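(* Consider tilt-stable form data $(S,V_{\rm e},\mathcal E,\mathcal M_{\rm adm},H_{\rm reg},\kappa)$ as defined in the context. Let $\mu\in\mathcal M_{\rm adm}$, let $\Lambda>0$ be an eigenvalue of $A_\mu$ of multiplicity $r$, let $\phi_1,\dots,\phi_r$ be a real $L^2(\mu)$-orthonormal basis of $E_\mu(\Lambda)=\ker(A_\mu-\Lambda)$, and let $f\in H_{\rm reg}$. Then there are $\varepsilon>0$ and real-analytic functions $\lambda_j:(-\varepsilon,\varepsilon)\to\mathbb R$, $1\le j\le r$, listing the eigenvalues of $\widehat A_{\tau,f}$ issuing from $\Lambda$ (so $\lambda_j(0)=\Lambda$). In the basis $(\phi_i)$, $$\big(\langle B_f^\Lambda(\mu)\phi_j,\phi_i\rangle_{L^2(\mu)}\big)_{i,j}=-\kappa\Lambda\Big(\int_S f\phi_i\phi_j\,d\mu\Big)_{i,j}.$$ Moreover, as multisets, $$\{\lambda_1'(0),\dots,\lambda_r'(0)\}=\operatorname{Spec}\big(B_f^\Lambda(\mu)\big).$$ The statement is independent of the choice of basis.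
   Context: Tilt-stable form data: $S$ is a locally compact second-countable Hausdorff space; $V_{\rm e}$ a real linear space of functions on $S$; $\mathcal E$ a non-negative symmetric bilinear form on $V_{\rm e}$; $\mathcal M_{\rm adm}$ a class of finite positive Radon measures on $S$; $H_{\rm reg}$ a linear space of bounded Borel functions on $S$ (contained in the Cameron--Martin space $H$ of an abstract Wiener space $(X,H,\mathbb P)$); $\kappa>0$. For $\mu\in\mathcal M_{\rm adm}$ let $V_\mu=V_{\rm e}\cap L^2(\mu)$ (elements regarded in $L^2(\mu)$), $\|u\|_{\mathcal E,\mu}^2=\mathcal E(u,u)+\|u\|^2_{L^2(\mu)}$. It is assumed that for every $\mu\in\mathcal M_{\rm adm}$ and $f\in H_{\rm reg}$: (a) $(\mathcal E,V_\mu)$ is a densely defined closed form on $L^2(\mu)$, $\dim L^2(\mu)=\infty$, and $(V_\mu,\|\cdot\|_{\mathcal E,\mu})\hookrightarrow L^2(\mu)$ is compact; (b) $fV_\mu\subset V_\mu$; (c) $e^{\kappa f}\mu\in\mathcal M_{\rm adm}$. $A_\mu$ is the non-negative self-adjoint operator on $L^2(\mu)$ associated with $(\mathcal E,V_\mu)$; it has compact resolvent. A reference measure $\rho\in\{0\}\cup\mathcal P(S)$ and a nonzero countable $\mathbb Q$-vector space $\mathcal Q\subset H_{\rm reg}$ are also fixed (they play no role in this statement). For $f\in H_{\rm reg}$, $\tau\in\mathbb R$: $d\mu_\tau=e^{\kappa\tau f}d\mu$; $U_{\tau,f}:L^2(\mu_\tau)\to L^2(\mu)$ is the unitary $U_{\tau,f}u=e^{\kappa\tau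 f/2}u$; $\widehat A_{\tau,f}=U_{\tau,f}A_{\mu_\tau}U_{\tau,f}^{-1}$. $P_\Lambda^\mu$ is the $L^2(\mu)$-orthogonal projection onto $E_\mu(\Lambda)$ (a real Hilbert space), $\operatorname{Mult}_f$ is multiplication by $f$, and the first-order response operator is $B_f^\Lambda(\mu):=-\kappa\Lambda\,P_\Lambda^\mu\operatorname{Mult}_f|_{E_\mu(\Lambda)}$. *)

(* Defs.v *)
From HB Require Import structures.
From mathcomp Require Import all_boot all_order all_algebra.
From mathcomp Require Import all_classical all_reals all_analysis.
From mathcomp Require Import measurable_realfun.

Set Implicit Arguments.
Unset Strict Implicit.
Unset Printing Implicit Defensive.

Import Order.TTheory GRing.Theory Num.Theory.
Import numFieldNormedType.Exports.

Local Open Scope classical_set_scope.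
Local Open Scope ring_scope.

(* The Borel sigma-algebra. The library puts generated sigma-algebras on
   pointed types only, whence [ptopologicalType] below (a nonempty space). *)
Notation borel S := (g_sigma_algebraType (@open S)).

Definition linear_subspace (R : realType) (V : lmodType R) (W : set V) :=
  W 0 /\ forall (a : R) u v, W u -> W v -> W (a *: u + v).

(* Non-negative symmetric bilinear form on the linear subspace [W]. *)
Definition nonneg_sym_bilinear (R : realType) (V : lmodType R) (W : set V)
    (B : V -> V -> R) :=
  [/\ forall (a : R) u v w, W u -> W v -> W w ->
        B (a *: u + v) w = a * B u w + B v w,
      forall u v, W u -> W v -> B u v = B v u
    & forall u, W u -> 0 <= B u u].

(* [W] is complete for the seminorm [nm]. *)
Definition complete_for (R : realType) (V : lmodType R) (W : set V)
    (nm : V -> R) :=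
  forall w : nat -> V, (forall n, W (w n)) ->
    (forall e : R, 0 < e -> exists N : nat, forall m n : nat,
       (N <= m)%N -> (N <= n)%N -> nm (w m - w n) < e) ->
    exists2 w0, W w0 & (fun n => nm (w n - w0)) @ \oo --> (0 : R).

(* [g] is real-analytic at every point of the open set [D]. *)
Definition real_analytic_on (R : realType) (D : set R) (g : R -> R) :=
  forall t0, D t0 -> exists a : nat -> R,
    \forall t \near t0, pseries a (t - t0) @ \oo --> g t.

Section TiltedMeasure.
Context d (T : measurableType d) (R : realType).
Variables (mu : {measure set T -> \bar R}) (g : {mfun T >-> R}).

(* The measure e^g mu. *)
Definition tilt (A : set T) : \bar R := (\int[mu]_(x in A) (expR (g x))%:E)%E.

Let tilt0 : tilt set0 = 0%E.
Proof. exact: integral_set0. Qed.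

Let tilt_ge0 A : (0 <= tilt A)%E.
Proof. by apply: integral_ge0 => x _; rewrite lee_fin expR_ge0. Qed.

Let tilt_sigma_additive : semi_sigma_additive tilt.
Proof.
move=> F mF tF mUF.
have mg : measurable_fun (\bigcup_k F k) (EFin \o (expR \o g)).
  apply/measurable_EFinP; apply: measurable_funTS.
  exact: measurableT_comp.
have g0 x : (\bigcup_k F k) x -> (0 <= (expR (g x))%:E)%E.
  by rewrite lee_fin expR_ge0.
rewrite /tilt (ge0_integral_bigcup _ mF mg g0 tF).
by apply: is_cvg_ereal_nneg_natsum_cond => n _ _; exact: tilt_ge0.
Qed.

HB.instance Definition _ :=
  isMeasure.Build d T R tilt tilt0 tilt_ge0 tilt_sigma_additive.

End TiltedMeasure.

(* L^2(mu) is represented by the square-integrable functions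
   [Lfun mu 2%:E], its elements being equal when they agree mu-a.e.; all
   subspaces of L^2(mu) below are stable under mu-a.e. equality. *)
Section L2.
Context d (T : measurableType d) (R : realType).
Variable mu : {measure set T -> \bar R}.
Implicit Types (u v w : T -> R) (W : set (T -> R)).

Definition L2 : set (T -> R) := [set u | u \in Lfun mu 2%:E].

Definition L2dot u v : R := \int[mu]_x (u x * v x).

Definition L2norm u : R := Num.sqrt (L2dot u u).

(* [W] has dimension [n] as a subspace of L^2(mu). *)
Definition L2dim W (n : nat) :=
  exists e : 'I_n -> T -> R, (forall i, W (e i)) /\
    forall u, W u -> exists! c : {ffun 'I_n -> R},
      u = (fun x => \sum_(i < n) c i * e i x) %[ae mu].

Definition orthonormal_basis W (n : nat) (e : 'I_n -> T -> R) :=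
  [/\ forall i, W (e i),
      forall i j, L2dot (e i) (e j) = (i == j)%:R
    & forall u, W u -> exists c : 'I_n -> R,
        u = (fun x => \sum_(i < n) c i * e i x) %[ae mu]].

(* The orthogonal projection onto [W]; its value is determined mu-a.e. *)
Definition orth_proj W u : T -> R :=
  xget (cst 0) [set w | W w /\ forall v, W v -> L2dot (u \- w) v = 0].

Definition graph_on W (B : (T -> R) -> T -> R) (u v : T -> R) :=
  W u /\ v = B u %[ae mu].

End L2.

(* Unbounded operators are given by their graphs: [A u v] means that u is in
   the domain of A and A u = v. *)
Definition op_eigenspace (T : Type) (R : realType)
    (A : (T -> R) -> (T -> R) -> Prop) (nu : R) : set (T -> R) :=
  [set u | A u (fun x => nu * u x)].

(* U A U^-1 for an operator A given by its graph. *)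
Definition conjugate_op (F G : Type) (U : F -> G) (A : F -> F -> Prop)
    (v w : G) :=
  exists u1 u2, [/\ A u1 u2, v = U u1 & w = U u2].

Section AbstractWiener.
Context (R : realType) (X : completeNormedModType R).

(* (X, H, P) is an abstract Wiener space: X is a separable Banach space, H is a
   Hilbert space continuously and densely included in X, and P is the centred
   Gaussian measure such that every continuous linear functional l on X has law
   N(0, s^2) under P, with s the norm of the restriction of l to H. *)
Definition abstract_Wiener_space (H : set X) (dotH : X -> X -> R)
    (P : probability (borel X) R) :=
  let normH h := Num.sqrt (dotH h h) in
  [/\ (exists2 Q : set X, countable Q & dense Q),
      [/\ linear_subspace H,
          nonneg_sym_bilinear H dotH,
          (forall h, H h -> dotH h h = 0 -> h = 0)
        & complete_for H normH],
      (exists C : R, forall h, H h -> `|h| <= C * normH h),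
      dense H
    & forall l : {linear X -> R^o}, continuous l ->
        let s := sup [set `|l h| | h in [set h | H h /\ normH h <= 1]] in
        \int[P]_x cos (l x) = expR (- (s ^+ 2 / 2)) /\
        \int[P]_x sin (l x) = 0 ].

End AbstractWiener.

Section Forms.
Context (R : realType) (S : ptopologicalType).
Variables (Ve : set (S -> R)) (E : (S -> R) -> (S -> R) -> R).
Variable mu : {measure set (borel S) -> \bar R}.

(* V_mu, the elements of L^2(mu) having a representative in V_e. *)
Definition Vmu : set (S -> R) :=
  [set w | L2 mu w /\ exists2 u, Ve u & w = u %[ae mu]].

Definition Ve_repr (w : S -> R) : S -> R :=
  xget (cst 0) [set u | Ve u /\ w = u %[ae mu]].

(* The form E on V_mu. *)
Definition Emu (u v : S -> R) : R := E (Ve_repr u) (Ve_repr v).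

Definition Enorm (u : S -> R) : R := Num.sqrt (Emu u u + L2norm mu u ^+ 2).

(* The first condition says that E is well defined on classes. *)
Definition densely_defined_closed_form :=
  [/\ forall u, Ve u -> u = cst 0 %[ae mu] -> E u u = 0,
      forall u, L2 mu u -> forall e : R, 0 < e ->
        exists2 v, Vmu v & L2norm mu (u \- v) < e
    & complete_for (Vmu : set (S -> R^o)) Enorm].

Definition compact_embedding :=
  forall w : nat -> S -> R, (forall n, Vmu (w n)) ->
    (exists M : R, forall n, Enorm (w n) <= M) ->
    exists k : nat -> nat, exists2 w0, L2 mu w0 &
      (forall n : nat, (k n < k n.+1)%N) /\
      (fun n => L2norm mu (w (k n) \- w0)) @ \oo --> (0 : R).

(* The self-adjoint operator A_mu associated with (E, V_mu). *)
Definition form_op (u v : S -> R) :=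
  [/\ Vmu u, L2 mu v & forall w, Vmu w -> Emu u w = L2dot mu v w].

End Forms.

Record tilt_stable_form_data (R : realType) (S : ptopologicalType) := {
  Ve : set (S -> R);
  Eform : (S -> R) -> (S -> R) -> R;
  (* Only the values of a [{measure set _ -> _}] on Borel sets are meaningful:
     [Madm] may contain several representatives of the same measure. *)
  Madm : set {measure set (borel S) -> \bar R};
  Hreg : set {mfun (borel S) >-> R};
  kappa : R;
  rho : {measure set (borel S) -> \bar R};
  Qreg : set {mfun (borel S) >-> R};

  S_hausdorff : hausdorff_space S;
  S_locally_compact : locally_compact [set: S];
  S_second_countable : @second_countable S;

  Ve_linear : linear_subspace (Ve : set (S -> R^o));
  E_form : nonneg_sym_bilinear (Ve : set (S -> R^o)) Eform;

  Madm_finite : forall mu, Madm mu -> (mu [set: S] < +oo)%E;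
  Madm_radon : forall mu, Madm mu -> forall A : set (borel S), measurable A ->
    mu A = ereal_sup [set mu K | K in [set K : set S | compact K /\ K `<=` A]];

  Hreg_linear : linear_subspace Hreg;
  Hreg_bounded : forall f, Hreg f -> exists M : R, forall x, `|f x| <= M;
  Hreg_Cameron_Martin :
    exists (X : completeNormedModType R) (H : set X) (dotH : X -> X -> R)
        (P : probability (borel X) R) (j : {mfun (borel S) >-> R} -> X),
      [/\ abstract_Wiener_space H dotH P,
          forall (a : R) f g, Hreg f -> Hreg g ->
            j (a *: f + g) = a *: j f + j g,
          {in Hreg &, injective j}
        & forall f, Hreg f -> H (j f)];

  kappa_gt0 : 0 < kappa;

  form_closed : forall mu, Madm mu -> densely_defined_closed_form Ve Eform mu;
  L2_infinite_dim : forall mu, Madm mu -> forall n, ~ L2dim mu (L2 mu) n;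
  form_compact : forall mu, Madm mu -> compact_embedding Ve Eform mu;

  Hreg_mul : forall mu f, Madm mu -> Hreg f ->
    forall u, Vmu Ve mu u -> Vmu Ve mu (f \* u);

  Madm_tilt : forall mu f, Madm mu -> Hreg f -> Madm (tilt mu (kappa *: f));

  rho_mass : rho [set: S] = 0%E \/ rho [set: S] = 1%E;
  Qreg_sub : Qreg `<=` Hreg;
  Qreg_countable : countable Qreg;
  Qreg_nonzero : exists2 f, Qreg f & f != 0;
  Qreg_add : forall f g, Qreg f -> Qreg g -> Qreg (f + g);
  Qreg_scale : forall (q : rat) f, Qreg f -> Qreg (ratr q *: f);
}.

Section Operators.
Context (R : realType) (S : ptopologicalType) (D : tilt_stable_form_data R S).
Variable mu : {measure set (borel S) -> \bar R}.
Implicit Types (f : {mfun (borel S) >-> R}) (Lam tau : R).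

Definition Aop := form_op (Ve D) (Eform D) mu.

Definition eigsp Lam : set (S -> R) := op_eigenspace Aop Lam.

Definition eigenvalue_of_mult Lam (r : nat) :=
  (0 < r)%N /\ L2dim mu (eigsp Lam) r.

Definition tilted f tau : {measure set (borel S) -> \bar R} :=
  tilt mu ((kappa D * tau) *: f).

Definition Utilt f tau (u : S -> R) : S -> R :=
  fun x => expR (kappa D * tau * f x / 2) * u x.

(* B_f^Lam(mu), as an operator on [eigsp Lam]. *)
Definition response f Lam (u : S -> R) : S -> R :=
  fun x => - kappa D * Lam * orth_proj mu (eigsp Lam) (f \* u) x.

(* The multiset {s_1, ..., s_r} is the spectrum of the self-adjoint operator
   B_f^Lam(mu), each eigenvalue being counted with its multiplicity. *)
Definition response_spectrum f Lam (r : nat) (s : 'I_r -> R) :=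
  forall nu : R,
    L2dim mu (op_eigenspace (graph_on mu (eigsp Lam) (response f Lam)) nu)
      #|[pred j | s j == nu]|.

End Operators.

(* U_{tau,f} A_{mu_tau} U_{tau,f}^-1 *)
Definition hatA (R : realType) (S : ptopologicalType)
    (D : tilt_stable_form_data R S) (mu : {measure set (borel S) -> \bar R})
    (f : {mfun (borel S) >-> R}) (tau : R) :=
  conjugate_op (Utilt D f tau) (Aop D (tilted D mu f tau)).

(* For |tau| < eps, the eigenvalues of \hat A_{tau,f} in some fixed
   neighbourhood of Lam, repeated according to multiplicity, are
   lam_1(tau), ..., lam_r(tau), and all of these issue from Lam. *)
Definition lists_eigenvalues_from (R : realType) (S : ptopologicalType)
    (D : tilt_stable_form_data R S) (mu : {measure set (borel S) -> \bar R})
    (f : {mfun (borel S) >-> R}) (Lam eps : R) (r : nat)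
    (lam : 'I_r -> R -> R) :=
  (forall j, lam j 0 = Lam) /\
  exists2 delta : R, 0 < delta &
    forall tau : R, `|tau| < eps ->
      (forall j, `|lam j tau - Lam| < delta) /\
      (forall nu : R, `|nu - Lam| < delta ->
         L2dim mu (op_eigenspace (hatA D mu f tau) nu)
           #|[pred j | lam j tau == nu]|).

Definition response_matrix_formula (R : realType) (S : ptopologicalType)
    (D : tilt_stable_form_data R S) (mu : {measure set (borel S) -> \bar R})
    (f : {mfun (borel S) >-> R}) (Lam : R) (r : nat) (phi : 'I_r -> S -> R) :=
  \matrix_(i < r, j < r) L2dot mu (response D mu f Lam (phi j)) (phi i) =
  (- kappa D * Lam) *:
    \matrix_(i < r, j < r) (\int[mu]_x (f x * phi i x * phi j x)).

(* Main.v *)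
(** The form is the same for all the measures of the tilt: conjugating by
    [Utilt] turns the eigenvalue equation of the tilted operator into
    E(u, w) = nu m_t(u, w) on V_mu, with m_t(u, w) the integral of
    e^(kappa t f) u w, a power series in t whose coefficients are bounded forms
    on L^2(mu).  Compactness makes E - Lam m_0 invertible transversally to the
    eigenspace, so the spectral subspace issuing from Lam has a basis z_j(t) with
    E(z_j, w) = sum_i L_ij(t) m_t(z_i, w), where z and the r x r matrix L are
    found as power series and a quadratic majorant gives convergence.  L(t) is
    selfadjoint for the Gram matrix of m_t, L(0) = Lam, and L'(0) is the matrix
    of the response operator.  Hence L(t) = Lam + t L_1(t) where L_1(t) has real
    roots only, and Rellich's theorem (analyticity of the roots of a real-rooted
    monic polynomial with analytic coefficients) applied to its characteristic
    polynomial gives lam_j(t) = Lam + t mu_j(t), with the mu_j(0) = lam_j'(0)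
    being the eigenvalues of L_1(0) = L'(0). *)

(* Since [Lam] may be multiple, single eigenvectors have no canonical expansion; the space issuing
   from the whole eigenspace has one, and the normalization b(z_j, phi_i) = delta_ij selects its
   basis. Dividing L(t) - Lam by t preserves selfadjointness for the Gram matrix because L(0) is
   scalar.

   Producing r branches is not enough: no other eigenvalue may lie near [Lam]. A solution u with
   eigenvalue near [Lam] is compared with its m_t-orthogonal projection on the span of the z_j. The
   difference solves the same equation and is nearly orthogonal to the phi_i, so coercivity bounds
   its norm by 3/8 of itself. Multiplicities are then dimensions of kernels of L(t) - nu, hence
   ranks.

   Functions are not identified almost everywhere, so the forms are only semidefinite: equalities of
   vectors hold up to null vectors and are tested through bounded functionals. *)
From HB Require Import structures.
Require Import Defs.
From mathcomp Require Import all_boot all_order all_algebra.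
From mathcomp Require Import all_classical all_reals all_analysis.
From mathcomp Require Import measurable_realfun.
From mathcomp Require Import complex ring lra zify.
Import Order.TTheory GRing.Theory Num.Theory.
Import numFieldNormedType.Exports.
Local Open Scope classical_set_scope.
Local Open Scope ring_scope.
Set Implicit Arguments.
Unset Strict Implicit.
Unset Printing Implicit Defensive.

(** * Power series *)

Section DoubleSeries.
Variable R : realType.
Implicit Types (u v w : nat -> R) (F : nat -> nat -> R).

Lemma cvg_dist_le u v w (l : R) : (forall n, `|u n - v n| <= w n) ->
  w @ \oo --> (0 : R) -> v @ \oo --> l -> u @ \oo --> l.
Proof.
move=> uvw w0 vl.
have uv0 : (fun n => u n - v n) @ \oo --> (0 : R).
  apply: norm_cvg0; apply: (@squeeze_cvgr _ _ _ _ (fun=> 0) w) => //.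
    by apply: nearW => n; rewrite normr_ge0 uvw.
  exact: cvg_cst.
have -> : u = (fun n => u n - v n) \+ v by apply/funext => n /=; rewrite subrK.
by rewrite -[l]add0r; exact: cvgD.
Qed.

Lemma abs_series_cvg u (K : R) : (forall n, \sum_(0 <= k < n) `|u k| <= K) ->
  exists2 l : R, series u @ \oo --> l & `|l| <= K.
Proof.
move=> uK.
have c : cvgn [normed series u].
  apply: nondecreasing_is_cvgn; last by exists K => _ [n _ <-]; exact: uK.
  by apply: nondecreasing_series => n _ _; exact: normr_ge0.
have /normed_cvg c' := c.
exists (limn (series u)) => //.
apply: le_trans (lim_series_norm c) _.
by apply: limr_le => //; apply: nearW => n; exact: uK.
Qed.

Lemma cauchy_le_cvg u w : (forall N M, (N <= M)%N -> `|u M - u N| <= w N) ->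
  w @ \oo --> (0 : R) -> exists l : R, u @ \oo --> l.
Proof.
move=> uw w0; suff : cvgn u by move=> ?; exists (limn u).
apply/cauchy_cvgP; apply: cauchy_exP => e e0.
move/cvgrPdist_lt: w0 => /(_ e e0)[N _ wN].
exists (u N); exists N => // M /= NM; rewrite /ball /= distrC.
apply: le_lt_trans (uw _ _ NM) _.
by have := wN N (leqnn N); rewrite /= sub0r normrN; apply: le_lt_trans (ler_norm _).
Qed.

Lemma cvg_sumr (T I : Type) (G : set_system T) (FG : ProperFilter G) (s : seq I)
    (P : pred I) (f : I -> T -> R) (l : I -> R) :
  (forall i, P i -> f i @ G --> l i) ->
  (fun x => \sum_(i <- s | P i) f i x) @ G --> \sum_(i <- s | P i) l i.
Proof.
move=> fl; elim: s => [|i s IH].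
  under eq_fun do rewrite big_nil.
  by rewrite big_nil; exact: cvg_cst.
under eq_fun do rewrite big_cons.
rewrite big_cons; case: ifPn => // Pi.
by apply: cvgD => //; exact: fl.
Qed.

Lemma cvg_le_bound (T : Type) (G : set_system T) (FG : ProperFilter G)
    (f : T -> R) (l K : R) :
  f @ G --> l -> (\forall x \near G, f x <= K) -> l <= K.
Proof.
move=> fl fK; rewrite -(cvg_lim _ fl) //; apply: limr_le => //.
by apply/cvg_ex; exists l.
Qed.

Lemma cvg_half : half @ \oo --> \oo.
Proof.
apply/cvgnyPge => A; near=> n.
have : (A.*2 <= n)%N by near: n; exact: nbhs_infty_ge.
lia.
Unshelve. all: by end_near.
Qed.

(** Sums over squares, strips and triangles of index pairs are all instances inside one common box,
    so that they can be compared by inclusion of the regions. *)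
Definition pairsum (M : nat) (P : nat -> nat -> bool) F :=
  \sum_(0 <= k < M) \sum_(0 <= l < M) if P k l then F k l else 0.

Lemma pairsum_dist M (P Q : nat -> nat -> bool) F :
  (forall k l, P k l -> Q k l) ->
  `|pairsum M Q F - pairsum M P F| <=
  pairsum M Q (fun k l => `|F k l|) - pairsum M P (fun k l => `|F k l|).
Proof.
move=> PQ; rewrite /pairsum -!sumrB.
apply: le_trans (ler_norm_sum _ _ _) _; apply: ler_sum => k _.
rewrite -!sumrB.
apply: le_trans (ler_norm_sum _ _ _) _; apply: ler_sum => l _.
have := PQ k l; case: (P k l) => [-> //|_]; first by rewrite !subrr normr0.
by case: (Q k l); rewrite !subr0 ?normr0.
Qed.

Lemma pairsum_le M (P Q : nat -> nat -> bool) F :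
  (forall k l, P k l -> Q k l) ->
  pairsum M P (fun k l => `|F k l|) <= pairsum M Q (fun k l => `|F k l|).
Proof.
move=> PQ; apply: ler_sum => k _; apply: ler_sum => l _.
by have := PQ k l; case: (P k l) => [->//|_]; case: (Q k l).
Qed.

Lemma pairsum_box M N F : (N <= M)%N ->
  pairsum M (fun k l => (k < N) && (l < N))%N F =
  \sum_(0 <= k < N) \sum_(0 <= l < N) F k l.
Proof.
move=> NM; rewrite /pairsum (big_cat_nat (n := N)) //= [X in _ + X]big1_seq ?addr0.
  apply: eq_big_nat => k /andP[_ kN]; rewrite (big_cat_nat (n := N)) //=.
  rewrite [X in _ + X]big1_seq ?addr0.
    by apply: eq_big_nat => l /andP[_ lN]; rewrite kN lN.
  move=> l /andP[_]; rewrite mem_index_iota => /andP[Nl _].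
  by rewrite [(l < N)%N]ltnNge Nl andbF.
move=> k /andP[_]; rewrite mem_index_iota => /andP[Nk _].
by rewrite big1 // => l _; rewrite [(k < N)%N]ltnNge Nk.
Qed.

Lemma pairsum_diag M N F : (N <= M)%N ->
  pairsum M (fun k l => k + l < N)%N F =
  \sum_(0 <= n < N) \sum_(0 <= k < n.+1) F k (n - k)%N.
Proof.
elim: N => [_|N IH NM].
  by rewrite big_geq // /pairsum big1 // => k _; rewrite big1.
rewrite big_nat_recr //= -IH; last exact: ltnW.
apply/eqP; rewrite addrC -subr_eq; apply/eqP.
rewrite /pairsum -sumrB (big_cat_nat (n := N.+1)) //=.
rewrite [X in _ + X]big1_seq ?addr0; last first.
  move=> k /andP[_]; rewrite mem_index_iota => /andP[Nk _].
  rewrite -sumrB big1 // => l _.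
  by rewrite !ifF ?subrr //; lia.
apply: eq_big_nat => k /andP[_ kN].
have lM : (N - k < M)%N by lia.
rewrite -sumrB (bigD1_seq (N - k)%N) ?iota_uniq ?mem_index_iota //=.
rewrite ifT ?ifF ?subr0; [|lia|lia].
rewrite big1 ?addr0 // => l lk.
have -> : (k + l < N.+1 = (k + l < N))%N by lia.
by rewrite subrr.
Qed.

(** Fubini for an absolutely summable double family, by rows and by diagonals [k + l = n]. The
    square sums of [F] converge because those of its absolute values are bounded and monotone.
    Strips of rows and triangles contain a square, and what they have outside it is dominated by the
    tail of the absolute sums. *)
Lemma diag_sum F (K : R) (r : nat -> R) :
  (forall N, \sum_(0 <= k < N) \sum_(0 <= l < N) `|F k l| <= K) ->
  (forall k, series (F k) @ \oo --> r k) ->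
  exists S : R, [/\ series r @ \oo --> S,
    series (fun n => \sum_(0 <= k < n.+1) F k (n - k)%N) @ \oo --> S
    & `|S| <= K].
Proof.
move=> FK rF.
pose T N := \sum_(0 <= k < N) \sum_(0 <= l < N) `|F k l|.
pose B N := \sum_(0 <= k < N) \sum_(0 <= l < N) F k l.
have Tbox M N : (N <= M)%N ->
    T N = pairsum M (fun k l => (k < N) && (l < N))%N (fun k l => `|F k l|).
  by move=> NM; rewrite pairsum_box.
have TT N M : (N <= M)%N -> T N <= T M.
  move=> NM; rewrite (Tbox M N) // (Tbox M M) //.
  by apply: pairsum_le => k l /andP[? ?]; apply/andP; split; lia.
have Tc : cvgn T.
  apply: nondecreasing_is_cvgn; last by exists K => _ [n _ <-]; exact: FK.
  by move=> n m nm; exact: TT.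
have Tlim N : T N <= limn T by apply: nondecreasing_cvgn_le => // n m; exact: TT.
have T0 : (fun N => limn T - T N) @ \oo --> (0 : R).
  by rewrite -[0](subrr (limn T)); apply: cvgB => //; exact: cvg_cst.
have BT N M : (N <= M)%N -> `|B M - B N| <= T M - T N.
  move=> NM; rewrite (Tbox M N) // (Tbox M M) // /B.
  rewrite -(pairsum_box F NM) -(pairsum_box F (leqnn M)).
  by apply: pairsum_dist => k l /andP[? ?]; apply/andP; split; lia.
have [S BS] : exists S : R, B @ \oo --> S.
  apply: cauchy_le_cvg T0 => N M NM; apply: le_trans (BT _ _ NM) _.
  exact: lerB.
exists S.
(* The first [N] rows are limits of strips of length [M], which lie between the squares of sides [N]
   and [M]. *)
have bR N : `|series r N - B N| <= limn T - T N.
  have h : (fun M => \sum_(0 <= k < N) \sum_(0 <= l < M) F k l) @ \oo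
      --> series r N.
    by apply: cvg_sumr => k _; exact: rF.
  have h2 : (fun M => `|(\sum_(0 <= k < N) \sum_(0 <= l < M) F k l) - B N|)
      @ \oo --> `|series r N - B N|.
    by apply: cvg_norm; apply: cvgB => //; exact: cvg_cst.
  apply: (@cvg_le_bound nat \oo _ _ _ _ h2).
  near=> M.
  have NM : (N <= M)%N by near: M; exact: nbhs_infty_ge.
  apply: (@le_trans _ _ (T M - T N)); last by rewrite lerB.
  rewrite (Tbox M N) // (Tbox M M) // /B -(pairsum_box F NM).
  have -> : \sum_(0 <= k < N) \sum_(0 <= l < M) F k l =
     pairsum M (fun k l => (k < N)%N) F.
    rewrite /pairsum [RHS](big_cat_nat (n := N)) //= [X in _ = _ + X]big1_seq ?addr0.
      by apply: eq_big_nat => k /andP[_ kN]; rewrite kN.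
    move=> k /andP[_]; rewrite mem_index_iota => /andP[Nk _].
    by rewrite big1 // => l _; rewrite ltnNge Nk.
  apply: le_trans (pairsum_dist _ _ _) _; first by move=> k l /andP[].
  rewrite lerB //; apply: ler_sum_nat => k kM; apply: ler_sum_nat => l lM.
  rewrite /= [leRHS]ifT; last lia.
  by case: ifP.
split.
- exact: (cvg_dist_le bR T0 BS).
(* The triangle [k + l < M] contains the square of side [M./2] and lies in that of side [M]. *)
- apply: (@cvg_dist_le _ (fun M => B M./2) (fun M => limn T - T M./2)).
  + move=> M; have hM : (M./2 <= M)%N by lia.
    apply: (@le_trans _ _ (T M - T M./2)); last by rewrite lerB.
    rewrite (Tbox M M./2) // (Tbox M M) // /B -(pairsum_box F hM).
    rewrite {1}/series /= -(pairsum_diag F (leqnn M)).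
    apply: le_trans (pairsum_dist _ _ _) _; first by move=> k l; lia.
    rewrite lerB //; apply: ler_sum_nat => k kM; apply: ler_sum_nat => l lM.
    rewrite /= [leRHS]ifT; last lia.
    by case: ifP.
  + exact: (cvg_comp _ _ cvg_half T0).
  + exact: (cvg_comp _ _ cvg_half BS).
- have h := cvg_norm BS.
  suff h' : \forall N \near \oo, `|B N| <= K by exact: (cvg_le_bound _ (h _) h').
  apply: nearW => N; apply: le_trans (FK N).
  apply: le_trans (ler_norm_sum _ _ _) _; apply: ler_sum => k _.
  exact: ler_norm_sum.
Unshelve. all: by end_near.
Qed.

Lemma conv_le u v N : (forall n, 0 <= u n) -> (forall n, 0 <= v n) ->
  \sum_(0 <= n < N) \sum_(0 <= k < n.+1) u k * v (n - k)%N <=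
  (\sum_(0 <= k < N) u k) * (\sum_(0 <= l < N) v l).
Proof.
move=> u0 v0.
rewrite -(pairsum_diag (fun k l => u k * v l) (leqnn N)) mulr_suml.
apply: ler_sum => k _; rewrite mulr_sumr; apply: ler_sum => l _.
by case: ifP => // _; exact: mulr_ge0.
Qed.

Lemma geometric_sum_le (x : R) N : 0 <= x -> x <= 2^-1 ->
  \sum_(1 <= k < N.+1) x ^+ k <= 2 * x.
Proof.
(* The bound with the remainder [2 * x ^+ N.+1] is the one that is stable under induction. *)
move=> x0 x2; suff : \sum_(1 <= k < N.+1) x ^+ k <= 2 * x - 2 * x ^+ N.+1.
  move/le_trans; apply; rewrite lerBlDr lerDl mulr_ge0 //; exact: exprn_ge0.
elim: N => [|N IH]; first by rewrite big_geq // expr1 subrr.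
rewrite big_nat_recr //=.
have := ler_wpM2r (exprn_ge0 N.+1 x0) x2.
rewrite -exprS; move: IH; lra.
Qed.

(* The weighted sums [s] of [y m * sg ^+ m] over [1 <= m <= M] satisfy
   [s <= A * (th + s' ^+ 2 + th * (y 0 + s') ^+ 2)], where [s'] is the sum up
   to [M - 1] and [th] vanishes with [sg]. *)
Lemma quadratic_majorant (y : nat -> R) (A B : R) :
  0 < A -> 0 < B -> (forall n, 0 <= y n) ->
  (forall m, (0 < m)%N -> y m <= A * (B ^+ m +
     \sum_(1 <= l < m) y l * y (m - l)%N +
     \sum_(1 <= k < m.+1) B ^+ k *
        \sum_(0 <= l < (m - k).+1) y l * y (m - k - l)%N)) ->
  exists sg K : R, 0 < sg /\
    forall N, \sum_(0 <= n < N) y n * sg ^+ n <= K.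
Proof.
move=> A0 B0 y0 yle.
(* [eta] is the bound to be propagated: [A * eta ^+ 2 = eta / 2], and [th] is taken so small that
   the two remaining terms contribute at most [eta / 2]. *)
pose eta := (2 * A)^-1; have eta0 : 0 < eta by rewrite invr_gt0; lra.
pose D := 1 + (y 0%N + eta) ^+ 2.
have D1 : 1 <= D by rewrite lerDl sqr_ge0.
pose th := Num.min 1 (eta / (2 * A * D)).
have th0 : 0 < th.
  rewrite lt_min ltr01 divr_gt0 //; apply: mulr_gt0; lra.
have thD : A * (th * D) <= eta / 2.
  have : th <= eta / (2 * A * D) by rewrite ge_min lexx orbT.
  have AD : 0 < 2 * A * D by apply: mulr_gt0; lra.
  rewrite ler_pdivlMr //; lra.
have th1 : th <= 1 by rewrite ge_min lexx.
(* This weight gives [2 * (B * sg) = th], so that the geometric sums of [B * sg] stay below [th]. *)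
pose sg : R := th / (2 * B); have sg0 : 0 < sg by rewrite divr_gt0 //; lra.
pose x := B * sg.
have xth : 2 * x = th by rewrite /x /sg; field; lra.
have x0 : 0 < x by rewrite mulr_gt0.
have x2 : x <= 2^-1 by lra.
pose Y n := y n * sg ^+ n.
have Y0 n : 0 <= Y n by rewrite mulr_ge0 // exprn_ge0 // ltW.
have Yle m : (0 < m)%N -> Y m <= A * (x ^+ m +
     \sum_(1 <= l < m) Y l * Y (m - l)%N +
     \sum_(1 <= k < m.+1) x ^+ k *
        \sum_(0 <= l < (m - k).+1) Y l * Y (m - k - l)%N).
  move=> m0; have sm : 0 <= sg ^+ m by rewrite exprn_ge0 // ltW.
  have := ler_wpM2r sm (yle m m0); rewrite -/(Y m) => /le_trans; apply.
  rewrite -mulrA ler_wpM2l ?(ltW A0) // !mulrDl -exprMn -/x !mulr_suml.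
  rewrite lerD //; first rewrite lerD2l.
    apply: ler_sum_nat => l /andP[l1 lm].
    by rewrite /Y mulrACA -exprD subnKC // ltnW.
  apply: ler_sum_nat => k /andP[k1 km].
  have -> : x ^+ k = B ^+ k * sg ^+ k by exact: exprMn.
  rewrite -!mulrA; apply: ler_wpM2l; first by rewrite exprn_ge0 // ltW.
  rewrite [sg ^+ m](_ : _ = sg ^+ k * sg ^+ (m - k)); last first.
    by rewrite -exprD subnKC.
  rewrite mulrCA; apply: ler_wpM2l; first by rewrite exprn_ge0 // ltW.
  rewrite mulr_suml.
  apply: ler_sum_nat => l /andP[_ lm].
  by rewrite /Y mulrACA -exprD subnKC.
have key M : \sum_(1 <= m < M.+1) Y m <= eta.
  elim: M => [|M IH]; first by rewrite big_geq // ltW.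
  (* Up to order [M.+1] the right-hand sides only see [Y] at orders at most [M]. The truncations
     [YT] and [cT] allow the convolutions to be bounded by products of full sums, which the
     induction hypothesis controls. *)
  pose YT l := if (0 < l <= M)%N then Y l else 0.
  pose c n := \sum_(0 <= l < n.+1) Y l * Y (n - l)%N.
  pose cT n := if (n <= M)%N then c n else 0.
  pose be k := if (0 < k)%N then x ^+ k else 0.
  have YT0 n : 0 <= YT n by rewrite /YT; case: ifP.
  have c0 n : 0 <= c n by apply: sumr_ge0 => l _; exact: mulr_ge0.
  have cT0 n : 0 <= cT n by rewrite /cT; case: ifP.
  have be0 n : 0 <= be n by rewrite /be; case: ifP => // _; exact/exprn_ge0/ltW.
  have sYT : \sum_(0 <= l < M.+2) YT l = \sum_(1 <= m < M.+1) Y m.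
    rewrite big_nat_recl // big_nat_recr //= {1 3}/YT /= ltnn addr0 add0r.
    rewrite big_add1 /=; apply: eq_big_nat => l lM.
    by rewrite /YT ifT //; move: lM; clear; lia.
  have sbe : \sum_(0 <= l < M.+2) be l <= th.
    rewrite big_nat_recl // {1}/be /= add0r -xth.
    apply: le_trans (geometric_sum_le M.+1 (ltW x0) x2).
    by rewrite big_add1.
  have scT : \sum_(0 <= l < M.+2) cT l <= (y 0%N + eta) ^+ 2.
    rewrite big_nat_recr //= {2}/cT ltnn addr0.
    rewrite (eq_big_nat _ _ (F2 := c)); last first.
      by move=> l lM; rewrite /cT ifT //; move: lM; clear; lia.
    apply: le_trans (conv_le _ Y0 Y0) _.
    rewrite -expr2 lerXn2r ?nnegrE ?sumr_ge0 //.
      by rewrite addr_ge0 // ltW.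
    by rewrite big_nat_recl // {1}/Y expr0 mulr1 lerD2l //; move: IH; rewrite big_add1.
  apply: (@le_trans _ _ (A * (th + eta ^+ 2 + th * (y 0%N + eta) ^+ 2))).
    apply: (@le_trans _ _ (\sum_(1 <= m < M.+2) A * (x ^+ m +
       \sum_(0 <= l < m.+1) YT l * YT (m - l)%N +
       \sum_(0 <= k < m.+1) be k * cT (m - k)%N))).
      apply: ler_sum_nat => m /andP[m1 mM].
      apply: le_trans (Yle m m1) _; rewrite ler_wpM2l ?(ltW A0) // -!addrA lerD2l lerD //.
        rewrite [leRHS]big_nat_recl // {1}/YT /= mul0r add0r.
        case: m m1 mM => // m _ mM.
        rewrite [leRHS]big_nat_recr //= subnn {3}/YT /= mulr0 addr0 big_add1 /=.
        apply: ler_sum_nat => l lm; rewrite /YT !ifT //; move: lm mM; clear; lia.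
      rewrite [leRHS]big_nat_recl // {1}/be /= mul0r add0r big_add1 /=.
      apply: ler_sum_nat => k km; rewrite /be /cT ifT //; move: km mM; clear; lia.
    rewrite -mulr_sumr ler_wpM2l ?(ltW A0) // !big_split /=.
    rewrite !lerD //.
    - by rewrite -xth; exact: geometric_sum_le (ltW x0) x2.
    - apply: (@le_trans _ _ ((\sum_(0 <= l < M.+2) YT l) * (\sum_(0 <= l < M.+2) YT l))).
        apply: le_trans _ (conv_le _ YT0 YT0).
        rewrite [leRHS]big_nat_recl // big_add1 /= lerDr.
        by apply: sumr_ge0 => l _; exact: mulr_ge0.
      by rewrite -expr2 sYT lerXn2r ?nnegrE ?(ltW eta0) // sumr_ge0.
    - apply: (@le_trans _ _ ((\sum_(0 <= l < M.+2) be l) * (\sum_(0 <= l < M.+2) cT l))).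
        apply: le_trans _ (conv_le _ be0 cT0).
        rewrite [leRHS]big_nat_recl // big_add1 /= lerDr.
        by apply: sumr_ge0 => l _; exact: mulr_ge0.
      by rewrite ler_pM // sumr_ge0.
  have Ae : A * eta ^+ 2 = eta / 2 by rewrite /eta; field; lra.
  move: thD Ae; rewrite /D; lra.
exists sg, (y 0%N + eta); split => // -[|N].
  by rewrite big_geq // addr_ge0 // ltW.
by rewrite big_nat_recl // expr0 mulr1 lerD2l; move: (key N); rewrite big_add1.
Qed.

End DoubleSeries.

(** * Germs of analytic functions at 0 *)

Section AnalyticGerms.
Variable R : realType.
Implicit Types (a b : nat -> R) (g h : R -> R) (s t : R).

(** Absolute summability at the radius [s] itself keeps sums and products on the same closed
    interval and yields the coefficient bounds that feed the majorants. Outside that interval [g] is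
    unconstrained. *)
Definition ps_on s a g :=
  (exists K : R, forall n, \sum_(0 <= k < n) `|a k| * s ^+ k <= K) /\
  forall t, `|t| <= s -> series (fun n => a n * t ^+ n) @ \oo --> g t.

Definition an g := exists2 s, 0 < s & exists a, ps_on s a g.

Lemma ps_bound_shrink s s' a : 0 <= s' -> s' <= s ->
  (exists K : R, forall n, \sum_(0 <= k < n) `|a k| * s ^+ k <= K) ->
  (exists K : R, forall n, \sum_(0 <= k < n) `|a k| * s' ^+ k <= K).
Proof.
move=> s'0 s's [K aK]; exists K => n; apply: le_trans (aK n).
apply: ler_sum => k _; rewrite ler_wpM2l // lerXn2r ?nnegrE //.
exact: le_trans s's.
Qed.

Lemma ps_on_shrink s s' a g : 0 <= s' -> s' <= s -> ps_on s a g -> ps_on s' a g.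
Proof.
move=> s'0 s's [aK ag]; split; first exact: ps_bound_shrink aK.
by move=> t ts'; apply: ag; exact: le_trans s's.
Qed.

Lemma ps_on_bounded s a : 0 <= s ->
  (exists K : R, forall n, \sum_(0 <= k < n) `|a k| * s ^+ k <= K) ->
  exists g, ps_on s a g.
Proof.
move=> s0 aK; have [K aK'] := aK.
have c t : exists l : R, `|t| <= s -> series (fun n => a n * t ^+ n) @ \oo --> l.
  have [ts|_] := boolP (`|t| <= s); last by exists 0.
  have [n|l al _] := @abs_series_cvg R (fun n => a n * t ^+ n) K.
    apply: le_trans (aK' n); apply: ler_sum => k _.
    by rewrite normrM normrX ler_wpM2l // lerXn2r ?nnegrE.
  by exists l.
exists (fun t => projT1 (cid (c t))); split => // t ts.
by case: cid => l /= /(_ ts).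
Qed.

Lemma ps_on_at0 s a g : 0 <= s -> ps_on s a g -> g 0 = a 0%N.
Proof.
move=> s0 [_ /(_ 0)]; rewrite normr0 => /(_ s0) c.
have : series (fun n => a n * 0 ^+ n) @ \oo --> a 0%N.
  apply: (@cvg_dist_le _ _ (fun=> a 0%N) (fun n => if n is 0%N then `|a 0%N| else 0)).
  - case=> [|n]; first by rewrite /series /= big_geq // sub0r normrN.
    rewrite /series /= big_nat_recl // expr0 mulr1 big1 ?addr0 ?subrr ?normr0 //.
    by move=> i _; rewrite expr0n mulr0.
  - by rewrite -(@cvg_shiftn 1) /=; under eq_fun do rewrite addn1; exact: cvg_cst.
  - exact: cvg_cst.
by move/(cvg_lim (@Rhausdorff R)) => <-; move/(cvg_lim (@Rhausdorff R)): c.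
Qed.

Lemma ps_on_add s a b g h : 0 <= s -> ps_on s a g -> ps_on s b h ->
  ps_on s (a \+ b) (g \+ h).
Proof.
move=> s0 [[K aK] ag] [[L bL] bh]; split.
  exists (K + L) => n; apply: le_trans (lerD (aK n) (bL n)).
  rewrite -big_split /=; apply: ler_sum => k _; rewrite -mulrDl.
  by rewrite ler_wpM2r ?exprn_ge0 // ler_normD.
move=> t ts; have -> : series (fun n => (a \+ b) n * t ^+ n) =
    series (fun n => a n * t ^+ n) \+ series (fun n => b n * t ^+ n).
  apply/funext => n; rewrite /series /= -big_split /=.
  by apply: eq_bigr => k _; rewrite mulrDl.
by apply: cvgD; [exact: ag|exact: bh].
Qed.

Definition conv a b n := \sum_(0 <= k < n.+1) a k * b (n - k)%N.

Lemma ps_on_mul s a b g h : 0 <= s -> ps_on s a g -> ps_on s b h ->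
  ps_on s (conv a b) (g \* h).
Proof.
move=> s0 [[K aK] ag] [[L bL] bh].
have as0 k : 0 <= `|a k| * s ^+ k by rewrite mulr_ge0 // exprn_ge0.
have bs0 k : 0 <= `|b k| * s ^+ k by rewrite mulr_ge0 // exprn_ge0.
have K0 : 0 <= K by apply: le_trans (aK 0%N); rewrite big_geq.
have KL N : (\sum_(0 <= k < N) `|a k| * s ^+ k) *
    (\sum_(0 <= l < N) `|b l| * s ^+ l) <= K * L.
  by rewrite ler_pM // sumr_ge0.
split.
  exists (K * L) => N; apply: le_trans (KL N).
  apply: le_trans (conv_le _ as0 bs0); apply: ler_sum => n _.
  rewrite /conv; apply: le_trans (ler_wpM2r (exprn_ge0 _ s0) (ler_norm_sum _ _ _)) _.
  rewrite mulr_suml; apply: ler_sum_nat => k /andP[_ kn].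
  by rewrite normrM mulrACA -exprD subnKC.
move=> t ts.
pose F k l := (a k * t ^+ k) * (b l * t ^+ l).
have [N|k|S [S1 S2 _]] := @diag_sum R F (K * L) (fun k => a k * t ^+ k * h t).
- apply: le_trans (KL N); rewrite mulr_suml; apply: ler_sum => k _.
  rewrite mulr_sumr; apply: ler_sum => l _.
  rewrite /F !normrM !normrX ler_pM ?mulr_ge0 // ler_wpM2l //;
  by rewrite lerXn2r ?nnegrE.
- have -> : series (F k) = (fun n => a k * t ^+ k * series (fun l => b l * t ^+ l) n).
    by apply/funext => n; rewrite /series /= mulr_sumr.
  by apply: cvgMr; exact: bh.
have -> : series (fun n => conv a b n * t ^+ n) =
    series (fun n => \sum_(0 <= k < n.+1) F k (n - k)%N).
  apply/funext => n; rewrite /series /=; apply: eq_bigr => m _.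
  rewrite /conv mulr_suml; apply: eq_big_nat => k /andP[_ km].
  by rewrite /F mulrACA -exprD subnKC.
suff <- : S = (g \* h) t by [].
have : series (fun k => a k * t ^+ k * h t) @ \oo --> (g \* h) t.
  have -> : series (fun k => a k * t ^+ k * h t) =
      (fun n => series (fun l => a l * t ^+ l) n * h t).
    by apply/funext => n; rewrite /series /= mulr_suml.
  by apply: cvgMl; exact: ag.
by move/(cvg_lim (@Rhausdorff R)) => <-; move/(cvg_lim (@Rhausdorff R)): S1.
Qed.

Lemma ps_on_cst s (c : R) : 0 <= s ->
  ps_on s (fun n => if n is 0%N then c else 0) (fun=> c).
Proof.
move=> s0; split.
  exists `|c| => -[|n]; first by rewrite big_geq.
  rewrite big_nat_recl // expr0 mulr1 big1 ?addr0 //.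
  by move=> i _; rewrite normr0 mul0r.
move=> t _; rewrite -(@cvg_shiftn 1) /=.
rewrite [X in X @ _ --> _](_ : _ = fun=> c); first exact: cvg_cst.
apply/funext => n; rewrite addn1 /series /= big_nat_recl // expr0 mulr1 big1 ?addr0 //.
by move=> i _; rewrite mul0r.
Qed.

(** Division of a power series by [t]. The equation [g t = t * h t] leaves [h 0] free, so its value
    has to be prescribed. *)
Lemma ps_on_shift s a g h : 0 < s -> ps_on s a g -> a 0%N = 0 ->
  (forall t, g t = t * h t) -> h 0 = a 1%N -> ps_on s (fun n => a n.+1) h.
Proof.
move=> s0 [[K aK] ag] a0 gh h0; split.
  exists (K / s) => n; rewrite ler_pdivlMr //; apply: le_trans (aK n.+1).
  rewrite big_nat_recl // a0 normr0 mul0r add0r mulr_suml.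
  by apply: ler_sum => k _; rewrite -mulrA -exprSr.
move=> t ts; have [->|t0] := eqVneq t 0.
  rewrite h0 -(@cvg_shiftn 1) /=.
  rewrite [X in X @ _ --> _](_ : _ = fun=> a 1%N); first exact: cvg_cst.
  apply/funext => n; rewrite addn1 /series /= big_nat_recl // expr0 mulr1 big1 ?addr0 //.
  by move=> i _; rewrite expr0n mulr0.
have -> : h t = t^-1 * g t by rewrite gh mulKf.
have -> : series (fun n => a n.+1 * t ^+ n) =
    (fun n => t^-1 * series (fun n => a n * t ^+ n) n.+1).
  apply/funext => n; rewrite /series /= [in RHS]big_nat_recl // a0 mul0r add0r.
  rewrite mulr_sumr; apply: eq_bigr => k _.
  by rewrite exprS; field.
apply: cvgMr.
have := ag _ ts; rewrite -(@cvg_shiftn 1) /=.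
by under eq_fun do rewrite addn1.
Qed.

Lemma an_common g h : an g -> an h ->
  exists2 s, 0 < s & (exists a, ps_on s a g) /\ (exists b, ps_on s b h).
Proof.
move=> [s s0 [a ag]] [s' s'0 [b bh]].
have m0 : 0 < Num.min s s' by rewrite lt_min s0.
exists (Num.min s s') => //; split; [exists a|exists b].
  by apply: ps_on_shrink ag; rewrite ?ge_min ?lexx // ltW.
by apply: ps_on_shrink bh; rewrite ?ge_min ?lexx ?orbT // ltW.
Qed.

Lemma an_cst (c : R) : an (fun=> c).
Proof. exists 1 => //; exists (fun n => if n is 0%N then c else 0); exact: ps_on_cst. Qed.

Lemma an_id : an id.
Proof.
exists 1 => //; exists (fun n => (n == 1%N)%:R); split.
  exists 1 => n; rewrite (eq_bigr (fun k => (k == 1%N)%:R)); last first.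
    by move=> k _; rewrite expr1n mulr1; case: eqP; rewrite ?normr0 ?normr1.
  rewrite -[leRHS]/(1%:R) -natr_sum ler_nat.
  case: n => [|[|n]]; [by rewrite big_geq|by rewrite big_nat1|].
  by rewrite big_nat_recl // big_nat_recl // big1.
move=> t _; rewrite -(@cvg_shiftn 2) /=.
rewrite [X in X @ _ --> _](_ : _ = fun=> t); first exact: cvg_cst.
apply/funext => n; rewrite addn2 /series /= big_nat_recl // big_nat_recl //.
rewrite mul0r add0r mul1r expr1 big1 ?addr0 //.
by move=> i _; rewrite mul0r.
Qed.

Lemma anD g h : an g -> an h -> an (fun t => g t + h t).
Proof.
move=> ag ah; have [s s0 [[a ga] [b hb]]] := an_common ag ah.
by exists s => //; exists (a \+ b); apply: ps_on_add => //; exact: ltW.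
Qed.

Lemma anM g h : an g -> an h -> an (fun t => g t * h t).
Proof.
move=> ag ah; have [s s0 [[a ga] [b hb]]] := an_common ag ah.
by exists s => //; exists (conv a b); apply: ps_on_mul => //; exact: ltW.
Qed.

Lemma anN g : an g -> an (fun t => - g t).
Proof.
move=> ag; have := anM (an_cst (-1)) ag.
by under eq_fun do rewrite mulN1r.
Qed.

Lemma an_sum (I : Type) (r : seq I) (P : pred I) (f : I -> R -> R) :
  (forall i, P i -> an (f i)) -> an (fun t => \sum_(i <- r | P i) f i t).
Proof.
move=> af; elim: r => [|i r IH].
  by under eq_fun do rewrite big_nil; exact: an_cst.
under eq_fun do rewrite big_cons.
have [Pi|_] // := boolP (P i); apply: anD => //; exact: af.
Qed.

Lemma anX g n : an g -> an (fun t => g t ^+ n).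
Proof.
move=> ag; elim: n => [|n IH].
  by under eq_fun do rewrite expr0; exact: an_cst.
by under eq_fun do rewrite exprS; exact: anM.
Qed.

Lemma an_div g : an g -> g 0 = 0 -> exists2 h, an h & forall t, g t = t * h t.
Proof.
move=> [s s0 [a ga]] g0.
have a0 : a 0%N = 0 by rewrite -(ps_on_at0 (ltW s0) ga).
pose h t := if t == 0 then a 1%N else t^-1 * g t.
have gh t : g t = t * h t.
  by rewrite /h; case: eqVneq => [->|t0]; rewrite ?mul0r ?mulVKf.
exists h => //; exists s => //; exists (fun n => a n.+1).
by apply: ps_on_shift ga _ gh _ => //; rewrite /h eqxx.
Qed.

Lemma an_bounded g : an g -> exists2 K : R, 0 < K & \forall t \near (0 : R), `|g t| <= K.
Proof.
move=> [s s0 [a [[K aK] ag]]].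
have K0 : 0 <= K by apply: le_trans (aK 0%N); rewrite big_geq.
exists (K + 1); first lra.
apply/nbhs_normP; exists s => //= t; rewrite /= sub0r normrN => /ltW ts.
have [n|l al lK] := @abs_series_cvg R (fun n => a n * t ^+ n) K.
  apply: le_trans (aK n); apply: ler_sum => k _.
  by rewrite normrM normrX ler_wpM2l // lerXn2r ?nnegrE // ltW.
suff -> : g t = l by apply: le_trans lK _; lra.
by rewrite -(cvg_lim (@Rhausdorff R) al); apply/esym/(cvg_lim (@Rhausdorff R))/ag.
Qed.

Lemma an_cvg0 g : an g -> g @ (0 : R) --> g 0.
Proof.
move=> ag; have : an (fun t => g t - g 0) by apply: anD => //; exact/an_cst.
case/an_div; first by rewrite subrr.
move=> h ah gh; have [K K0 hK] := an_bounded ah.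
apply/cvgrPdist_le => e e0; near=> t.
rewrite distrC gh normrM.
apply: (@le_trans _ _ (e / K * K)); last by rewrite divfK // gt_eqF.
rewrite ler_pM //; last by near: t.
near: t; apply/nbhs_normP; exists (e / K); first by rewrite /= divr_gt0.
by move=> t /=; rewrite sub0r normrN => /ltW.
Unshelve. all: by end_near.
Qed.

Lemma an_derive1 (c : R) h : an h -> derive1 (fun t => c + t * h t) 0 = h 0.
Proof.
move=> ah; rewrite /derive1; apply: (cvg_lim (@Rhausdorff R)).
apply: (@cvg_trans _ (h @ (0 : R)^')).
  apply: near_eq_cvg; apply/nbhs_normP; exists 1 => //= t _ t0.
  by rewrite addr0 mul0r addr0 addrAC subrr add0r /GRing.scale /= mulKf.
apply: cvg_trans (an_cvg0 ah); apply: cvg_app; exact: cvg_within.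
Qed.

(** The bound is asked off 0 only, where the roots of the polynomials will be known. Its limit at 0
    forces [g 0 = 0], and one factor [t] is removed at a time. *)
Lemma an_bigO (K : R) j g : an g -> (\forall t \near (0 : R)^', `|g t| <= K * `|t| ^+ j) ->
  exists2 h, an h & forall t, g t = t ^+ j * h t.
Proof.
elim: j g => [|j IH] g ag gj; first by exists g => // t; rewrite expr0 mul1r.
have g0 : g 0 = 0.
  apply/eqP; rewrite -normr_le0; apply: (@cvg_le_bound R _ (0 : R)^' _ (fun t => `|g t| - K * `|t| ^+ j.+1)).
    rewrite -[X in _ --> X]subr0; apply: cvgB.
      apply: cvg_norm; apply: cvg_trans (an_cvg0 ag); apply: cvg_app.
      exact: cvg_within.
    have := an_cvg0 (anX j.+1 an_id) => /cvg_norm.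
    rewrite expr0n normr0 => /(cvgMr (a := K)); rewrite mulr0 => c.
    under eq_fun do rewrite -normrX.
    apply: cvg_trans c; apply: cvg_app; exact: cvg_within.
  by near=> t; rewrite subr_le0; near: t.
have [h ah gh] := an_div ag g0.
have [|k ak hk] := IH h ah.
  near=> t; have t0 : 0 < `|t|.
    by rewrite normr_gt0; near: t; exact: nbhs_dnbhs_neq.
  rewrite -(ler_pM2l t0) mulrCA -exprS -normrM -gh.
  by near: t.
by exists k => // t; rewrite gh hk mulrA -exprS.
Unshelve. all: by end_near.
Qed.

(** Either all coefficients vanish, or repeated division by [t] brings a non-zero coefficient down
    to index 0. *)
Lemma an_factor g : an g -> (\forall t \near (0 : R), g t = 0) \/
  exists k h, [/\ an h, h 0 != 0 & forall t, g t = t ^+ k * h t].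
Proof.
move=> [s s0 [a ga]].
have [[k]|] := pselect (exists k, a k != 0); last first.
  move=> /forallNP a0; left; apply/nbhs_normP; exists s => //= t.
  rewrite /= sub0r normrN => /ltW /ga.2.
  rewrite [X in X @ _ --> _](_ : _ = fun=> 0); last first.
    apply/funext => n; rewrite /series /= big1 // => i _.
    by have /negP := a0 i; rewrite negbK => /eqP ->; rewrite mul0r.
  by move/(cvg_lim (@Rhausdorff R)) => <-; rewrite lim_cst.
have [a0|a0] := eqVneq (a 0%N) 0; last first.
  move=> _; right; exists 0%N, g; split; first by exists s => //; exists a.
    by rewrite (ps_on_at0 (ltW s0) ga).
  by move=> t; rewrite expr0 mul1r.
move=> ak; right; elim: k a g ga ak a0 => [|k IH] a g ga ak a0.
  by rewrite a0 eqxx in ak.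
pose h t := if t == 0 then a 1%N else t^-1 * g t.
have gh t : g t = t * h t.
  rewrite /h; case: eqVneq => [->|t0]; last by rewrite mulVKf.
  by rewrite mul0r (ps_on_at0 (ltW s0) ga).
have ph : ps_on s (fun n => a n.+1) h.
  by apply: ps_on_shift ga _ gh _ => //; rewrite /h eqxx.
have [a1|a1] := eqVneq (a 1%N) 0.
  have [j [h' [ah' h'0 hh']]] := IH _ _ ph ak a1.
  by exists j.+1, h'; split => // t; rewrite gh hh' mulrA -exprS.
exists 1%N, h; split => //; first by exists s => //; exists (fun n => a n.+1).
by rewrite (ps_on_at0 (ltW s0) ph).
Qed.

Lemma row_le_box (G : nat -> nat -> R) k n N : (forall k l, 0 <= G k l) ->
  (k < N)%N -> (n <= N)%N ->
  \sum_(0 <= l < n) G k l <= \sum_(0 <= k < N) \sum_(0 <= l < N) G k l.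
Proof.
move=> G0 kN nN.
rewrite [leRHS](bigD1_seq k) ?iota_uniq ?mem_index_iota //=.
rewrite -[leLHS]addr0 lerD //; last by do 2!apply: sumr_ge0 => ? _.
by rewrite [leRHS](big_cat_nat (n := n)) //= lerDl sumr_ge0.
Qed.

(** The binomial expansion of [a n * (t0 + h) ^+ n] is a double family indexed by the powers of [h]
    and [t0], absolutely summable for [|t0| + |h| <= s]. Its diagonals sum to [g (t0 + h)] and its
    rows give the coefficients at [t0]. *)
Lemma ps_on_recenter s a g : 0 < s -> ps_on s a g ->
  real_analytic_on [set t | `|t| < s] g.
Proof.
move=> s0 [[K aK] ag] t0 /= t0s.
have t0s' : 0 < s - `|t0| by lra.
pose F (h : R) k l := a (k + l)%N * 'C(k + l, k)%:R * t0 ^+ l * h ^+ k.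
have FK (h : R) : `|h| <= s - `|t0| -> forall N,
    \sum_(0 <= k < N) \sum_(0 <= l < N) `|F h k l| <= K.
  move=> hs N; apply: le_trans (aK (N + N)%N).
  pose G k l := `|a (k + l)%N| * 'C(k + l, k)%:R * `|t0| ^+ l * `|h| ^+ k.
  have G0 k l : 0 <= G k l by rewrite !mulr_ge0.
  apply: (@le_trans _ _ (pairsum (N + N) (fun k l => k + l < N + N)%N G)).
    have NN : (N <= N + N)%N by lia.
    rewrite (eq_big_nat _ _ (F2 := fun k => \sum_(0 <= l < N) G k l)); last first.
      move=> k _; apply: eq_big_nat => l _.
      by rewrite /F /G !normrM !normrX normr_nat.
    rewrite -(pairsum_box G NN); apply: ler_sum => k _; apply: ler_sum => l _.
    by case: ifPn => [/andP[kN lN]|_]; case: ifPn => //; lia.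
  rewrite pairsum_diag //; apply: ler_sum => n _.
  apply: (@le_trans _ _ (`|a n| * (`|t0| + `|h|) ^+ n)); last first.
    rewrite ler_wpM2l // lerXn2r ?nnegrE ?addr_ge0 //; first exact: ltW.
    by lra.
  rewrite exprDn mulr_sumr big_mkord; apply: ler_sum => k _.
  rewrite /G subnKC; last by rewrite -ltnS.
  by rewrite -mulr_natl; lra.
pose b k := limn (series (fun l => a (k + l)%N * 'C(k + l, k)%:R * t0 ^+ l)).
(* Row [k] converges because at [h = s - |t0|], the largest admissible value, it is part of a
   bounded box. *)
have bc k : series (fun l => a (k + l)%N * 'C(k + l, k)%:R * t0 ^+ l) @ \oo --> b k.
  have [N|l] := @abs_series_cvg R
    (fun l => a (k + l)%N * 'C(k + l, k)%:R * t0 ^+ l) (K / (s - `|t0|) ^+ k).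
    rewrite ler_pdivlMr ?exprn_gt0 //.
    have st0 : `|s - `|t0| | <= s - `|t0| by rewrite gtr0_norm.
    apply: le_trans (FK _ st0 (N + k.+1)%N).
    have := @row_le_box (fun k l => `|F (s - `|t0|) k l|) k N (N + k.+1).
    move=> /(_ (fun _ _ => normr_ge0 _)).
    rewrite leq_addl leq_addr => /(_ isT isT); apply: le_trans.
    rewrite mulr_suml; apply: ler_sum => l _.
    by rewrite /F [leRHS]normrM normrX (gtr0_norm t0s').
  by move=> c _; rewrite /b (cvg_lim _ c).
exists b; apply/nbhs_normP; exists (s - `|t0|) => //= t /=.
rewrite distrC => tt0.
have [N|k|S [S1 S2 _]] := @diag_sum R (F (t - t0)) K (fun k => b k * (t - t0) ^+ k).
- by apply: FK; exact: ltW.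
- rewrite [X in X @ _ --> _](_ : _ = fun n => series (fun l => a (k + l)%N * 'C(k + l, k)%:R * t0 ^+ l) n * (t - t0) ^+ k).
    by apply: cvgMl; exact: bc.
  by apply/funext => n; rewrite /series /= mulr_suml.
suff -> : g t = S by [].
have ts : `|t| <= s.
  by rewrite -[t](subrK t0); apply: le_trans (ler_normD _ _) _; lra.
rewrite -(cvg_lim (@Rhausdorff R) S2).
rewrite -(cvg_lim (@Rhausdorff R) (ag _ ts)); congr (limn _).
apply/funext => n; rewrite /series /=; apply: eq_bigr => m _.
rewrite -{1}[t](subrK t0) addrC exprDn mulr_sumr big_mkord; apply: eq_bigr => k _.
rewrite /F subnKC; last by rewrite -ltnS.
by rewrite -mulr_natl; ring.
Qed.

Lemma ps_on_unique s a g h t : ps_on s a g -> ps_on s a h -> `|t| <= s -> g t = h t.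
Proof.
move=> [_ ag] [_ ah] ts.
by rewrite -(cvg_lim (@Rhausdorff R) (ag _ ts)); exact: (cvg_lim (@Rhausdorff R) (ah _ ts)).
Qed.

Lemma ps_on_sum s (I : Type) (r : seq I) (a : I -> nat -> R) (g : I -> R -> R) :
  0 <= s -> (forall i, ps_on s (a i) (g i)) ->
  ps_on s (fun n => \sum_(i <- r) a i n) (fun t => \sum_(i <- r) g i t).
Proof.
move=> s0 ag; elim: r => [|i r IH].
  have := ps_on_cst 0 s0.
  rewrite (_ : (fun n => _) = (fun n => \sum_(i <- [::]) a i n)); last first.
    by apply/funext => -[|n]; rewrite big_nil.
  by under [fun t => \sum_(i <- [::]) g i t]eq_fun do rewrite big_nil.
have := ps_on_add s0 (ag i) IH.
by congr ps_on; apply/funext => x /=; rewrite big_cons.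
Qed.

Lemma ps_on_coef_le s a g : 0 < s -> ps_on s a g ->
  exists2 K : R, 0 < K & forall n, `|a n| <= K * (s^-1) ^+ n.
Proof.
move=> s0 [[K aK] _]; exists (K + 1).
  by apply: ltr_wpDl => //; apply: le_trans (aK 0%N); rewrite big_geq.
move=> n; rewrite exprVn ler_pdivlMr ?exprn_gt0 //.
apply: (@le_trans _ _ K); last by rewrite lerDl.
apply: le_trans (aK n.+1); rewrite big_nat_recr //= lerDr sumr_ge0 // => k _.
by rewrite mulr_ge0 // exprn_ge0 // ltW.
Qed.

Lemma an_ord n (f : 'I_n -> R -> R) : (forall i, an (f i)) ->
  exists2 s, 0 < s & exists a : 'I_n -> nat -> R,
    forall i, ps_on s (a i) (f i).
Proof.
elim: n f => [|n IH] f af; first by exists 1 => //; exists (fun _ _ => 0) => -[].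
have [s s0 [a ga]] := IH (fun i => f (lift ord0 i)) (fun i => af _).
have [s' s'0 [b gb]] := af ord0.
have m0 : 0 < Num.min s s' by rewrite lt_min s0.
exists (Num.min s s') => //.
exists (fun i => if unlift ord0 i is Some j then a j else b) => i.
case: unliftP => [j ->|->].
  by apply: ps_on_shrink (ga j); rewrite ?ge_min ?lexx // ltW.
by apply: ps_on_shrink gb; rewrite ?ge_min ?lexx ?orbT // ltW.
Qed.

Lemma an_eq0 g h : an g -> an h -> (\forall t \near (0 : R)^', g t = h t) ->
  g 0 = h 0.
Proof.
move=> ag ah gh.
have c1 : g @ (0 : R)^' --> g 0.
  by apply: cvg_trans (an_cvg0 ag); apply: cvg_app; exact: cvg_within.
have c2 : h @ (0 : R)^' --> h 0.
  by apply: cvg_trans (an_cvg0 ah); apply: cvg_app; exact: cvg_within.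
have c3 : g @ (0 : R)^' --> h 0
  by apply: cvg_trans c2; apply: near_eq_cvg; apply: filterS gh => t ->.
by rewrite -(cvg_lim (@Rhausdorff R) c1); exact: (cvg_lim (@Rhausdorff R) c3).
Qed.

Lemma near_punctured (P : R -> Prop) : P 0 -> (\forall t \near (0 : R)^', P t) ->
  \forall t \near (0 : R), P t.
Proof.
move=> P0 /nbhs_normP[e e0 eP]; apply/nbhs_normP; exists e => // t te.
by have [->//|t0] := eqVneq t 0; exact: eP.
Qed.

End AnalyticGerms.

(** * Polynomials with analytic coefficients *)

(** The coefficients of a power series solution depend on all the previous ones. Each iteration of
    [Phi] fixes one more term, so the default [x0] does not survive in the diagonal. *)
Lemma strong_rec (T : Type) (x0 : T) (Phi : (nat -> T) -> nat -> T) :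
  (forall y y' m, (forall i, (i < m)%N -> y i = y' i) -> Phi y m = Phi y' m) ->
  exists y, forall m, y m = Phi y m.
Proof.
move=> PhiE; pose it n := iter n Phi (fun=> x0).
have itE m n : (m < n)%N -> it n m = it m.+1 m.
  elim/ltn_ind: m n => m IH [//|n] mn /=.
  apply: PhiE => i im; rewrite -!/(it _) IH ?[in RHS]IH //; lia.
exists (fun m => it m.+1 m) => m /=; apply: PhiE => i im.
by rewrite -/(it _) itE.
Qed.

Section AnalyticPolynomials.
Variable R : realType.
Implicit Types (p q : R -> {poly R}).

Definition pan p := forall i, an (fun t => (p t)`_i).

Lemma pan_cst (u : {poly R}) : pan (fun=> u).
Proof. by move=> i; exact: an_cst. Qed.

Lemma panC (c : R -> R) : an c -> pan (fun t => (c t)%:P).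
Proof.
move=> ac i; under eq_fun do rewrite coefC.
by case: (i == 0%N) => //; exact: an_cst.
Qed.

Lemma panD p q : pan p -> pan q -> pan (fun t => p t + q t).
Proof. by move=> ap aq i; under eq_fun do rewrite coefD; exact: anD. Qed.

Lemma panM p q : pan p -> pan q -> pan (fun t => p t * q t).
Proof.
move=> ap aq i; under eq_fun do rewrite coefM.
by apply: an_sum => j _; exact: anM.
Qed.

Lemma panX p n : pan p -> pan (fun t => p t ^+ n).
Proof.
move=> ap; elim: n => [|n IH].
  by under eq_fun do rewrite expr0; exact: pan_cst.
by under eq_fun do rewrite exprS; exact: panM.
Qed.

Lemma pan_prod (I : Type) (r : seq I) (f : I -> R -> {poly R}) :
  (forall i, pan (f i)) -> pan (fun t => \prod_(i <- r) f i t).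
Proof.
move=> af; elim: r => [|i r IH].
  by under eq_fun do rewrite big_nil; exact: pan_cst.
by under eq_fun do rewrite big_cons; exact: panM.
Qed.

(** A size independent of [t] gives the expansion of the composition a fixed range of summation. *)
Lemma pan_comp_affine p n (c : R -> R) : pan p -> (forall t, size (p t) = n) ->
  an c -> pan (fun t => p t \Po ('X + (c t)%:P)).
Proof.
move=> ap pn ac i; under eq_fun => t do rewrite comp_polyE pn coef_sum.
apply: an_sum => j _; under eq_fun do rewrite coefZ.
apply: anM => //; apply: panX; apply: panD; [exact: pan_cst|exact: panC].
Qed.

Lemma pan_eq0 p q : pan p -> pan q -> (\forall t \near (0 : R)^', p t = q t) ->
  p 0 = q 0.
Proof.
move=> ap aq pq; apply/polyP => i.
by apply: (an_eq0 (ap i) (aq i)); apply: filterS pq => t ->.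
Qed.

Definition pnorm (n : nat) (u : {poly R}) : R := \sum_(0 <= i < n) `|u`_i|.

Lemma pnorm_ge0 n u : 0 <= pnorm n u.
Proof. exact: sumr_ge0. Qed.

Lemma pnormD n u v : pnorm n (u + v) <= pnorm n u + pnorm n v.
Proof.
by rewrite /pnorm -big_split; apply: ler_sum => i _; rewrite coefD ler_normD.
Qed.

Lemma pnormN n u : pnorm n (- u) = pnorm n u.
Proof. by apply: eq_bigr => i _; rewrite coefN normrN. Qed.

Lemma pnormZ n (c : R) u : pnorm n (c *: u) = `|c| * pnorm n u.
Proof. by rewrite /pnorm mulr_sumr; apply: eq_bigr => i _; rewrite coefZ normrM. Qed.

Lemma pnorm_sum n (I : Type) (r : seq I) (P : pred I) (f : I -> {poly R}) :
  pnorm n (\sum_(i <- r | P i) f i) <= \sum_(i <- r | P i) pnorm n (f i).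
Proof.
elim/big_ind2: _ => //.
  by rewrite /pnorm big1 // => i _; rewrite coef0 normr0.
by move=> u x v y ux vy; apply: le_trans (pnormD _ _ _) _; exact: lerD.
Qed.

(** Truncation keeps submultiplicativity: the coefficients of index below [n] of a product only
    involve those of index below [n] of the factors. *)
Lemma pnormM n u v : pnorm n (u * v) <= pnorm n u * pnorm n v.
Proof.
apply: le_trans (conv_le n (fun i => normr_ge0 u`_i) (fun i => normr_ge0 v`_i)).
apply: ler_sum => m _; rewrite coefM big_mkord.
by apply: le_trans (ler_norm_sum _ _ _) _; apply: ler_sum => i _; rewrite normrM.
Qed.

Lemma pnorm_coef n (u : {poly R}) i : (i < n)%N -> `|u`_i| <= pnorm n u.
Proof.
move=> iN; rewrite /pnorm (bigD1_seq i) ?iota_uniq ?mem_index_iota //=.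
by rewrite lerDl sumr_ge0.
Qed.

Lemma pnorm_linear n (J : {poly R} -> {poly R}) :
  (forall u v, J (u + v) = J u + J v) -> (forall c u, J (c *: u) = c *: J u) ->
  exists2 C : R, 0 <= C & forall u : {poly R}, (size u <= n)%N ->
    pnorm n (J u) <= C * pnorm n u.
Proof.
move=> JD JZ; exists (\sum_(i < n) pnorm n (J 'X^i)).
  by apply: sumr_ge0 => i _; exact: pnorm_ge0.
move=> u un.
have J0 : J 0 = 0 by have := JZ 0 0; rewrite !scale0r.
have -> : u = \sum_(i < n) u`_i *: 'X^i.
  rewrite -poly_def; apply/polyP => i; rewrite coef_poly; case: ltnP => //.
  by move=> /(leq_trans un) /leq_sizeP ->.
rewrite (big_morph J JD J0).
apply: le_trans (pnorm_sum _ _ _ _) _; rewrite mulr_suml; apply: ler_sum => i _.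
rewrite JZ pnormZ mulrC ler_wpM2l ?pnorm_ge0 //.
rewrite -poly_def (_ : \poly_(i < n) u`_i = u); last first.
  by apply/polyP => k; rewrite coef_poly; case: ltnP => // /(leq_trans un) /leq_sizeP ->.
exact: pnorm_coef.
Qed.

(** This inverts the linearization of the product at [(q0, s0)]. [J1 h] is a Bezout solution reduced
    modulo [q0], which fixes the degrees, and [J2 h] is the resulting exact quotient. Both are
    linear in [h], hence bounded on polynomials of bounded size. *)
Lemma bezout_split (q0 s0 : {poly R}) : q0 \is monic -> s0 \is monic ->
  coprimep q0 s0 ->
  let n := ((size q0).-1 + (size s0).-1)%N in
  exists (J1 J2 : {poly R} -> {poly R}) (C : R), 0 <= C /\
    forall h : {poly R}, (size h <= n)%N ->
    [/\ q0 * J2 h + s0 * J1 h = h, (size (J1 h) < size q0)%N,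
      (size (J2 h) < size s0)%N & pnorm n (J1 h) + pnorm n (J2 h) <= C * pnorm n h].
Proof.
move=> q0m s0m cop n.
have [[al be] /= ab] := Bezout_eq1_coprimepP _ _ cop.
pose J1 h := (be * h) %% q0; pose J2 h := (h - s0 * J1 h) %/ q0.
have q0n : q0 != 0 by exact: monic_neq0.
have s0n : s0 != 0 by exact: monic_neq0.
have J1D u v : J1 (u + v) = J1 u + J1 v by rewrite /J1 mulrDr modpD.
have J1Z c u : J1 (c *: u) = c *: J1 u by rewrite /J1 -scalerAr modpZl.
have J2D u v : J2 (u + v) = J2 u + J2 v.
  by rewrite /J2 J1D mulrDr opprD addrACA divpD.
have J2Z c u : J2 (c *: u) = c *: J2 u.
  by rewrite /J2 J1Z -scalerAr -scalerBr divpZl.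
have [C1 C10 J1C] := @pnorm_linear n _ J1D J1Z.
have [C2 C20 J2C] := @pnorm_linear n _ J2D J2Z.
exists J1, J2, (C1 + C2); split; first exact: addr_ge0.
move=> h hn.
have J1s : (size (J1 h) < size q0)%N by rewrite ltn_modp.
have dv : q0 %| h - s0 * J1 h.
  rewrite /dvdp /J1 modpD modpN; apply/eqP; rewrite modp_mul -modpN -modpD mulrA.
  have -> : h - s0 * be * h = (al * h) * q0.
    by rewrite -[X in X - _]mul1r -ab mulrDl [s0 * be]mulrC addrK mulrAC.
  exact: modp_mull.
have e : q0 * J2 h + s0 * J1 h = h by rewrite /J2 mulrC divpK // subrK.
split => //.
  have [J20|J20] := eqVneq (J2 h) 0; first by rewrite J20 size_poly0 lt0n size_poly_eq0.
  have sq : (0 < size q0)%N by rewrite lt0n size_poly_eq0.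
  have ss : (0 < size s0)%N by rewrite lt0n size_poly_eq0.
  have : (size (q0 * J2 h)%R <= n)%N.
    have -> : q0 * J2 h = h - s0 * J1 h by apply/eqP; rewrite eq_sym subr_eq e.
    apply: leq_trans (size_polyD _ _) _; rewrite geq_max hn size_polyN /=.
    apply: leq_trans (size_polyMleq _ _) _; rewrite /n.
    have aux (a b c : nat) : (b < c -> 0 < a -> 0 < c -> (a + b).-1 <= c.-1 + a.-1)%N.
      by clear; lia.
    exact: aux J1s ss sq.
  rewrite mulrC size_Mmonic // /n.
  have aux (a b c : nat) : (0 < b -> 0 < c -> (a + b).-1 <= b.-1 + c.-1 -> a < c)%N.
    by clear; lia.
  exact: aux sq ss.
by rewrite mulrDl lerD // ?J1C ?J2C.
Qed.

Lemma pan_of_coefs s (Q : nat -> {poly R}) : 0 <= s -> Q 0%N \is monic ->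
  (forall m, (0 < m)%N -> (size (Q m) < size (Q 0%N))%N) ->
  (forall i, exists K : R, forall N, \sum_(0 <= m < N) `|(Q m)`_i| * s ^+ m <= K) ->
  exists q : R -> {poly R},
    (forall t, q t \is monic /\ size (q t) = size (Q 0%N)) /\
    forall i, ps_on s (fun m => (Q m)`_i) (fun t => (q t)`_i).
Proof.
move=> s0 Q0m Qs QK; set d := (size (Q 0%N)).-1.
have dE : size (Q 0%N) = d.+1.
  by rewrite /d prednK // lt0n size_poly_eq0 monic_neq0.
have f i := ps_on_bounded s0 (QK i).
pose g i := projT1 (cid (f i)).
have gP i : ps_on s (fun m => (Q m)`_i) (g i) by rewrite /g; case: cid.
(* The leading coefficient is set to 1 by hand: [g] is only controlled for [|t| <= s], while [q t]
   has to be monic for every [t]. *)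
pose q t : {poly R} := \poly_(i < d.+1) (if i == d then 1 else g i t).
have qs t : size (q t) = d.+1 by rewrite size_poly_eq // eqxx oner_neq0.
have qc t i : (q t)`_i = if (i < d)%N then g i t else (i == d)%:R.
  rewrite coef_poly ltnS leq_eqVlt.
  by have [->|_] := eqVneq i d; rewrite ?ltnn.
exists q; split => [t|i].
  by split; rewrite ?dE // monicE lead_coefE qs /= qc ltnn eqxx.
under [X in ps_on _ _ X]eq_fun do rewrite qc.
have [id|di] := ltnP i d; first exact: gP.
have := ps_on_cst (i == d)%:R s0; congr ps_on; apply/funext => -[|m].
  have [->|id] := eqVneq i d; first by move: Q0m; rewrite monicE lead_coefE => /eqP.
  by rewrite nth_default // dE ltn_neqAle eq_sym id.
by rewrite nth_default //; apply: leq_trans di; rewrite -ltnS -dE Qs.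
Qed.

(** At each order the unknown coefficients of the two factors solve the linearized equation of
    [bezout_split], with products of lower orders on the right; [quadratic_majorant] then gives
    convergence. *)
Lemma hensel p n (q0 s0 : {poly R}) : pan p ->
  (forall t, p t \is monic /\ size (p t) = n.+1) ->
  q0 \is monic -> s0 \is monic -> coprimep q0 s0 -> p 0 = q0 * s0 ->
  exists q s : R -> {poly R}, [/\ pan q, pan s,
    (forall t, q t \is monic /\ size (q t) = size q0),
    (forall t, s t \is monic /\ size (s t) = size s0) &
    \forall t \near (0 : R), p t = q t * s t].
Proof.
move=> ap pmn q0m s0m cop p0.
have q0n : q0 != 0 by exact: monic_neq0.
have s0n : s0 != 0 by exact: monic_neq0.
have sq : (0 < size q0)%N by rewrite lt0n size_poly_eq0.
have ss : (0 < size s0)%N by rewrite lt0n size_poly_eq0.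
have nE : n = ((size q0).-1 + (size s0).-1)%N.
  have := (pmn 0).2; rewrite p0 size_Mmonic //; move: sq ss; clear; lia.
have [J1 [J2 [C [C0 JP]]]] := bezout_split q0m s0m cop; rewrite -nE in JP.
have [sg sg0 [A AP]] := an_ord (fun i : 'I_n => ap i).
have [B [K [B0 K0 AK]]] : exists B K : R, [/\ 0 < B, 0 < K &
    forall (i : 'I_n) m, `|A i m| <= K * B ^+ m].
  have K' i : exists K : R, 0 < K /\ forall m, `|A i m| <= K * (sg^-1) ^+ m.
    by have [K ? ?] := ps_on_coef_le sg0 (AP i); exists K.
  exists sg^-1, (1 + \sum_i projT1 (cid (K' i))).
  have Kp i : 0 < projT1 (cid (K' i)) by case: cid => ? [].
  split; first by rewrite invr_gt0.
    by apply: ltr_pwDl => //; apply: sumr_ge0 => i _; exact: ltW.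
  move=> i m; apply: (@le_trans _ _ (projT1 (cid (K' i)) * sg^-1 ^+ m)).
    by case: cid => ? [].
  rewrite ler_wpM2r ?exprn_ge0 ?invr_ge0 ?(ltW sg0) //.
  rewrite (bigD1 i) //= addrCA lerDl addr_ge0 // sumr_ge0 // => j _.
  by apply: ltW; exact: Kp.
(* The coefficient of index [n] is left out: it is constantly 1, so it contributes at order 0 only,
   while the corrections start at order 1. *)
pose P m : {poly R} := \poly_(i < n) (if insub i is Some j then A j m else 0).
have Pc m (i : 'I_n) : (P m)`_i = A i m by rewrite coef_poly ltn_ord valK.
have Ps m : (size (P m) <= n)%N by exact: size_poly.
have PK m : pnorm n (P m) <= n%:R * K * B ^+ m.
  rewrite /pnorm big_mkord.
  apply: (@le_trans _ _ (\sum_(i < n) K * B ^+ m)).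
    by apply: ler_sum => i _; rewrite Pc.
  by rewrite sumr_const card_ord -mulrA mulr_natl.
pose rhs (y : nat -> {poly R} * {poly R}) m := P m - \sum_(1 <= l < m) (y l).1 * (y (m - l)%N).2.
have [y yE] : exists y : nat -> {poly R} * {poly R}, forall m,
    y m = if m is 0%N then (0, 0) else (J1 (rhs y m), J2 (rhs y m)).
  apply: (@strong_rec _ (0, 0) (fun y m =>
    if m is 0%N then (0, 0) else (J1 (rhs y m), J2 (rhs y m)))).
  move=> y y' [//|m] yy'; suff -> : rhs y m.+1 = rhs y' m.+1 by [].
  congr (_ - _); apply: eq_big_nat => l lm; rewrite !yy' //; move: lm; clear; lia.
have ys m : [/\ (size (y m).1 < size q0)%N, (size (y m).2 < size s0)%N
    & (size (rhs y m) <= n)%N].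
  elim/ltn_ind: m => m IH.
  have r : (size (rhs y m) <= n)%N.
    rewrite /rhs (leq_trans (size_polyD _ _)) // geq_max Ps size_polyN /=.
    rewrite big_seq; apply: (big_ind (fun u : {poly R} => (size u <= n)%N)).
    - by rewrite size_poly0.
    - by move=> u v us vs; rewrite (leq_trans (size_polyD _ _)) // geq_max us.
    - move=> l; rewrite mem_index_iota => lm.
      have [|u1 _ _] := IH l; first by move: lm; clear; lia.
      have [|_ u2 _] := IH (m - l)%N; first by move: lm; clear; lia.
      apply: leq_trans (size_polyMleq _ _) _.
      move: u1 u2 sq ss nE; clear; lia.
  have [_ r1 r2 _] := JP _ r.
  by split => //; rewrite yE; move: r1 r2; case: (m) => [|m'] //=; rewrite size_poly0.
pose Y m := pnorm n (y m).1 + pnorm n (y m).2.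
have Y0 m : 0 <= Y m by rewrite addr_ge0 ?pnorm_ge0.
have nK0 : 0 <= n%:R * K by rewrite mulr_ge0 // ltW.
have CnK : 0 <= C * (n%:R * K) by exact: mulr_ge0.
(* One constant dominates both the factor [C] of the products and the factor [C * (n%:R * K)] of the
   data. The double sums [S2] are non-negative and are added to match the form of
   [quadratic_majorant]. *)
pose A0 := 1 + C + C * (n%:R * K).
have A00 : 0 < A0 by rewrite /A0; lra.
have Yle m : (0 < m)%N -> Y m <= A0 * (B ^+ m +
     \sum_(1 <= l < m) Y l * Y (m - l)%N +
     \sum_(1 <= k < m.+1) B ^+ k *
        \sum_(0 <= l < (m - k).+1) Y l * Y (m - k - l)%N).
  move=> m0; have [_ _ r] := ys m; have [_ _ _ JC] := JP _ r.
  apply: (@le_trans _ _ (C * pnorm n (rhs y m))).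
    by rewrite /Y yE; case: m m0 r JC.
  set S1 := \sum_(1 <= l < m) _; set S2 := \sum_(1 <= k < m.+1) _.
  have S10 : 0 <= S1 by apply: sumr_ge0 => l _; exact: mulr_ge0.
  have S20 : 0 <= S2.
    apply: sumr_ge0 => k _; rewrite mulr_ge0 ?exprn_ge0 ?(ltW B0) // sumr_ge0 // => l _.
    exact: mulr_ge0.
  have Bm : 0 <= B ^+ m by rewrite exprn_ge0 // ltW.
  have rle : pnorm n (rhs y m) <= n%:R * K * B ^+ m + S1.
    apply: le_trans (pnormD _ _ _) _; rewrite pnormN lerD //.
    apply: le_trans (pnorm_sum _ _ _ _) _; apply: ler_sum => l _.
    apply: le_trans (pnormM _ _ _) _.
    by rewrite ler_pM ?pnorm_ge0 // ?lerDl ?lerDr pnorm_ge0.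
  apply: le_trans (ler_wpM2l C0 rle) _; rewrite /A0.
  have h1 := mulr_ge0 CnK S10; have h2 := mulr_ge0 C0 Bm.
  have h3 := mulr_ge0 (ltW A00) S20; move: h3; rewrite /A0 => h3.
  rewrite !mulrDr !mulrDl !mul1r; move: h3; rewrite !mulrDl !mul1r.
  move: h1 h2 Bm S10; rewrite !mulrA; lra.
have [sg2 [K2 [sg20 YK]]] := quadratic_majorant A00 B0 Y0 Yle.
(* At order 0 the recursion holds zeros, so that [Y] measures the corrections alone; the factors
   [q0] and [s0] are put back here. *)
pose Q m := if m is 0%N then q0 else (y m).1.
pose S m := if m is 0%N then s0 else (y m).2.
pose s3 := Num.min sg sg2.
have s30 : 0 < s3 by rewrite lt_min sg0.
have s3sg : s3 <= sg by rewrite ge_min lexx.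
have s3sg2 : s3 <= sg2 by rewrite ge_min lexx orbT.
have q0n1 : (size q0 <= n.+1)%N by move: nE sq ss; clear; lia.
have s0n1 : (size s0 <= n.+1)%N by move: nE sq ss; clear; lia.
have YK' (Z : nat -> {poly R}) : (forall m, (0 < m)%N -> pnorm n (Z m) <= Y m) ->
    (forall m, (0 < m)%N -> (size (Z m) <= n)%N) ->
    forall i, exists K : R, forall N, \sum_(0 <= m < N) `|(Z m)`_i| * s3 ^+ m <= K.
  move=> ZY Zs i; apply: (ps_bound_shrink (ltW s30) s3sg2).
  have K20 : 0 <= K2 by apply: le_trans (YK 0%N); rewrite big_geq.
  exists (`|(Z 0%N)`_i| + K2) => -[|N]; first by rewrite big_geq // addr_ge0.
  rewrite big_nat_recl // expr0 mulr1 lerD2l; apply: le_trans (YK N.+1).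
  rewrite big_nat_recl // ler_wpDl ?mulr_ge0 ?exprn_ge0 ?(ltW sg20) //.
  apply: ler_sum => m _; rewrite ler_wpM2r ?exprn_ge0 ?(ltW sg20) //.
  apply: le_trans (ZY m.+1 isT); have [iN|iN] := ltnP i n; first exact: pnorm_coef.
  by rewrite nth_default ?normr0 ?pnorm_ge0 // (leq_trans (Zs _ _)).
have Qs m : (0 < m)%N -> (size (Q m) < size q0)%N by case: m => // m _; case: (ys m.+1).
have Ss m : (0 < m)%N -> (size (S m) < size s0)%N by case: m => // m _; case: (ys m.+1).
have QK := @YK' Q; have SK := @YK' S.
have [|q [qm qc]] := @pan_of_coefs s3 Q (ltW s30) q0m Qs.
  apply: QK => m m0; first by case: m m0 => // m _; rewrite lerDl pnorm_ge0.
  by rewrite -ltnS (leq_trans (Qs _ m0)).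
have [|s [sm sc]] := @pan_of_coefs s3 S (ltW s30) s0m Ss.
  apply: SK => m m0; first by case: m m0 => // m _; rewrite lerDr pnorm_ge0.
  by rewrite -ltnS (leq_trans (Ss _ m0)).
exists q, s; split => //.
- by move=> i; exists s3 => //; exists (fun m => (Q m)`_i).
- by move=> i; exists s3 => //; exists (fun m => (S m)`_i).
(* The two end terms of the Cauchy product add up to [rhs] by [bezout_split], and the middle terms
   are those subtracted in [rhs]. *)
have QS m (i : 'I_n) : (\sum_(0 <= l < m.+1) Q l * S (m - l)%N)`_i = A i m.
  case: m => [|m].
    by rewrite big_nat1 -p0 -(ps_on_at0 (ltW sg0) (AP i)).
  rewrite big_nat_recl // big_nat_recr //= subn0 subnn.
  have [_ _ r] := ys m.+1; have [e _ _ _] := JP _ r.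
  have PE : P m.+1 = q0 * (y m.+1).2 + s0 * (y m.+1).1 +
      \sum_(1 <= l < m.+1) (y l).1 * (y (m.+1 - l)%N).2.
    by rewrite {1 2}yE e subrK.
  rewrite -Pc; congr (_`_i); rewrite PE big_add1 /=.
  have -> : \sum_(0 <= i0 < m) Q i0.+1 * S (m.+1 - i0.+1)%N =
      \sum_(0 <= l < m) (y l.+1).1 * (y (m.+1 - l.+1)%N).2.
    apply: eq_big_nat => l lm; rewrite /S.
    case E: (m.+1 - l.+1)%N => //; move: E lm; clear; lia.
  by congr polyseq; rewrite -!addrA; congr (_ + _); rewrite addrC [s0 * _]mulrC.
apply/nbhs_normP; exists s3 => //= t; rewrite /= sub0r normrN => /ltW ts.
have qsm : q t * s t \is monic by rewrite rpredM //; [case: (qm t)|case: (sm t)].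
have qss : size (q t * s t) = n.+1.
  rewrite size_Mmonic; [|by apply: monic_neq0; case: (qm t)|by case: (sm t)].
  rewrite (qm t).2 (sm t).2 /= nE.
  have aux (a b : nat) : (0 < a -> 0 < b -> (a + b).-1 = (a.-1 + b.-1).+1)%N.
    by clear; lia.
  exact: aux sq ss.
apply/polyP => i; have [iN|iN] := ltnP i n; last first.
  move: iN; rewrite leq_eqVlt => /predU1P[<-|iN].
    have [] := pmn t; rewrite monicE lead_coefE => /eqP pt1 ps.
    move: qsm; rewrite monicE lead_coefE qss /= => /eqP ->.
    by rewrite -pt1 ps.
  by rewrite !nth_default // ?qss // (pmn t).2.
have APi := ps_on_shrink (ltW s30) s3sg (AP (Ordinal iN)).
suff qsi : ps_on s3 (A (Ordinal iN)) (fun t => (q t * s t)`_i).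
  exact: (ps_on_unique APi qsi ts).
under [X in ps_on _ _ X]eq_fun do rewrite coefM.
have := @ps_on_sum R s3 _ (index_enum 'I_i.+1)
  (fun j => conv (fun m => (Q m)`_j) (fun m => (S m)`_(i - j)))
  (fun j t => (q t)`_j * (s t)`_(i - j)) (ltW s30).
move=> /(_ (fun j => ps_on_mul (ltW s30) (qc j) (sc _))).
congr ps_on; apply/funext => m.
rewrite -QS coef_sum exchange_big /=; apply: eq_bigr => j _.
by rewrite coefM.
Qed.

End AnalyticPolynomials.

(** * Analytic roots of real-rooted polynomials *)

Section AnalyticRoots.
Variable R : realType.
Implicit Types (p q : R -> {poly R}).

Definition proots (s : seq R) : {poly R} := \prod_(x <- s) ('X - x%:P).

Lemma size_proots s : size (proots s) = (size s).+1.
Proof. exact: size_prod_XsubC. Qed.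

Lemma proots_monic s : proots s \is monic.
Proof. exact: monic_prod_XsubC. Qed.

Lemma proots_cons x s : proots (x :: s) = ('X - x%:P) * proots s.
Proof. by rewrite /proots big_cons. Qed.

Lemma proots_lead s : (proots s)`_(size s) = 1.
Proof.
by have := proots_monic s; rewrite monicE lead_coefE size_proots => /eqP.
Qed.

(** The coefficient of index [i] is homogeneous of degree [size s - i] in the roots. *)
Lemma coef_proots_scale (D : R) s i : (i <= size s)%N ->
  (proots [seq D * x | x <- s])`_i = D ^+ (size s - i) * (proots s)`_i.
Proof.
elim: s i => [|x s IH] i /=; first by rewrite leqn0 => /eqP ->; rewrite expr0 mul1r.
move=> iS; rewrite !proots_cons !mulrBl !coefB !coefXM !coefCM.
move: iS; rewrite leq_eqVlt => /predU1P[->|iS].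
  rewrite subnn expr0 mul1r /= IH // subnn expr0 mul1r.
  rewrite [(proots (map _ _))`_(size s).+1]nth_default ?size_proots ?size_map //.
  by rewrite [(proots s)`_(size s).+1]nth_default ?size_proots // !mulr0.
rewrite ltnS in iS; rewrite (IH i) // subSn // exprS mulrBr.
congr (_ - _); last by ring.
case: i iS => [|i] iS /=; first by rewrite mulr0.
by rewrite IH ?(ltnW iS) // subnS -exprS prednK // subn_gt0.
Qed.

Lemma coef_proots_bound s i : (forall x, x \in s -> `|x| <= 1) ->
  `|(proots s)`_i| <= 2 ^+ size s.
Proof.
elim: s i => [|x s IH] i xs /=.
  by rewrite /proots big_nil coef1 expr0; case: (i == 0%N); rewrite ?normr0 ?normr1.
have {}IH j : `|(proots s)`_j| <= 2 ^+ size s.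
  by apply: IH => y ys; apply: xs; rewrite inE ys orbT.
have x1 : `|x| <= 1 by apply: xs; rewrite inE eqxx.
rewrite proots_cons mulrBl coefB coefXM coefCM exprS.
apply: le_trans (ler_normB _ _) _; rewrite mulrDl mul1r lerD //.
  by case: (i == 0%N); rewrite ?normr0 ?exprn_ge0.
rewrite normrM; apply: le_trans (IH i).
by rewrite ler_piMl.
Qed.

Lemma coef_proots_bigO (D : R) s i : 0 < D -> (forall x, x \in s -> `|x| <= D) ->
  (i <= size s)%N -> `|(proots s)`_i| <= 2 ^+ size s * D ^+ (size s - i).
Proof.
move=> D0 sD iS.
have -> : s = [seq D * x | x <- [seq D^-1 * x | x <- s]].
  by rewrite -map_comp map_id_in // => x _ /=; rewrite mulVKf // gt_eqF.
rewrite !size_map coef_proots_scale size_map // normrM normrX (gtr0_norm D0) mulrC.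
rewrite ler_wpM2r ?exprn_ge0 ?(ltW D0) // -(size_map (fun x => D^-1 * x) s).
apply: coef_proots_bound => y /mapP[x xs ->].
by rewrite normrM normfV (gtr0_norm D0) ler_pdivrMl // mulr1 sD.
Qed.

(** Newton's identities for the first two power sums. Here [n] is one less than the number of roots,
    so a single root leaves no coefficient of index [n - 1], whence the [match]. *)
Lemma proots_sum_sqr x s :
  let p := proots (x :: s) in let n := size s in
  p`_n = - \sum_(y <- x :: s) y /\
  p`_n ^+ 2 - 2 * (if n is n'.+1 then p`_n' else 0) = \sum_(y <- x :: s) y ^+ 2.
Proof.
move=> p n; split; first by have := @coefPn_prod_XsubC R (x :: s) isT.
rewrite /p /n; elim: s x {p n} => [|y s IH] x.
  rewrite /proots !big_seq1 mulr0 subr0 coefB coefX coefC /= sub0r; ring.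
have lc := proots_lead s.
have c1 : (proots (y :: s))`_(size s) = - \sum_(z <- y :: s) z.
  by have := @coefPn_prod_XsubC R (y :: s) isT.
rewrite [\sum_(_ <- x :: _) _]big_cons -IH proots_cons /= !mulrBl !coefB !coefXM !coefCM /=.
have -> : (proots (y :: s))`_(size s).+1 = 1 by have := proots_lead (y :: s).
case: (size s) => [|k] /=; ring.
Qed.

Lemma comp_proots (c : R) s :
  proots s \Po ('X + c%:P) = proots [seq x - c | x <- s].
Proof.
rewrite /proots big_map (big_morph (fun u : {poly R} => u \Po ('X + c%:P))
  (fun u v => comp_polyM u v _) (comp_polyC 1 _ )).
apply: eq_bigr => x _; rewrite comp_polyB comp_polyX comp_polyC polyCB; ring.
Qed.

(** Otherwise [|p 0|] has a positive minimum on [[-C, C]], whereas [p t] has a root there and its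
    coefficients tend to those of [p 0]. *)
Lemma limit_root p n (C : R) : 0 <= C -> pan p -> (forall t, (size (p t) <= n)%N) ->
  (\forall t \near (0 : R)^', exists2 x, `|x| <= C & root (p t) x) ->
  exists x, root (p 0) x.
Proof.
move=> C0 ap pn rt; apply: contrapT => /forallNP nr.
have cont : {within `[- C, C], continuous (fun x => `|(p 0).[x]|)}.
  apply: continuous_subspaceT => x; apply: cvg_norm.
  exact: continuous_horner.
have [|c cC cmin] := EVT_min _ cont; first lra.
have d0 : 0 < `|(p 0).[c]|.
  by rewrite normr_gt0; apply/negP => /eqP r; apply: (nr c); rewrite /root r.
have : (fun t => \sum_(i < n) `|(p t)`_i - (p 0)`_i| * C ^+ i) @ (0 : R)^' --> (0 : R).
  rewrite -[X in _ --> X](_ : \sum_(i < n) `|(p 0)`_i - (p 0)`_i| * C ^+ i = 0); last first.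
    by rewrite big1 // => i _; rewrite subrr normr0 mul0r.
  apply: cvg_sumr => i _; apply: cvgMl; apply: cvg_norm; apply: cvgB; last exact: cvg_cst.
  by apply: cvg_trans (an_cvg0 (ap i)); apply: cvg_app; exact: cvg_within.
move/cvgrPdist_lt => /(_ _ d0) near0.
have rtn : \forall t \near (0 : R)^', (exists2 x : R, `|x| <= C & root (p t) x) /\
    `|0 - \sum_(i < n) `|(p t)`_i - (p 0)`_i| * C ^+ i| < `|(p 0).[c]| by exact: filterI.
have [t [[x xC r] tl]] := @filter_ex R (0 : R)^' _ _ rtn.
move: tl; rewrite sub0r normrN; apply/negP; rewrite -leNgt.
apply: le_trans (ler_norm _).
have xI : x \in `[- C, C] by rewrite in_itv /= -ler_norml.
apply: le_trans (cmin x xI) _.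
have -> : (p 0).[x] = (p 0).[x] - (p t).[x] by rewrite (eqP r) subr0.
rewrite !(horner_coef_wide _ (pn _)) -sumrB.
apply: le_trans (ler_norm_sum _ _ _) _; apply: ler_sum => i _.
rewrite -mulrBl normrM distrC normrX ler_wpM2l // lerXn2r ?nnegrE //.
Qed.

Lemma proots_dvd (u : {poly R}) s : u \is monic -> u %| proots s ->
  exists s', u = proots s'.
Proof.
move=> um /dvdp_prod_XsubC[m]; exists (mask m s); apply/eqP.
by rewrite -eqp_monic // monic_prod_XsubC.
Qed.

Lemma near0_neq : \forall t \near (0 : R)^', t != 0.
Proof. exact: nbhs_dnbhs_neq. Qed.

(** Near 0 the germ [h] keeps the sign of [h 0], so for odd [k] the values at [t] and [- t] would
    have opposite signs. *)
Lemma even_order (k : nat) (h : R -> R) : an h -> h 0 != 0 ->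
  (\forall t \near (0 : R)^', t ^+ k * h t <= 0) -> exists j, k = j.*2.
Proof.
move=> ah h0 sgn; exists k./2; apply/esym; rewrite -[RHS](odd_double_half k).
case: (boolP (odd k)) => [ok|]; rewrite ?add0n //; exfalso.
have h00 : 0 < `|h 0| by rewrite normr_gt0.
have /cvgrPdist_lt/(_ _ h00)/nbhs_normP[e /= e0 eh] := an_cvg0 ah.
move/nbhs_normP: sgn => [e' /= e'0 sgn].
pose t := Num.min e e' / 2.
have t0 : 0 < t by rewrite divr_gt0 // lt_min e0.
have te : t < e by rewrite ltr_pdivrMr // gt_min ltr_pMr // ltr1n.
have te' : t < e' by rewrite ltr_pdivrMr // gt_min [X in _ || X]ltr_pMr // ?ltr1n ?orbT.
have h1 : `|h 0 - h t| < `|h 0| by apply: eh; rewrite /= sub0r normrN gtr0_norm.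
have h2 : `|h 0 - h (- t)| < `|h 0| by apply: eh; rewrite /= sub0r opprK gtr0_norm.
have s1 : t ^+ k * h t <= 0.
  by apply: sgn; [rewrite /= sub0r normrN gtr0_norm|rewrite gt_eqF].
have s2 : (- t) ^+ k * h (- t) <= 0.
  by apply: sgn; [rewrite /= sub0r opprK gtr0_norm|rewrite oppr_eq0 gt_eqF].
rewrite pmulr_rle0 ?exprn_gt0 // in s1.
rewrite exprNn -signr_odd ok expr1 mulN1r mulNr oppr_le0 pmulr_rge0 ?exprn_gt0 // in s2.
have [h0p|h0n|h00'] := ltgtP (h 0) 0.
- move: h1 h2; rewrite (ltr0_norm h0p) !ltr_norml; lra.
- move: h1 h2; rewrite (gtr0_norm h0n) !ltr_norml; lra.
- by rewrite h00' eqxx in h0.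
Qed.

(* With the roots translated to sum 0, the sum of their squares has even order
   [2 k] at 0, so that all of them are O(t^k).  After division by [t^k] the
   polynomial at [t = 0] is no longer a power of a linear factor, and Hensel's
   lemma splits it into factors of smaller degree. *)
Theorem analytic_roots n p : pan p ->
  (forall t, p t \is monic /\ size (p t) = n.+1) ->
  (\forall t \near (0 : R)^', exists s, p t = proots s) ->
  exists lam : nat -> R -> R, (forall j, an (lam j)) /\
    \forall t \near (0 : R), p t = \prod_(0 <= j < n) ('X - (lam j t)%:P).
Proof.
elim/ltn_ind: n p => -[|[|m]] IH p ap pmn rr.
- exists (fun _ _ => 0); split => [j|]; first exact: an_cst.
  apply/nbhs_normP; exists 1 => //= t _; rewrite big_geq //.
  have [+ ps] := pmn t; rewrite monicE lead_coefE ps /= => /eqP p1.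
  by rewrite [p t]size1_polyC ?ps // p1.
- exists (fun _ t => - (p t)`_0); split => [j|]; first exact: anN.
  apply/nbhs_normP; exists 1 => //= t _; rewrite big_nat1; have [pm ps] := pmn t.
  apply/polyP => -[|[|i]].
  + by rewrite coefB coefX coefC /= sub0r opprK.
  + by rewrite coefB coefX coefC /= subr0; move: pm; rewrite monicE lead_coefE ps => /eqP.
  + by rewrite nth_default ?ps // nth_default // size_XsubC.
pose n := m.+2.
(* [c t] is the mean of the roots of [p t]. *)
pose c t := - (p t)`_m.+1 / m.+2%:R.
have ac : an c by apply: anM; [exact: anN|exact: an_cst].
pose pt t := p t \Po ('X + (c t)%:P).
have apt : pan pt by apply: (@pan_comp_affine R p n.+1) => // t; exact: (pmn t).2.
have n0 : n%:R != 0 :> R by rewrite pnatr_eq0.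
(* Translating the variable so that the roots sum to 0 makes [-2 (pt t)`_m]
   the sum of their squares. *)
have pts : \forall t \near (0 : R)^', exists s, [/\ size s = n, pt t = proots s,
    \sum_(x <- s) x = 0 & \sum_(x <- s) x ^+ 2 = - 2 * (pt t)`_m].
  apply: filterS rr => t [s ps].
  have sn : size s = n by have := (pmn t).2; rewrite ps size_proots => -[].
  have E : pt t = proots [seq x - c t | x <- s] by rewrite /pt ps comp_proots.
  have S0 : \sum_(x <- [seq x - c t | x <- s]) x = 0.
    rewrite big_map sumrB; case: s sn ps {E} => // x s [sn] ps.
    have [] := proots_sum_sqr x s; rewrite -ps sn => h1 _.
    rewrite big_const_seq count_predT iter_addr_0 -[\sum_(_ <- _) _]opprK -h1 /= sn /c.
    by rewrite -[_ / _ *+ _]mulr_natr divfK // subrr.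
  exists [seq x - c t | x <- s]; split => //; first by rewrite size_map.
  case: s sn ps E S0 => // x s [sn] ps E S0.
  have [h1 h2] := proots_sum_sqr (x - c t) [seq x - c t | x <- s].
  move: S0 h1 h2; rewrite /= => -> h1; rewrite h1 size_map sn -E => <-.
  by rewrite oppr0 expr0n /= sub0r mulNr.
(* Translating back gives the roots of [p]; the factorization at [t = 0] itself follows by
   continuity of the coefficients. *)
have back (lam : nat -> R -> R) : (forall j, an (lam j)) ->
   (\forall t \near (0 : R)^', pt t = \prod_(0 <= j < n) ('X - (lam j t)%:P)) ->
   exists lam : nat -> R -> R, (forall j, an (lam j)) /\
    \forall t \near (0 : R), p t = \prod_(0 <= j < n) ('X - (lam j t)%:P).
  move=> al lE; exists (fun j t => c t + lam j t); split=> [j|]; first exact: anD.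
  have h : \forall t \near (0 : R)^', p t = \prod_(0 <= j < n) ('X - (c t + lam j t)%:P).
    apply: filterS lE => t; rewrite /pt => E.
    have -> : p t = (p t \Po ('X + (c t)%:P)) \Po ('X + (- c t)%:P).
      by rewrite -comp_polyA comp_polyD comp_polyX comp_polyC -addrA -polyCD addNr addr0 comp_polyXr.
    rewrite E (big_morph (fun u : {poly R} => u \Po ('X + (- c t)%:P)) (fun u v => comp_polyM u v _) (comp_polyC 1 _ )).
    by apply: eq_bigr => j _; rewrite comp_polyB comp_polyX comp_polyC polyCD polyCN; ring.
  apply: (near_punctured _ h); apply: (pan_eq0 _ _ h) => //.
  apply: pan_prod => j; apply: panD; first exact: pan_cst.
  by under eq_fun do rewrite -polyCN; apply: panC; apply: anN; exact: anD.
(* Either the sum of squares vanishes near 0, and all roots coincide, or it has a finite order [K],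
   which is even because the sum does not change sign. *)
have [e0|[K [h [ah h0 eh]]]] := an_factor (apt m).
  apply: (back (fun _ _ => 0)) => [j|]; first exact: an_cst.
  near=> t.
  have [s [sn ps _ s2]] : exists s, [/\ size s = n, pt t = proots s,
    \sum_(x <- s) x = 0 & \sum_(x <- s) x ^+ 2 = - 2 * (pt t)`_m] by near: t.
  have sz : forall x, x \in s -> x = 0.
    move: s2; have -> : (pt t)`_m = 0 by near: t; exact: nbhs_dnbhs.
    rewrite mulr0 => /eqP; rewrite psumr_eq0; last by move=> x _; exact: sqr_ge0.
    by move=> /allP s2 x xs; move: (s2 x xs); rewrite /= expf_eq0 /= => /eqP.
  rewrite ps /proots -sn; rewrite (big_nth 0); apply: eq_big_nat => i /andP[_ iS].
  by rewrite (sz _ (mem_nth _ iS)).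
have [k KE] : exists k, K = k.*2.
  apply: even_order ah h0 _; apply: filterS pts => t [s [_ _ _ s2]].
  have : 0 <= \sum_(x <- s) x ^+ 2 by apply: sumr_ge0 => x _; exact: sqr_ge0.
  by rewrite s2 eh; lra.
have [C C0 Ch] := an_bounded ah.
(* Chosen so that [2 * C <= C' ^+ 2], which turns the bound on the sum of squares into a bound on
   each root. *)
pose C' := 1 + 2 * C.
have C'0 : 0 < C' by rewrite /C'; lra.
have ptb : \forall t \near (0 : R)^', exists s, [/\ size s = n, pt t = proots s,
    \sum_(x <- s) x = 0 & forall x, x \in s -> `|x| <= C' * `|t| ^+ k].
  near=> t.
  have [s [sn ps s1 s2]] : exists s, [/\ size s = n, pt t = proots s,
    \sum_(x <- s) x = 0 & \sum_(x <- s) x ^+ 2 = - 2 * (pt t)`_m] by near: t.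
  exists s; split => // x xs.
  have t0 : 0 <= `|t| ^+ k by exact: exprn_ge0.
  rewrite -[leRHS]ger0_norm ?mulr_ge0 ?(ltW C'0) // -ler_sqr ?nnegrE // !real_normK ?num_real //.
  apply: (@le_trans _ _ (\sum_(x <- s) x ^+ 2)).
    rewrite (big_rem x xs) /= lerDl; apply: sumr_ge0 => y _; exact: sqr_ge0.
  rewrite s2 eh KE -muln2 exprM.
  have ht : `|h t| <= C by near: t; exact: nbhs_dnbhs.
  rewrite exprMn -normrX real_normK ?num_real //.
  have : - h t <= C by move: ht; rewrite ler_norml; lra.
  move=> /(ler_wpM2l (sqr_ge0 (t ^+ k))).
  have : 2 * C <= C' ^+ 2 by rewrite /C'; have := sqr_ge0 C; nra.
  move=> /(ler_wpM2l (sqr_ge0 (t ^+ k))); lra.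
(* This coefficient is homogeneous of degree [n - i] in roots of size O(t^k), so it can be divided
   by [t ^+ (k * (n - i))]. *)
have hG i : exists g, an g /\ ((i < n)%N -> forall t, (pt t)`_i = t ^+ (k * (n - i)) * g t).
  have [iN|_] := ltnP i n; last by exists (fun=> 0); split => //; exact: an_cst.
  have [|g ag gE] := @an_bigO R (2 ^+ n * C' ^+ (n - i)) (k * (n - i)) _ (apt i); last by exists g.
  near=> t.
  have [s [sn -> _ sb]] : exists s, [/\ size s = n, pt t = proots s,
    \sum_(x <- s) x = 0 & forall x, x \in s -> `|x| <= C' * `|t| ^+ k] by near: t.
  have t0 : 0 < `|t| by rewrite normr_gt0; near: t; exact: near0_neq.
  have D0 : 0 < C' * `|t| ^+ k by rewrite mulr_gt0 // exprn_gt0.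
  have := coef_proots_bigO D0 sb; rewrite sn => /(_ i (ltnW iN)).
  by rewrite exprMn exprM mulrA.
pose G i := projT1 (cid (hG i)).
have aG i : an (G i) by rewrite /G; case: cid => g [].
have GE i : (i < n)%N -> forall t, (pt t)`_i = t ^+ (k * (n - i)) * G i t.
  by rewrite /G; case: cid => g [].
(* For [t != 0] its roots are those of [pt t] divided by [t ^+ k]; its coefficients are analytic at
   0 as well. *)
pose p2 t : {poly R} := \poly_(i < n.+1) (if i == n then 1 else G i t).
have p2s t : size (p2 t) = n.+1 by rewrite size_poly_eq // eqxx oner_neq0.
have p2c t i : (p2 t)`_i = if (i < n)%N then G i t else (i == n)%:R.
  rewrite coef_poly ltnS leq_eqVlt.
  by have [->|_] := eqVneq i n; rewrite ?ltnn.
have p2m t : p2 t \is monic by rewrite monicE lead_coefE p2s /= p2c ltnn eqxx.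
have ap2 : pan p2.
  move=> i; under eq_fun do rewrite p2c.
  by have [_|_] := ltnP i n; [exact: aG|exact: an_cst].
have ptm t : pt t \is monic /\ size (pt t) = n.+1.
  have sX : size ('X + (c t)%:P) = 2%N by exact: size_XaddC.
  split; last by rewrite size_comp_poly2 // (pmn t).2.
  rewrite monicE lead_coef_comp ?sX // lead_coefXaddC expr1n mulr1 -monicE.
  by have [] := pmn t.
have ptc t i : (i <= n)%N -> (pt t)`_i = t ^+ (k * (n - i)) * (p2 t)`_i.
  rewrite leq_eqVlt => /predU1P[->|iN]; last by rewrite p2c iN; exact: GE.
  rewrite subnn muln0 expr0 mul1r p2c ltnn eqxx.
  by have [] := ptm t; rewrite monicE lead_coefE => + E; rewrite E /= => /eqP.
have p2pt t s : t != 0 -> size s = n -> pt t = proots s ->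
    p2 t = proots [seq (t ^+ k)^-1 * x | x <- s].
  move=> t0 sn ps; apply/polyP => i; have [iN|iN] := leqP i n; last first.
    by rewrite !nth_default ?p2s // size_proots size_map sn.
  rewrite coef_proots_scale ?sn // -ps ptc // exprM mulrA -exprMn mulVf ?expr1n ?mul1r //.
  by rewrite expf_neq0.
have p2rr : \forall t \near (0 : R)^', exists s, [/\ size s = n, p2 t = proots s & forall x, x \in s -> `|x| <= C'].
  near=> t.
  have [s [sn ps _ sb]] : exists s, [/\ size s = n, pt t = proots s,
    \sum_(x <- s) x = 0 & forall x, x \in s -> `|x| <= C' * `|t| ^+ k] by near: t.
  have t0 : t != 0 by near: t; exact: near0_neq.
  exists [seq (t ^+ k)^-1 * x | x <- s]; split; first by rewrite size_map.
    exact: p2pt.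
  move=> y /mapP[x xs ->]; rewrite normrM normfV normrX ler_pdivrMl ?exprn_gt0 ?normr_gt0 //.
  by rewrite mulrC; exact: sb.
(* Exactly [t ^+ K] is removed from this coefficient, so that its value at 0 is not zero. Together
   with the vanishing of the next coefficient this excludes a single root of multiplicity [n]. *)
have p2_m : (p2 0)`_m = h 0.
  rewrite p2c ifT; last by rewrite /n.
  apply: an_eq0 => //; near=> t.
  have t0 : t != 0 by near: t; exact: near0_neq.
  have := eh t; rewrite GE // /n subSn // subSn // subnn muln2 -KE.
  by move/mulfI; apply; rewrite expf_neq0.
have p2_m1 : (p2 0)`_m.+1 = 0.
  rewrite p2c ifT; last by rewrite /n.
  apply: (@an_eq0 R _ (fun=> 0)) => //; first exact: an_cst.
  near=> t.
  have t0 : t != 0 by near: t; exact: near0_neq.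
  have [s [sn ps s0 _]] : exists s, [/\ size s = n, pt t = proots s,
    \sum_(x <- s) x = 0 & forall x, x \in s -> `|x| <= C' * `|t| ^+ k] by near: t.
  have : (pt t)`_m.+1 = 0.
    case: s sn ps s0 => // x s [sn] ps s0.
    by have [] := proots_sum_sqr x s; rewrite sn -ps s0 oppr0.
  rewrite GE // => /eqP; rewrite mulf_eq0 expf_eq0 (negPf t0) andbF /=.
  by move/eqP.
have [rho rhoP] : exists x, root (p2 0) x.
  apply: (@limit_root p2 n.+1 C' (ltW C'0) ap2) => [t|]; first by rewrite p2s.
  apply: filterS p2rr => t [[|x s] [// sn -> sb]].
  exists x; first by apply: sb; rewrite inE eqxx.
  by rewrite root_prod_XsubC inE eqxx.
have [mult [u unr p2E]] := multiplicity_XsubC (p2 0) rho.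
have {unr} : ~~ root u rho by move: unr; rewrite monic_neq0.
have Xm : ('X - rho%:P) ^+ mult \is monic by rewrite monic_exp // monicXsubC.
have um : u \is monic by have := p2m 0; rewrite p2E monicMr.
move=> unr.
have mu0 : (0 < mult)%N.
  by case: mult p2E {Xm} => // p2E; move: rhoP; rewrite p2E expr0 mulr1 (negPf unr).
have u0 : (0 < size u)%N by rewrite lt0n size_poly_eq0 monic_neq0.
have szu : (size u + mult = n.+1)%N.
  have := p2s 0; rewrite p2E size_Mmonic ?monic_neq0 //.
  have -> : size (('X - rho%:P) ^+ mult) = mult.+1.
    by rewrite size_exp_XsubC.
  by rewrite addnS.
(* If [rho] were the only root, the zero sum of the roots would give [rho = 0] and make the
   coefficient of index [m] vanish. *)
have mun : (mult < n)%N.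
  rewrite ltn_neqAle; apply/andP; split; last by move: szu u0; clear; lia.
  apply/negP => /eqP muE; rewrite muE in szu.
  have u1 : u = 1.
    have us : (size u <= 1)%N by move: szu; clear; lia.
    move: um; rewrite [u]size1_polyC // monicE lead_coefC => /eqP -> //.
  have p2E' : p2 0 = proots (rho :: nseq m.+1 rho).
    by rewrite p2E u1 mul1r muE /proots big_cons big_nseq iter_mulr_1 -exprS.
  have [e1 e2] := proots_sum_sqr rho (nseq m.+1 rho).
  rewrite -p2E' size_nseq p2_m1 p2_m in e1 e2.
  have r0 : rho = 0.
    move/eqP: e1; rewrite eq_sym oppr_eq0 big_cons big_nseq iter_addr_0 -mulrS -[_ *+ _]mulr_natr.
    by rewrite mulf_eq0 (negPf n0) orbF => /eqP.
  move: e2; rewrite big_cons big_nseq r0 iter_addr_0 expr0n /= mul0rn addr0.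
  move/eqP; rewrite sub0r oppr_eq0 mulf_eq0 (negPf h0) orbF pnatr_eq0 //.
have cop : coprimep (('X - rho%:P) ^+ mult) u.
  by rewrite coprimep_expl // coprimep_sym coprimep_XsubC.
have [q [v [aq av qm vm qv]]] :=
  @hensel R p2 n _ u ap2 (fun t => conj (p2m t) (p2s t)) Xm um cop (etrans p2E (mulrC _ _)).
have qv' : \forall t \near (0 : R)^', p2 t = q t * v t by exact: nbhs_dnbhs.
(* Off 0 the factors divide [p2 t], which is known to split only there; this is why the induction
   asks for real roots on a punctured neighbourhood. *)
have qrr : \forall t \near (0 : R)^', exists s, q t = proots s.
  apply: filterS2 qv' p2rr => t E [s [_ ps _]].
  apply: (@proots_dvd _ s); first by have [] := qm t.
  by rewrite -ps E dvdp_mulr.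
have vrr : \forall t \near (0 : R)^', exists s, v t = proots s.
  apply: filterS2 qv' p2rr => t E [s [_ ps _]].
  apply: (@proots_dvd _ s); first by have [] := vm t.
  by rewrite -ps E dvdp_mull.
have [|lam1 [al1 l1]] := IH _ mun q aq _ qrr.
  by move=> t; have [? ->] := qm t; rewrite size_exp_XsubC.
have nmu : (n - mult < m.+2)%N by move: mu0 mun; rewrite /n; clear; lia.
have [|lam2 [al2 l2]] := IH _ nmu v av _ vrr.
  move=> t; have [? ->] := vm t; split=> //.
  by apply/eqP; rewrite -(eqn_add2r mult) szu addSn subnK // ltnW.
apply: (back (fun j t => t ^+ k * (if (j < mult)%N then lam1 j t else lam2 (j - mult)%N t))).
  move=> j; apply: anM; first by apply: anX; exact: an_id.
  by have [_|_] := ltnP j mult.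
near=> t.
have E1 : p2 t = q t * v t by near: t.
have E2 : q t = \prod_(0 <= j < mult) ('X - (lam1 j t)%:P) by near: t; exact: nbhs_dnbhs.
have E3 : v t = \prod_(0 <= j < n - mult) ('X - (lam2 j t)%:P) by near: t; exact: nbhs_dnbhs.
pose lam j := if (j < mult)%N then lam1 j t else lam2 (j - mult)%N t.
have E4 : p2 t = proots [seq lam j | j <- index_iota 0 n].
  rewrite E1 E2 E3 /proots big_map [RHS](big_cat_nat (n := mult)) //=; last exact: ltnW.
  congr (_ * _); first by apply: eq_big_nat => j /andP[_ jm]; rewrite /lam jm.
  rewrite -{2}[mult]add0n big_addn; apply: eq_bigr => j _.
  by rewrite /lam ltnNge leq_addl /= addnK.
have -> : \prod_(0 <= j < n) ('X - (t ^+ k * lam j)%:P) =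
    proots [seq t ^+ k * x | x <- [seq lam j | j <- index_iota 0 n]].
  by rewrite /proots !big_map.
have sz : size [seq lam j | j <- index_iota 0 n] = n by rewrite size_map size_iota subn0.
apply/polyP => i; have [iN|iN] := leqP i n; last first.
  by rewrite !nth_default ?(ptm t).2 // size_proots size_map sz.
by rewrite coef_proots_scale sz // -E4 ptc // exprM.
Unshelve. all: by end_near.
Qed.

End AnalyticRoots.

(** * Symmetric pencils *)

Lemma rank_diag_mx (F : fieldType) n (d : 'rV[F]_n) :
  \rank (diag_mx d) = #|[pred i | d 0 i != 0]|.
Proof.
rewrite -sum1_card; elim: n d => [|n IH] d.
  by rewrite big_ord0; apply/eqP; rewrite -leqn0 rank_leq_row.
have [d1 [d2 dE]] : exists (d1 : 'rV[F]_1) (d2 : 'rV[F]_n), d = row_mx d1 d2.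
  by exists (@lsubmx F 1 1 n d), (@rsubmx F 1 1 n d); rewrite hsubmxK.
rewrite dE -[RHS]/(\sum_(i : 'I_(1 + n) | (row_mx d1 d2 0 i != 0)%R) 1)%N.
transitivity (\rank (diag_mx (row_mx d1 d2 : 'rV[F]_(1 + n)))); first by [].
rewrite diag_mx_row rank_diag_block_mx big_split_ord /=.
congr (_ + _)%N.
  rewrite big_mkcond big_ord1 row_mxEl.
  have -> : diag_mx d1 = (d1 0 0)%:M.
    by apply/matrixP => i j; rewrite !ord1 !mxE !mulr1n.
  have [->|d0] := eqVneq (d1 0 0) 0; first by rewrite raddf0 mxrank0.
  by rewrite mxrank_unit // unitmxE det_scalar1 unitfE.
by rewrite IH; apply: eq_bigl => i; rewrite !inE row_mxEr.
Qed.

Section Conjugation.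
Variables (F : fieldType) (n : nat) (P Q : 'M[F]_n).
Hypothesis QP : Q *m P = 1%:M.

Lemma unit_conjl : Q \in unitmx. Proof. by case: (mulmx1_unit QP). Qed.
Lemma unit_conjr : P \in unitmx. Proof. by case: (mulmx1_unit QP). Qed.

Lemma char_poly_conj (D : 'M[F]_n) : char_poly (Q *m D *m P) = char_poly D.
Proof.
rewrite /char_poly /char_poly_mx.
have QP' : map_mx polyC Q *m map_mx polyC P = 1%:M by rewrite -map_mxM QP map_mx1.
have -> : 'X%:M - map_mx polyC (Q *m D *m P) =
    map_mx polyC Q *m ('X%:M - map_mx polyC D) *m map_mx polyC P.
  by rewrite !map_mxM mulmxBr mulmxBl scalar_mxC -(mulmxA 'X%:M) QP' mulmx1.
by rewrite !det_mulmx mulrAC -det_mulmx QP' det1 mul1r.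
Qed.

Lemma rank_conj (D : 'M[F]_n) : \rank (Q *m D *m P) = \rank D.
Proof.
rewrite mxrankMfree ?row_free_unit ?unit_conjr // -mxrank_tr trmx_mul mxrankMfree ?mxrank_tr //.
by rewrite row_free_unit unitmx_tr unit_conjl.
Qed.

Lemma sub_scalar_conj (D : 'M[F]_n) (x : F) :
  Q *m D *m P - x%:M = Q *m (D - x%:M) *m P.
Proof. by rewrite mulmxBr mulmxBl scalar_mxC -(mulmxA x%:M) QP mulmx1. Qed.

Lemma det_conj (D : 'M[F]_n) : \det (Q *m D *m P) = \det D.
Proof. by rewrite !det_mulmx mulrAC -det_mulmx QP det1 mul1r. Qed.

End Conjugation.

Section Pencil.
Variable R : realType.
Local Notation conjC := (@Num.conj _).

(* With [g = S^* S] over [R[i]], the matrix [S L S^-1] is hermitian. *)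
Lemma pencil_spectrum n (g L : 'M[R]_n) : g^T = g -> (g *m L)^T = g *m L ->
  (forall v : 'rV[R]_n, v != 0 -> 0 < (v *m g *m v^T) 0 0) ->
  exists d : 'I_n -> R,
    char_poly L = \prod_(i < n) ('X - (d i)%:P) /\
    forall nu, \rank (L - nu%:M) = (n - #|[pred i | d i == nu]|)%N.
Proof.
move=> gs gLs gpos.
pose f := (real_complex R : {rmorphism R -> R[i]}).
have conjf (m k : nat) (A : 'M[R]_(m, k)) : map_mx conjC (map_mx f A) = map_mx f A.
  by apply/matrixP => i j; rewrite !mxE; apply: conj_Creal; apply/complex_realP; exists (A i j).
have symh (A : 'M[R]_n) : A^T = A -> (map_mx f A) \is hermsymmx.
  by move=> As; apply/is_hermitianmxP; rewrite expr0 scale1r map_trmx As conjf.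
pose G := map_mx f g; pose P := spectralmx G; pose s := spectral_diag G.
have Gh : G \is hermsymmx by exact: symh.
have GE : G = invmx P *m diag_mx s *m P.
  by apply/orthomx_spectralP; exact: hermitian_normalmx.
have Pu : P \is unitarymx by exact: spectral_unitarymx.
have Pun : P \in unitmx by exact: unitarymx_unit.
have PP : invmx P *m P = 1%:M by rewrite mulVmx.
have sreal := hermitian_spectral_diag_real Gh.
(* The eigenvalue [s 0 i] is real, so the real matrix [g - x%:M] is singular and has a real kernel
   vector, on which the positivity of [g] applies. *)
have spos i : 0 < s 0 i.
  have /complex_realP[x sx] : s 0 i \is Num.real by move/mxOverP: sreal.
  have dG : \det (G - (s 0 i)%:M) = 0.
    rewrite GE (sub_scalar_conj PP) (det_conj PP) -diag_const_mx -raddfB /= det_diag.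
    by rewrite (bigD1 i) //= !mxE subrr mul0r.
  have dg : \det (g - x%:M) = 0.
    apply: complexI; rewrite -[LHS]/(f (\det (g - x%:M))) -det_map_mx map_mxB map_scalar_mx.
    by rewrite rmorph0 -dG sx.
  move/eqP: dg => /det0P[v v0 vg].
  have := gpos v v0.
  have -> : v *m g = x *: v.
    by apply/eqP; rewrite -subr_eq0 -mul_mx_scalar -mulmxBr vg.
  rewrite sx ltcR -scalemxAl mxE => h; rewrite ltNge; apply/negP => x0.
  move: h; rewrite ltNge => /negP; apply; apply: mulr_le0_ge0 => //.
  by rewrite mxE sumr_ge0 // => k _; rewrite mxE -expr2 sqr_ge0.
have conjM (A B : 'M[R[i]]_n) : map_mx conjC (A *m B)^T = map_mx conjC B^T *m map_mx conjC A^T.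
  by rewrite trmx_mul map_mxM.
(* [S] is the diagonal matrix of the square roots of [s] times [P]; it is invertible because all
   [s 0 i] are positive. *)
have [S [Su SG]] : exists S : 'M[R[i]]_n, S \in unitmx /\ G = map_mx conjC S^T *m S.
  exists (diag_mx (map_mx sqrtC s) *m P); split.
    rewrite unitmx_mul Pun andbT unitmxE det_diag unitfE; apply/prodf_neq0 => i _.
    by rewrite mxE sqrtC_eq0 gt_eqF.
  rewrite conjM -invmx_unitary // tr_diag_mx map_diag_mx GE !mulmxA.
  congr (_ *m _); rewrite -!mulmxA mulmx_diag; congr (_ *m diag_mx _).
  apply/rowP => i; rewrite !mxE /= conj_Creal ?ger0_real ?sqrtC_ge0 ?ltW //.
  by rewrite -expr2 sqrtCK.
have [T [ST TS]] : exists T, S *m T = 1%:M /\ T *m S = 1%:M.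
  by exists (invmx S); rewrite mulmxV // mulVmx.
have [M [ME Mh]] : exists M, M = G *m map_mx f L /\ map_mx conjC M^T = M.
  by exists (map_mx f (g *m L)); rewrite map_mxM -map_mxM map_trmx gLs conjf.
(* [K] is similar to [L] and is also the congruence by [T] of the symmetric matrix [g *m L]; hence
   it is hermitian, with real spectrum and a unitary diagonalization. *)
pose K := S *m map_mx f L *m T.
have KE : K = map_mx conjC T^T *m M *m T.
  by rewrite ME SG !mulmxA -conjM ST trmx1 map_mx1 mul1mx.
have Kh : K \is hermsymmx.
  apply/is_hermitianmxP; rewrite expr0 scale1r KE !conjM -map_trmx trmxK.
  by rewrite -map_mx_comp (map_mx_id (@conjCK _)) mulmxA Mh.
have KE2 : K = invmx (spectralmx K) *m diag_mx (spectral_diag K) *m spectralmx K.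
  by apply/orthomx_spectralP; exact: hermitian_normalmx.
have dreal := hermitian_spectral_diag_real Kh.
have Ku : spectralmx K \in unitmx by exact: spectral_unit.
have LE : map_mx f L = (T *m invmx (spectralmx K)) *m diag_mx (spectral_diag K) *m
    (spectralmx K *m S).
  transitivity (T *m K *m S); last by rewrite {1}KE2 !mulmxA.
  by rewrite /K !mulmxA TS mul1mx -mulmxA TS mulmx1.
have QQ : T *m invmx (spectralmx K) *m (spectralmx K *m S) = 1%:M.
  by rewrite mulmxA -(mulmxA T) (mulVmx Ku) mulmx1 TS.
pose d i := complex.Re (spectral_diag K 0 i).
have dE i : spectral_diag K 0 i = f (d i).
  by rewrite /d /f /= RRe_real //; move/mxOverP: dreal.
exists d; split.
  apply: (map_poly_inj f); rewrite map_char_poly LE (char_poly_conj QQ) char_poly_trig ?diag_mx_is_trig //.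
  rewrite rmorph_prod; apply: eq_bigr => i _ /=.
  by rewrite map_polyXsubC !mxE eqxx mulr1n dE.
move=> nu; rewrite -(mxrank_map f) map_mxB map_scalar_mx LE (sub_scalar_conj QQ) (rank_conj QQ).
rewrite -diag_const_mx -raddfB /= rank_diag_mx -[X in (X - _)%N]card_ord -(cardC [pred i | d i == nu]) addKn.
apply: eq_card => i; rewrite !inE !mxE subr_eq0 dE.
by rewrite (inj_eq (@complexI R)).
Qed.

End Pencil.

(** * Eigenvalue branches of an analytic selfadjoint family of matrices *)

Section Branches.
Variable R : realType.

Lemma eq_proots_count (s1 s2 : seq R) x : proots s1 = proots s2 ->
  count_mem x s1 = count_mem x s2.
Proof.
by move=> e; rewrite -!mu_prod_XsubC -/(proots s1) -/(proots s2) e.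
Qed.

Lemma pan_sum (I : Type) (r : seq I) (f : I -> R -> {poly R}) :
  (forall i, pan (f i)) -> pan (fun t => \sum_(i <- r) f i t).
Proof.
move=> af; elim: r => [|i r IH].
  by under eq_fun do rewrite big_nil; exact: pan_cst.
by under eq_fun do rewrite big_cons; exact: panD.
Qed.

Lemma pan_char_poly r (M : R -> 'M[R]_r) : (forall i j, an (fun t => M t i j)) ->
  pan (fun t => char_poly (M t)).
Proof.
move=> aM; rewrite /char_poly /determinant; apply: pan_sum => s.
apply: panM; first exact: pan_cst.
apply: pan_prod => i; under eq_fun do rewrite !mxE.
apply: panD; first exact: pan_cst.
under eq_fun do rewrite -polyCN; apply: panC; exact: anN.
Qed.

Lemma card_nth r (f : nat -> R) (x : R) :
  #|[pred j : 'I_r | f j == x]| = count_mem x [seq f j | j <- index_iota 0 r].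
Proof.
rewrite count_map -sum1_card -sum1_count big_mkord.
by apply: eq_bigl => i; rewrite inE.
Qed.

Lemma rank_scalar_sub r (nu Lam : R) :
  \rank ((Lam%:M : 'M[R]_r) - nu%:M) = (r - #|[pred j : 'I_r | Lam == nu]|)%N.
Proof.
rewrite -raddfB /=; have [->|ne] := eqVneq Lam nu.
  by rewrite subrr raddf0 mxrank0 (eq_card (_ : _ =i predT)) ?card_ord ?subnn.
rewrite (eq_card0 (_ : _ =i pred0)) ?subn0 // mxrank_unit // unitmxE det_scalar unitfE.
by rewrite expf_neq0 // subr_eq0.
Qed.

(** The analytic factorization of the characteristic polynomial and the diagonalization of the
    pencil have the same multiset of roots, so geometric multiplicities can be read off from the
    analytic roots. *)
Lemma rank_from_roots r (g L : 'M[R]_r) (mu : nat -> R) : g^T = g -> (g *m L)^T = g *m L ->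
  (forall v : 'rV[R]_r, v != 0 -> 0 < (v *m g *m v^T) 0 0) ->
  char_poly L = \prod_(0 <= j < r) ('X - (mu j)%:P) ->
  forall nu, \rank (L - nu%:M) = (r - #|[pred j : 'I_r | mu j == nu]|)%N.
Proof.
move=> gs gLs gp Lmu nu; have [d [Ld ->]] := pencil_spectrum gs gLs gp.
congr (r - _)%N; rewrite card_nth.
have -> : #|[pred i | d i == nu]| = count_mem nu [seq d i | i <- index_enum 'I_r].
  rewrite count_map -sum1_card -sum1_count; apply: eq_bigl => i; by rewrite inE.
by apply: eq_proots_count; rewrite /proots !big_map -Lmu Ld.
Qed.

Lemma branches r (sg dl Lam : R) (A : nat -> 'M[R]_r) (L g : R -> 'M[R]_r) :
  0 < sg -> 0 < dl -> (forall i j, ps_on sg (fun m => A m i j) (fun t => L t i j)) ->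
  A 0%N = Lam%:M -> (A 1%N)^T = A 1%N ->
  (forall t : R, `|t| <= sg -> [/\ (g t)^T = g t, (g t *m L t)^T = g t *m L t &
    forall v : 'rV[R]_r, v != 0 -> 0 < (v *m g t *m v^T) 0 0]) ->
  exists (eps : R) (lam : 'I_r -> R -> R),
    [/\ 0 < eps /\ eps <= sg,
        forall j, real_analytic_on [set t | `|t| < eps] (lam j),
        forall j, lam j 0 = Lam,
        forall t : R, `|t| < eps -> (forall j, `|lam j t - Lam| < dl) /\
          forall nu, \rank (L t - nu%:M) = (r - #|[pred j | lam j t == nu]|)%N
      & forall nu, \rank (A 1%N - nu%:M) = (r - #|[pred j | derive1 (lam j) 0 == nu]|)%N].
Proof.
move=> sg0 dl0 LP A0 A1s gP.
have L0 : L 0 = Lam%:M.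
  by apply/matrixP => i j; rewrite (ps_on_at0 (ltW sg0) (LP i j)) A0.
pose L1 t := if t == 0 then A 1%N else t^-1 *: (L t - Lam%:M).
have LE t : L t = Lam%:M + t *: L1 t.
  rewrite /L1; have [->|t0] := eqVneq t 0; first by rewrite scale0r addr0.
  by rewrite scalerA mulfV // scale1r addrC subrK.
have L1P i j : ps_on sg (fun n => A n.+1 i j) (fun t => L1 t i j).
  have h1 := ps_on_cst (- (Lam%:M : 'M[R]_r) i j) (ltW sg0).
  have h2 := ps_on_add (ltW sg0) (LP i j) h1.
  have := @ps_on_shift R _ _ _ (fun t => L1 t i j) sg0 h2.
  rewrite /= A0 subrr => /(_ erefl) h3.
  have : ps_on sg (fun n => A n.+1 i j + 0) (fun t => L1 t i j).
    apply: h3; last by rewrite /L1 eqxx addr0.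
    by move=> t; rewrite LE !mxE addrAC subrr add0r.
  by congr ps_on; apply/funext => n; rewrite addr0.
have aL1 i j : an (fun t => L1 t i j) by exists sg => //; exists (fun n => A n.+1 i j).
have L1sym t : `|t| <= sg -> t != 0 -> (g t *m L1 t)^T = g t *m L1 t.
  move=> ts t0; have [gs gLs _] := gP t ts.
  rewrite /L1 (negPf t0) -scalemxAr mulmxBr linearZ /= linearB /= gLs.
  by rewrite trmx_mul tr_scalar_mx gs scalar_mxC.
have tsg : \forall t \near (0 : R)^', `|t| <= sg.
  apply: nbhs_dnbhs; apply/nbhs_normP; exists sg => //= t.
  by rewrite /= sub0r normrN => /ltW.
have [mu [amu muP]] : exists mu : nat -> R -> R, (forall j, an (mu j)) /\
    \forall t \near (0 : R), char_poly (L1 t) = \prod_(0 <= j < r) ('X - (mu j t)%:P).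
  apply: analytic_roots; first exact: pan_char_poly.
    by move=> t; rewrite char_poly_monic size_char_poly.
  near=> t; have t0 : t != 0 by near: t; exact: near0_neq.
  have ts : `|t| <= sg by near: t.
  have [gs _ gp] := gP t ts.
  have [d [-> _]] := pencil_spectrum gs (L1sym t ts t0) gp.
  by exists [seq d i | i <- index_enum 'I_r]; rewrite /proots big_map.
pose lam (j : 'I_r) t := Lam + t * mu j t.
have alam j : an (lam j).
  by apply: anD; [exact: an_cst|apply: anM => //; exact: an_id].
have lam0 j : lam j 0 = Lam by rewrite /lam mul0r addr0.
have [s s0 [a sa]] := an_ord alam.
have lamdl : \forall t \near (0 : R), forall j, `|lam j t - Lam| < dl.
  apply: (@filter_forall R _ (fun (j : 'I_r) t => `|lam j t - Lam| < dl) (nbhs (0 : R)) _) => j.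
  have := an_cvg0 (alam j); rewrite lam0 => /cvgrPdist_lt/(_ _ dl0).
  by apply: filterS => t; rewrite distrC.
have [e /= e0 eP] : nbhs_ball_ (ball_ Num.norm) (0 : R) (fun t => (forall j, `|lam j t - Lam| < dl) /\
    char_poly (L1 t) = \prod_(0 <= j < r) ('X - (mu j t)%:P)).
  by apply/nbhs_normP; exact: filterI lamdl muP.
pose eps := Num.min (Num.min s e) sg.
have eps0 : 0 < eps by rewrite !lt_min s0 e0.
exists eps, lam; split => //.
- by rewrite ge_min lexx orbT.
- move=> j t te; have := ps_on_recenter s0 (sa j); apply.
  by rewrite /= in te *; apply: lt_le_trans te _; rewrite !ge_min lexx.
- move=> t te; have [|lamd muE] := eP t.
    by rewrite /= sub0r normrN; apply: lt_le_trans te _; rewrite !ge_min lexx orbT.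
  split => // nu.
  have ts : `|t| <= sg by apply/ltW; apply: lt_le_trans te _; rewrite ge_min lexx orbT.
  have [gs _ gp] := gP t ts.
  (* At [t = 0] the relation between [L] and [L1] cannot be inverted; there [L 0] is scalar and all
     branches equal [Lam]. *)
  have [t0|t0] := eqVneq t 0.
    rewrite t0 L0 rank_scalar_sub; congr (r - _)%N; apply: eq_card => j.
    by rewrite !inE lam0.
  have -> : L t - nu%:M = t *: (L1 t - ((nu - Lam) / t)%:M).
    rewrite LE scalerBr scale_scalar_mx mulrC divfK // raddfB /= opprB addrCA.
    by rewrite addrA.
  rewrite mxrank_scale_nz // (rank_from_roots gs (L1sym t ts t0) gp muE).
  congr (r - _)%N; apply: eq_card => j; rewrite !inE /lam.
  by apply/eqP/eqP => [->|<-]; field.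
- move=> nu; have [|_ muE] := eP 0; first by rewrite /= subrr normr0.
  rewrite /L1 eqxx in muE.
  (* At 0 the identity serves as Gram matrix, since [A 1] is symmetric by assumption. *)
  rewrite (@rank_from_roots r 1%:M (A 1%N) (mu^~ 0)) ?trmx1 ?mul1mx //.
    by congr (r - _)%N; apply: eq_card => j; rewrite !inE /lam an_derive1.
  move=> v v0; rewrite mulmx1 mxE.
  have h i : 0 <= v 0 i * v^T i 0 by rewrite mxE -expr2 sqr_ge0.
  rewrite lt0r sumr_ge0 // andbT; apply: contra v0 => /eqP z0.
  apply/eqP/rowP => i; have /eqP := @psumr_eq0P _ _ xpredT _ (fun i _ => h i) z0 i isT.
  by rewrite !mxE mulf_eq0 orbb => /eqP.
Unshelve. all: by end_near.
Qed.

End Branches.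

(** * Perturbation of an eigenvalue of a form *)

Lemma ler_sum_term (R : realType) (I : finType) (F : I -> R) i :
  (forall i, 0 <= F i) -> F i <= \sum_j F j.
Proof. by move=> F0; rewrite (bigD1 i) //= lerDl sumr_ge0. Qed.

(** * Semidefinite forms: Riesz representation and vector-valued power series *)

Section Forms.
Variables (R : realType) (V : lmodType R).
Implicit Types (B : V -> V -> R) (u v w x : V).

Definition sym_bilinear B :=
  (forall (a : R) u v w, B (a *: u + v) w = a * B u w + B v w) /\
  (forall u v, B u v = B v u).

Definition is_linear (l : V -> R) := forall (a : R) u v, l (a *: u + v) = a * l u + l v.

Lemma is_linear0 l : is_linear l -> l 0 = 0.
Proof. by move=> ll; have := ll (-1) 0 0; rewrite scaler0 add0r mulN1r addNr. Qed.

Lemma is_linearD l u v : is_linear l -> l (u + v) = l u + l v.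
Proof. by move=> ll; rewrite -[u]scale1r ll mul1r scale1r. Qed.

Lemma is_linearZ l a u : is_linear l -> l (a *: u) = a * l u.
Proof. by move=> ll; rewrite -[_ *: _]addr0 ll is_linear0 // addr0. Qed.

Lemma is_linearB l u v : is_linear l -> l (u - v) = l u - l v.
Proof. by move=> ll; rewrite -scaleN1r addrC ll mulN1r addrC. Qed.

Lemma is_linear_sum l (I : Type) (r : seq I) (P : pred I) (f : I -> V) :
  is_linear l -> l (\sum_(i <- r | P i) f i) = \sum_(i <- r | P i) l (f i).
Proof.
by move=> ll; rewrite (big_morph l (fun u v => is_linearD u v ll) (is_linear0 ll)).
Qed.

Section Bil.
Variable B : V -> V -> R.
Hypothesis BP : sym_bilinear B.

Lemma bilC u v : B u v = B v u. Proof. by case: BP. Qed.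

Lemma bil_linl w : is_linear (B^~ w). Proof. by move=> a u v; case: BP => ->. Qed.

Lemma bil_linr w : is_linear (B w).
Proof. by move=> a u v; rewrite bilC; case: BP => -> _; rewrite (bilC u) (bilC v). Qed.

Lemma bilDl u v w : B (u + v) w = B u w + B v w.
Proof. exact: is_linearD (bil_linl w). Qed.
Lemma bilDr u v w : B w (u + v) = B w u + B w v.
Proof. exact: is_linearD (bil_linr w). Qed.
Lemma bilZl a u w : B (a *: u) w = a * B u w.
Proof. exact: is_linearZ (bil_linl w). Qed.
Lemma bilZr a u w : B w (a *: u) = a * B w u.
Proof. exact: is_linearZ (bil_linr w). Qed.
Lemma bilBl u v w : B (u - v) w = B u w - B v w.
Proof. exact: is_linearB (bil_linl w). Qed.
Lemma bilBr u v w : B w (u - v) = B w u - B w v.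
Proof. exact: is_linearB (bil_linr w). Qed.

Hypothesis B0 : forall u, 0 <= B u u.

Lemma cauchy_schwarz_sq u v : B u v ^+ 2 <= B u u * B v v.
Proof.
have q t : 0 <= B u u + 2 * t * B u v + t ^+ 2 * B v v.
  have := B0 (u + t *: v); rewrite !bilDl !bilDr !bilZl !bilZr [B v u]bilC.
  move/le_trans; apply; rewrite le_eqVlt; apply/orP; left; apply/eqP; ring.
(* The form is semidefinite, so [v] may be null. The quadratic polynomial is then affine in [t], and
   it is evaluated at the point where it would equal -1. *)
have [v0|v0] := eqVneq (B v v) 0.
  have [->|uv0] := eqVneq (B u v) 0; first by rewrite expr0n mulr_ge0.
  have := q (- (B u u + 1) / (2 * B u v)); rewrite v0 mulr0 addr0.
  have -> : 2 * (- (B u u + 1) / (2 * B u v)) * B u v = - (B u u + 1) by field.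
  lra.
have vp : 0 < B v v by rewrite lt_neqAle eq_sym v0 B0.
have := q (- B u v / B v v).
have -> : B u u + 2 * (- B u v / B v v) * B u v + (- B u v / B v v) ^+ 2 * B v v =
  B u u - B u v ^+ 2 / B v v by field.
by rewrite subr_ge0 ler_pdivrMr.
Qed.

Definition nrm u := Num.sqrt (B u u).

Lemma nrm_ge0 u : 0 <= nrm u. Proof. exact: sqrtr_ge0. Qed.

Lemma sqr_nrm u : nrm u ^+ 2 = B u u. Proof. exact: sqr_sqrtr. Qed.

Lemma cauchy_schwarz u v : `|B u v| <= nrm u * nrm v.
Proof.
rewrite -[leRHS]ger0_norm ?mulr_ge0 ?nrm_ge0 //.
by rewrite -ler_sqr ?nnegrE // !real_normK ?num_real // exprMn !sqr_nrm cauchy_schwarz_sq.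
Qed.

Lemma nrmD u v : nrm (u + v) <= nrm u + nrm v.
Proof.
rewrite -ler_sqr ?nnegrE ?addr_ge0 ?nrm_ge0 // sqrrD !sqr_nrm bilDl !bilDr [B v u]bilC.
have := le_trans (ler_norm _) (cauchy_schwarz u v); lra.
Qed.

Lemma nrmZ a u : nrm (a *: u) = `|a| * nrm u.
Proof. by rewrite /nrm bilZl bilZr mulrA -expr2 sqrtrM ?sqr_ge0 // sqrtr_sqr. Qed.

Lemma nrmN u : nrm (- u) = nrm u.
Proof. by rewrite -scaleN1r nrmZ normrN normr1 mul1r. Qed.

Lemma nrmBC u v : nrm (u - v) = nrm (v - u).
Proof. by rewrite -nrmN opprB. Qed.

Lemma nrm0 : nrm 0 = 0.
Proof. by have := nrmZ 0 0; rewrite scale0r normr0 mul0r. Qed.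

Lemma nrm_sum (I : Type) (r : seq I) (P : pred I) (f : I -> V) :
  nrm (\sum_(i <- r | P i) f i) <= \sum_(i <- r | P i) nrm (f i).
Proof.
elim/big_ind2: _ => //; first by rewrite nrm0.
by move=> u x v y ux vy; apply: le_trans (nrmD _ _) _; exact: lerD.
Qed.

Lemma nrm_sub_le u v : nrm u <= nrm v + nrm (u - v).
Proof. by apply: le_trans (nrmD _ _); rewrite addrC subrK. Qed.

Lemma nrm_eq0 u : (nrm u == 0) = (B u u == 0).
Proof. by rewrite sqrtr_eq0 eq_le B0 andbT. Qed.

Lemma bil_null u w : B u u = 0 -> B u w = 0.
Proof.
move=> u0; apply/eqP; rewrite -normr_le0; apply: le_trans (cauchy_schwarz _ _) _.
by rewrite [nrm u](_ : _ = 0) ?mul0r // /nrm u0 sqrtr0.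
Qed.

Definition cauchy_nrm (w : nat -> V) := forall e : R, 0 < e -> exists N : nat,
  forall m n, (N <= m)%N -> (N <= n)%N -> nrm (w m - w n) < e.

Definition complete_nrm := forall w : nat -> V, cauchy_nrm w ->
  exists w0, (fun n => nrm (w n - w0)) @ \oo --> (0 : R).

Lemma nrm_cvg_linear (l : V -> R) K (w : nat -> V) w0 : is_linear l ->
  (forall u, `|l u| <= K * nrm u) ->
  (fun n => nrm (w n - w0)) @ \oo --> (0 : R) -> (l \o w) @ \oo --> l w0.
Proof.
move=> ll lK ww; apply: (@cvg_dist_le _ _ (fun=> l w0) (fun n => K * nrm (w n - w0))).
- by move=> n /=; rewrite -is_linearB.
- by rewrite -(mulr0 K); apply: cvgMr.
- exact: cvg_cst.
Qed.

Lemma small_invS (e : R) : 0 < e -> exists N : nat, forall n, (N <= n)%N -> n.+1%:R^-1 < e.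
Proof.
move=> e0; have [N _ Ne] := near_infty_natSinv_lt (PosNum e0).
by exists N => n Nn; exact: Ne.
Qed.

(** The representing vector is the limit of a minimizing sequence of [B w w - 2 * l w]; no
    uniqueness is claimed, [B] being only semidefinite. *)
Theorem riesz (l : V -> R) K : complete_nrm -> is_linear l ->
  (forall u, `|l u| <= K * nrm u) -> exists v, forall w, B v w = l w.
Proof.
move=> cpl ll lK.
pose J w := B w w - 2 * l w.
have Jlb w : - K ^+ 2 <= J w.
  rewrite /J -sqr_nrm; have := le_trans (ler_norm _) (lK w).
  have := sqr_ge0 (nrm w - K); rewrite sqrrB; lra.
pose A := [set J w | w in [set: V]].
have Ainf : has_inf A by split; [exists (J 0), 0|exists (- K ^+ 2) => _ [w _ <-]].
have hw n : exists w, J w < inf A + n.+1%:R^-1.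
  have [|_ [w _ <-] Jw] := @inf_adherent _ A n.+1%:R^-1 _ Ainf; first by rewrite invr_gt0.
  by exists w.
have /choice[w wP] := hw.
have Jinf u : inf A <= J u by apply: ge_inf; [case: Ainf|exists u].
(* Parallelogram identity, with [J] at the midpoint of the two vectors bounded below by its
   infimum. *)
have wc m n : nrm (w m - w n) ^+ 2 <= 2 * m.+1%:R^-1 + 2 * n.+1%:R^-1.
  have := Jinf (2^-1 *: (w m + w n)).
  have := wP m; have := wP n; rewrite /J sqr_nrm bilBl !bilBr bilZl bilZr.
  rewrite bilDl !bilDr [B (w n) (w m)]bilC (is_linearZ _ _ ll) (is_linearD _ _ ll).
  move: (m.+1%:R^-1) (n.+1%:R^-1) => a b; lra.
have [|v vP] := cpl w.
  move=> e e0; have e4 : 0 < e ^+ 2 / 4 by rewrite divr_gt0 // exprn_gt0.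
  have [N Ne] := small_invS e4.
  exists N => m n Nm Nn; rewrite -ltr_sqr ?nnegrE ?nrm_ge0 ?(ltW e0) //.
  apply: le_lt_trans (wc m n) _; have := Ne m Nm; have := Ne n Nn.
  move: (m.+1%:R^-1) (n.+1%:R^-1) => x1 x2; lra.
exists v => u; apply/eqP; rewrite -subr_eq0; set g := _ - _.
have gl : is_linear (B^~ u) by exact: bil_linl.
have gK x : `|B x u| <= nrm u * nrm x by rewrite mulrC; exact: cauchy_schwarz.
have gc := nrm_cvg_linear gl gK vP.
have gq t : 0 <= 2 * t * g + t ^+ 2 * B u u.
  rewrite -oppr_le0; apply: (@cvg_le_bound R _ \oo _ (fun n => - (2 * t * (B (w n) u - l u) + t ^+ 2 * B u u) - n.+1%:R^-1)).
    rewrite -[X in _ --> X]subr0; apply: cvgB; last exact: cvg_harmonic.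
    apply: cvgN; apply: cvgD; last exact: cvg_cst.
    by apply: cvgMr; apply: cvgB => //; exact: cvg_cst.
  apply: nearW => n; have := Jinf (w n + t *: u); have := wP n.
  rewrite /J bilDl !bilDr !bilZl !bilZr [B u (w n)]bilC (is_linearD _ _ ll) (is_linearZ _ _ ll).
  move: (n.+1%:R^-1) => a; lra.
have Bu : 0 < 1 + B u u by have := B0 u; lra.
(* The summand 1 avoids a division by zero for null [u]; the value is a non-positive multiple of
   [g ^+ 2], which forces [g = 0]. *)
have := gq (- g / (1 + B u u)).
have -> : 2 * (- g / (1 + B u u)) * g + (- g / (1 + B u u)) ^+ 2 * B u u =
  - (g ^+ 2 * (2 + B u u) / (1 + B u u) ^+ 2) by field; lra.
rewrite oppr_ge0 pmulr_lle0 ?invr_gt0 ?exprn_gt0 // pmulr_lle0; last by have := B0 u; lra.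
by move=> g2; rewrite -sqrf_eq0 eq_le g2 sqr_ge0.
Qed.

(** The sum is a limit for a seminorm and is therefore described through bounded linear functionals.
    In the second bound every term after the constant one carries a factor [|t| / sg]. *)
Lemma vector_series (z : nat -> V) (sg K : R) : complete_nrm -> 0 < sg ->
  (forall N, \sum_(0 <= m < N) nrm (z m) * sg ^+ m <= K) ->
  exists Z : R -> V, forall t : R, `|t| <= sg ->
    (forall (l : V -> R) (K' : R), is_linear l -> (forall u, `|l u| <= K' * nrm u) ->
      series (fun m => l (z m) * t ^+ m) @ \oo --> l (Z t)) /\
    nrm (Z t - z 0%N) <= `|t| / sg * K.
Proof.
move=> cpl sg0 zK.
pose S t N := \sum_(0 <= m < N) t ^+ m *: z m.
pose T (t : R) N := \sum_(0 <= m < N) nrm (z m) * `|t| ^+ m.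
have ST t n m : (n <= m)%N -> nrm (S t m - S t n) <= T t m - T t n.
  move=> nm.
  have -> : S t m - S t n = \sum_(n <= i < m) t ^+ i *: z i.
    by rewrite /S [X in X - _](big_cat_nat (n := n)) //= addrAC subrr add0r.
  have -> : T t m - T t n = \sum_(n <= i < m) nrm (z i) * `|t| ^+ i.
    by rewrite /T [X in X - _](big_cat_nat (n := n)) //= addrAC subrr add0r.
  apply: le_trans (nrm_sum _ _ _) _.
  by apply: ler_sum => i _; rewrite nrmZ normrX mulrC.
have Tn t : nondecreasing_seq (T t).
  by apply: nondecreasing_series => n _ _; rewrite mulr_ge0 ?nrm_ge0 ?exprn_ge0.
have TK (t : R) N : `|t| <= sg -> T t N <= K.
  move=> ts; apply: le_trans (zK N); apply: ler_sum => m _.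
  by rewrite ler_wpM2l ?nrm_ge0 // lerXn2r ?nnegrE // ltW.
have K0 : 0 <= K by apply: le_trans (zK 0%N); rewrite big_geq.
have lim (t : R) : exists Zt, `|t| <= sg -> (fun N => nrm (S t N - Zt)) @ \oo --> (0 : R).
  have [ts|_] := boolP (`|t| <= sg); last by exists 0.
  have Tc : cvgn (T t).
    by apply: nondecreasing_is_cvgn => //; exists K => _ [N _ <-]; exact: TK.
  have [|Zt ZtP] := cpl (S t); last by exists Zt.
  move=> e e0; have Tc' := Tc; move/cvgrPdist_lt: Tc' => /(_ e e0)[N _ NP].
  have half m n : (N <= n)%N -> (n <= m)%N -> nrm (S t m - S t n) < e.
    move=> Nn nm; apply: le_lt_trans (ST _ _ _ nm) _.
    apply: le_lt_trans (NP n Nn); apply: le_trans (ler_norm _).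
    by rewrite lerB //; apply: nondecreasing_cvgn_le => //; exact: Tc.
  exists N => m n Nm Nn; have [nm|mn] := leqP n m; first exact: half.
  by rewrite nrmBC; apply: half => //; exact: ltnW.
have /choice[Z ZP] := lim.
exists Z => t ts; split.
  move=> l K' ll lK; have := nrm_cvg_linear ll lK (ZP t ts).
  suff -> : series (fun m => l (z m) * t ^+ m) = l \o S t by [].
  apply/funext => N; rewrite /series /= /S (is_linear_sum _ _ _ ll); apply: eq_bigr => m _.
  by rewrite (is_linearZ _ _ ll) mulrC.
apply: (@cvg_le_bound R _ \oo _ (fun N => nrm (Z t - z 0%N) - nrm (S t N - Z t))).
  by rewrite -[X in _ --> X]subr0; apply: cvgB; [exact: cvg_cst|exact: ZP].
near=> N; rewrite lerBlDr.
have -> : Z t - z 0%N = (S t N - z 0%N) - (S t N - Z t).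
  by rewrite opprB [RHS]addrC -addrA; congr (_ + _); rewrite addrA addNr add0r.
apply: le_trans (nrmD _ _) _; rewrite nrmN lerD2r.
have : (0 < N)%N by near: N; exact: nbhs_infty_gt.
case: (N) => // M _; rewrite /S big_nat_recl // expr0 scale1r addrAC subrr add0r.
apply: le_trans (nrm_sum _ _ _) _.
apply: le_trans (ler_wpM2l (_ : 0 <= `|t| / sg) (zK M.+1)); last by rewrite divr_ge0 // ltW.
rewrite big_nat_recl // mulrDr ler_wpDl ?mulr_ge0 ?nrm_ge0 ?invr_ge0 ?(ltW sg0) //.
rewrite mulr_sumr; apply: ler_sum => m _.
have -> : `|t| / sg * (nrm (z m.+1) * sg ^+ m.+1) = nrm (z m.+1) * (`|t| * sg ^+ m).
  by rewrite exprS; field; rewrite gt_eqF.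
rewrite nrmZ normrX mulrC ler_wpM2l ?nrm_ge0 // exprS ler_wpM2l // lerXn2r ?nnegrE //.
exact: ltW.
Unshelve. all: by end_near.
Qed.

End Bil.
End Forms.

(** * Inverting the shifted form transversally to the eigenspace *)

Section Eigenspace.
Variables (R : realType) (V : lmodType R).
Variables (E b : V -> V -> R).
Hypotheses (EP : sym_bilinear E) (E0 : forall u, 0 <= E u u).
Hypotheses (bP : sym_bilinear b) (b0 : forall u, 0 <= b u u).
Implicit Types (u v w x : V).

Definition graph_form u v := E u v + b u v.
Local Notation a := graph_form.

Lemma graph_form_bil : sym_bilinear a.
Proof.
split=> [t u v w|u v]; last by rewrite /a (bilC EP) (bilC bP).
by rewrite /a (bil_linl EP) (bil_linl bP); ring.
Qed.

Lemma graph_form_ge0 u : 0 <= a u u. Proof. exact: addr_ge0. Qed.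

Lemma nrm_b_le u : nrm b u <= nrm a u.
Proof. by rewrite ler_sqrt ?graph_form_ge0 // lerDr. Qed.

Lemma nrm_E_le u : nrm E u <= nrm a u.
Proof. by rewrite ler_sqrt ?graph_form_ge0 // lerDl. Qed.

Hypothesis a_complete : complete_nrm a.
(** The L^2 limit of an [a]-bounded sequence is not known to be in [V], so compactness is expressed
    by Cauchy subsequences. *)
Hypothesis a_compact : forall w : nat -> V, (exists M : R, forall n, nrm a (w n) <= M) ->
  exists2 k : nat -> nat, (forall n, (k n < k n.+1)%N) & cauchy_nrm b (w \o k).
Hypothesis b_null : forall u, b u u = 0 -> E u u = 0.

Variables (Lam : R) (r : nat) (phi : 'I_r -> V).
Hypothesis Lam0 : 0 <= Lam.
Hypothesis phi_eig : forall i w, E (phi i) w = Lam * b (phi i) w.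
Hypothesis phi_orth : forall i j, b (phi i) (phi j) = (i == j)%:R.
(** Completeness of [phi] in the eigenspace, phrased through orthogonality so that no equality of
    vectors is involved. *)
Hypothesis phi_span : forall u, (forall w, E u w = Lam * b u w) ->
  (forall i, b u (phi i) = 0) -> b u u = 0.

Lemma Lam1 : 0 < 1 + Lam.
Proof. by rewrite ltr_pwDl. Qed.

Lemma null_a u : b u u = 0 -> nrm a u = 0.
Proof. by move=> u0; rewrite /nrm /a u0 b_null // addr0 sqrtr0. Qed.

Definition shift_form u v := E u v - Lam * b u v.
Local Notation c := shift_form.

Lemma shift_form_bil : sym_bilinear c.
Proof.
split=> [t u v w|u v]; last by rewrite /c (bilC EP) (bilC bP).
by rewrite /c (bil_linl EP) (bil_linl bP); ring.
Qed.

Lemma shift_form_phi i w : c (phi i) w = 0.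
Proof. by rewrite /c phi_eig subrr. Qed.

Lemma shift_form_bound u w : `|c u w| <= (1 + Lam) * nrm a u * nrm a w.
Proof.
apply: le_trans (ler_normB _ _) _; rewrite mulrDl mul1r mulrDl lerD //.
  apply: le_trans (cauchy_schwarz EP E0 _ _) _.
  by rewrite ler_pM ?nrm_ge0 // nrm_E_le.
rewrite normrM (ger0_norm Lam0) -mulrA ler_wpM2l //.
apply: le_trans (cauchy_schwarz bP b0 _ _) _.
by rewrite ler_pM ?nrm_ge0 // nrm_b_le.
Qed.

Lemma nrm_b_phi i : nrm b (phi i) = 1.
Proof. by rewrite /nrm phi_orth eqxx sqrtr1. Qed.

Lemma b_phi_le u i : `|b u (phi i)| <= nrm b u.
Proof. by apply: le_trans (cauchy_schwarz bP b0 _ _) _; rewrite nrm_b_phi mulr1. Qed.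

Lemma subseq_ge (k : nat -> nat) n : (forall n, (k n < k n.+1)%N) -> (n <= k n)%N.
Proof. by move=> kk; elim: n => // n IH; apply: leq_ltn_trans IH (kk n). Qed.

(* Otherwise compactness produces a unit vector of the eigenspace that is
   orthogonal to all [phi i]. *)
Lemma coercive : exists2 C : R, 0 <= C & forall u (K : R), 0 <= K ->
  (forall i, b u (phi i) = 0) -> (forall w, `|c u w| <= K * nrm a w) ->
  nrm a u <= C * K.
Proof.
apply: contrapT => nC.
have H n : exists u, [/\ nrm a u = 1, forall i, b u (phi i) = 0 &
    forall w, `|c u w| <= n.+1%:R^-1 * nrm a w].
  apply: contrapT => nu; apply: nC; exists n.+1%:R => // u K K0 ub uc.
  rewrite leNgt; apply/negP => Ku; apply: nu.
  have u0 : 0 < nrm a u by apply: le_lt_trans Ku; rewrite mulr_ge0.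
  exists ((nrm a u)^-1 *: u); split.
  - by rewrite (nrmZ graph_form_bil) ger0_norm ?invr_ge0 ?ltW // mulVf // gt_eqF.
  - by move=> i; rewrite (bilZl bP) ub mulr0.
  move=> w; rewrite (bilZl shift_form_bil) normrM normfV (gtr0_norm u0) ler_pdivrMl //.
  apply: le_trans (uc w) _; rewrite mulrA ler_wpM2r ?nrm_ge0 //.
  by rewrite ler_pdivlMr // mulrC ltW.
have /choice[w wP] := H.
have [|k kk kc] := a_compact (w := w).
  by exists 1 => n; have [-> _ _] := wP n.
pose y := w \o k.
(* [a d d] equals [c d d + (1 + Lam) * b d d]: the first term is small because the functionals
   [c (w n)] tend to zero, the second by compactness. *)
have yc : cauchy_nrm a y.
  move=> e e0.
  have e3 : 0 < e / 4 by rewrite divr_gt0.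
  have eL : 0 < e / (4 * (1 + Lam)) by rewrite divr_gt0 // mulr_gt0 // Lam1.
  have [N1 N1P] := small_invS e3; have [N2 N2P] := kc _ eL.
  exists (maxn N1 N2) => m n; rewrite !geq_max => /andP[m1 m2] /andP[n1 n2].
  set d := y m - y n.
  have [->//|dn0] := eqVneq (nrm a d) 0.
  have d0 : 0 < nrm a d by rewrite lt_neqAle eq_sym dn0 nrm_ge0.
  have dE : a d d = c (y m) d - c (y n) d + (1 + Lam) * b d d.
    by rewrite -(bilBl shift_form_bil) -/d /a /c; ring.
  have [_ _ ym] := wP (k m); have [_ _ yn] := wP (k n).
  have h1 : c (y m) d <= (k m).+1%:R^-1 * nrm a d by apply: le_trans (ler_norm _) (ym _).
  have h2 : - c (y n) d <= (k n).+1%:R^-1 * nrm a d.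
    by apply: le_trans (yn _); rewrite -normrN ler_norm.
  have h3 : b d d <= nrm b d * nrm a d.
    by rewrite -(sqr_nrm b0) expr2 ler_wpM2l ?nrm_ge0 ?nrm_b_le.
  have h4 := ler_wpM2l (ltW Lam1) h3.
  have : nrm a d ^+ 2 <= ((k m).+1%:R^-1 + (k n).+1%:R^-1 + (1 + Lam) * nrm b d) * nrm a d.
    rewrite sqr_nrm; last exact: graph_form_ge0.
    have -> : ((k m).+1%:R^-1 + (k n).+1%:R^-1 + (1 + Lam) * nrm b d) * nrm a d =
      (k m).+1%:R^-1 * nrm a d + (k n).+1%:R^-1 * nrm a d + (1 + Lam) * (nrm b d * nrm a d).
      by ring.
    by rewrite dE; exact: lerD (lerD h1 h2) h4.
  rewrite expr2 ler_pM2r // => /le_lt_trans; apply.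
  have b1 : (k m).+1%:R^-1 < e / 4 by apply: N1P; apply: leq_trans m1 (subseq_ge _ kk).
  have b2 : (k n).+1%:R^-1 < e / 4 by apply: N1P; apply: leq_trans n1 (subseq_ge _ kk).
  have b3 : (1 + Lam) * nrm b d <= e / 4.
    have : nrm b d <= e / (4 * (1 + Lam)) by apply: ltW; exact: N2P.
    move/(ler_wpM2l (ltW Lam1)) => /le_trans; apply.
    by rewrite le_eqVlt; apply/orP; left; apply/eqP; field; rewrite gt_eqF // Lam1.
  apply: lt_le_trans (ltr_leD (ltrD b1 b2) b3) _; lra.
have [u uP] := a_complete yc.
have ub i : b u (phi i) = 0.
  have l1 : is_linear (b^~ (phi i)) by exact: bil_linl.
  have lK x : `|b x (phi i)| <= 1 * nrm a x.
    by rewrite mul1r; apply: le_trans (b_phi_le _ _) (nrm_b_le _).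
  have := nrm_cvg_linear l1 lK uP.
  rewrite [X in X @ _ --> _](_ : _ = fun=> 0); last first.
    by apply/funext => n /=; have [_ -> _] := wP (k n).
  by move/(cvg_lim (@Rhausdorff R)) => <-; rewrite lim_cst.
have uc x : c u x = 0.
  have l1 : is_linear (c^~ x) by exact: (bil_linl shift_form_bil).
  have lK z : `|c z x| <= ((1 + Lam) * nrm a x) * nrm a z.
    by rewrite mulrAC; exact: shift_form_bound.
  have h1 := nrm_cvg_linear l1 lK uP.
  have h2 : ((c^~ x) \o y) @ \oo --> (0 : R).
    apply: (@cvg_dist_le _ _ (fun=> 0) (fun n => n.+1%:R^-1 * nrm a x)).
    - move=> n /=; rewrite subr0; have [_ _ yn] := wP (k n).
      apply: le_trans (yn x) _; rewrite ler_wpM2r ?nrm_ge0 // lef_pV2 ?posrE // ler_nat ltnS.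
      exact: subseq_ge.
    - by rewrite -(mul0r (nrm a x)); apply: cvgMl; exact: cvg_harmonic.
    - exact: cvg_cst.
  by rewrite -(cvg_lim (@Rhausdorff R) h1); exact: (cvg_lim (@Rhausdorff R) h2).
(* The limit lies in the kernel of [c] and is orthogonal to [phi], hence null, although the [y n]
   have norm 1. *)
have u0 : nrm a u = 0.
  apply: null_a; apply: phi_span => // x.
  by apply/eqP; rewrite -subr_eq0; apply/eqP; exact: uc.
have : (1 : R) <= 0.
  apply: (@cvg_le_bound R _ \oo _ (fun n => 1 - nrm a (y n - u))).
    by rewrite -[X in _ --> X]subr0; apply: cvgB => //; exact: cvg_cst.
  apply: nearW => n; rewrite subr_le0.
  have [e1 _ _] := wP (k n).
  by have := nrm_sub_le graph_form_bil graph_form_ge0 (y n) u; rewrite u0 add0r {1}/y /= e1.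
by rewrite leNgt ltr01.
Qed.

Definition phi_part u := \sum_i b u (phi i) *: phi i.

Lemma b_phi_part u j : b (phi_part u) (phi j) = b u (phi j).
Proof.
rewrite /phi_part (is_linear_sum _ _ _ (bil_linl bP _)) (bigD1 j) //= (bilZl bP) phi_orth eqxx mulr1.
by rewrite big1 ?addr0 // => i ij; rewrite (bilZl bP) phi_orth (negPf ij) mulr0.
Qed.

Lemma shift_form_phi_part u w : c (phi_part u) w = 0.
Proof.
rewrite /phi_part (is_linear_sum _ _ _ (bil_linl shift_form_bil _)) big1 // => i _.
by rewrite (bilZl shift_form_bil) shift_form_phi mulr0.
Qed.

Lemma nrm_a_phi i : nrm a (phi i) <= 1 + Lam.
Proof.
rewrite -ler_sqr ?nnegrE ?nrm_ge0 ?addr_ge0 // (sqr_nrm graph_form_ge0) /a phi_eig phi_orth eqxx.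
rewrite mulr1 -subr_ge0 (_ : _ - _ = Lam * (1 + Lam)); last by rewrite /=; ring.
by rewrite mulr_ge0 // ltW // Lam1.
Qed.

Lemma nrm_a_phi_part u : nrm a (phi_part u) <= (1 + Lam) * \sum_i `|b u (phi i)|.
Proof.
apply: le_trans (nrm_sum graph_form_bil graph_form_ge0 _ _ _) _; rewrite mulr_sumr; apply: ler_sum => i _.
by rewrite (nrmZ graph_form_bil) mulrC ler_wpM2r // nrm_a_phi.
Qed.

(** [c] is indefinite, so Riesz is applied to a normal equation: with [T] representing [c] for [a],
    the form [a (T u) (T v)] plus the pairing of the coordinates along [phi] is non-negative and, by
    [coercive], equivalent to [a]. Subtracting from [l] its part along [phi] is the solvability
    condition. *)
Lemma solve_shift_form (l : V -> R) (K : R) : is_linear l -> (forall w, `|l w| <= K * nrm b w) ->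
  exists x, (forall i, b x (phi i) = 0) /\
    forall w, c x w = l w - \sum_i l (phi i) * b (phi i) w.
Proof.
move=> ll lK.
have [C C0 Cc] := coercive.
have hT u : exists Tu, forall w, a Tu w = c u w.
  apply: (riesz graph_form_bil graph_form_ge0 a_complete (bil_linr shift_form_bil u)) => w; exact: shift_form_bound.
have /choice[T TP] := hT.
have aT u : nrm a (T u) <= (1 + Lam) * nrm a u.
  have [->|n0] := eqVneq (nrm a (T u)) 0; first by rewrite mulr_ge0 ?nrm_ge0 ?addr_ge0.
  have p0 : 0 < nrm a (T u) by rewrite lt_neqAle eq_sym n0 nrm_ge0.
  rewrite -(ler_pM2r p0) -expr2 (sqr_nrm graph_form_ge0) TP.
  by apply: le_trans (ler_norm _) _; exact: shift_form_bound.
have TC u v : c u (T v) = c v (T u) by rewrite -TP (bilC graph_form_bil) TP.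
pose t u v := c u (T v) + \sum_i b u (phi i) * b v (phi i).
have tP : sym_bilinear t.
  split=> [s u v w|u v]; last first.
    by rewrite /t TC; congr (_ + _); apply: eq_bigr => i _; rewrite mulrC.
  rewrite /t (bil_linl shift_form_bil _ s u v) (mulrDr s (c u (T w))) addrACA; congr (_ + _).
  rewrite mulr_sumr -big_split /=; apply: eq_bigr => i _.
  by rewrite (bil_linl bP); ring.
have tE u : t u u = nrm a (T u) ^+ 2 + \sum_i b u (phi i) ^+ 2.
  by rewrite (sqr_nrm graph_form_ge0) /t TP.
have t0 u : 0 <= t u u.
  by rewrite tE addr_ge0 ?sqr_ge0 // sumr_ge0 // => i _; exact: sqr_ge0.
have tT u : nrm a (T u) <= nrm t u.
  rewrite -ler_sqr ?nnegrE ?nrm_ge0 // [leRHS](sqr_nrm t0) tE lerDl.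
  by rewrite sumr_ge0 // => i _; exact: sqr_ge0.
have tphi u i : `|b u (phi i)| <= nrm t u.
  rewrite -[leRHS]ger0_norm ?nrm_ge0 // -ler_sqr ?nnegrE // !real_normK ?num_real //.
  rewrite (sqr_nrm t0) tE (bigD1 i) //= addrCA lerDl addr_ge0 ?sqr_ge0 // sumr_ge0 // => j _.
  exact: sqr_ge0.
pose C1 := C + (1 + Lam) * r%:R.
have C10 : 0 <= C1 by rewrite addr_ge0 // mulr_ge0 // addr_ge0.
(* [coercive] bounds the component orthogonal to [phi], and the coordinates bound the rest. *)
have ta u : nrm a u <= C1 * nrm t u.
  rewrite -[u](subrK (phi_part u)); apply: le_trans (nrmD graph_form_bil graph_form_ge0 _ _) _.
  rewrite [X in C1 * nrm t X]subrK /C1 mulrDl lerD //.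
    apply: le_trans (_ : _ <= C * nrm a (T u)) _; last by rewrite ler_wpM2l.
    apply: Cc; first exact: nrm_ge0.
      by move=> i; rewrite (bilBl bP) b_phi_part subrr.
    move=> w; rewrite (bilBl shift_form_bil) shift_form_phi_part subr0 -TP.
    exact: (cauchy_schwarz graph_form_bil graph_form_ge0).
  apply: le_trans (nrm_a_phi_part _) _; rewrite -mulrA ler_wpM2l ?addr_ge0 //.
  apply: le_trans (ler_sum _ (fun i _ => tphi u i)) _.
  by rewrite sumr_const card_ord mulr_natl.
pose C2 := 1 + Lam + r%:R.
have at_ u : nrm t u <= C2 * nrm a u.
  rewrite -ler_sqr ?nnegrE ?mulr_ge0 ?addr_ge0 ?nrm_ge0 // (sqr_nrm t0) tE.
  have h1 : nrm a (T u) ^+ 2 <= ((1 + Lam) * nrm a u) ^+ 2.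
    by rewrite lerXn2r ?nnegrE ?mulr_ge0 ?addr_ge0 ?nrm_ge0.
  have h2 : \sum_i b u (phi i) ^+ 2 <= r%:R * nrm a u ^+ 2.
    apply: (@le_trans _ _ (\sum_(i < r) nrm a u ^+ 2)).
      apply: ler_sum => i _; rewrite -(real_normK (num_real (b u (phi i)))).
      rewrite lerXn2r ?nnegrE ?nrm_ge0 //.
      by apply: le_trans (b_phi_le _ _) (nrm_b_le _).
    by rewrite sumr_const card_ord mulr_natl.
  apply: le_trans (lerD h1 h2) _; rewrite !exprMn -mulrDl ler_wpM2r ?sqr_ge0 // /C2.
  have r0 : 0 <= r%:R :> R by [].
  rewrite [leRHS]sqrrD -addrA lerD2l.
  have r1 : r%:R <= (1 + Lam) * r%:R by rewrite ler_peMl // lerDl.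
  have r2 := sqr_ge0 (r%:R : R).
  by rewrite mulr2n -addrA; apply: le_trans r1 _; rewrite lerDl addr_ge0 // mulr_ge0 // ltW // Lam1.
have t_complete : complete_nrm t.
  move=> w wc; have [|u uP] := a_complete (w := w).
    move=> e e0.
    have C11 : 0 < C1 + 1 by lra.
    have [|N NP] := wc (e / (C1 + 1)); first by rewrite divr_gt0.
    exists N => m n mN nN; apply: le_lt_trans (ta _) _.
    apply: (@le_lt_trans _ _ ((C1 + 1) * nrm t (w m - w n))).
      by rewrite ler_wpM2r ?nrm_ge0 // lerDl.
    by rewrite mulrC -ltr_pdivlMr //; exact: NP.
  exists u; apply: (@cvg_dist_le _ _ (fun=> 0) (fun n => C2 * nrm a (w n - u))).
  - by move=> n; rewrite subr0 ger0_norm ?nrm_ge0.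
  - by rewrite -(mulr0 C2); apply: cvgMr.
  - exact: cvg_cst.
pose l' w := l w - \sum_i l (phi i) * b (phi i) w.
have l'l : is_linear l'.
  move=> s u v; rewrite /l' ll.
  have -> : \sum_i l (phi i) * b (phi i) (s *: u + v) =
      s * (\sum_i l (phi i) * b (phi i) u) + \sum_i l (phi i) * b (phi i) v.
    rewrite mulr_sumr -big_split /=; apply: eq_bigr => i _.
    by rewrite (bil_linr bP); ring.
  ring.
have l'phi j : l' (phi j) = 0.
  rewrite /l' (bigD1 j) //= phi_orth eqxx mulr1 big1 ?addr0 ?subrr // => i ij.
  by rewrite phi_orth (negPf ij) mulr0.
have [v vP] : exists v, forall w, a v w = l' w.
  apply: (riesz graph_form_bil graph_form_ge0 (K := K + \sum_i `|l (phi i)|) a_complete l'l) => w.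
  have K0 : 0 <= K * nrm b w by apply: le_trans (lK w).
  apply: le_trans (_ : _ <= K * nrm b w + (\sum_i `|l (phi i)|) * nrm b w) _.
    apply: le_trans (ler_normB _ _) _; rewrite lerD // mulr_suml.
    apply: le_trans (ler_norm_sum _ _ _) _; apply: ler_sum => i _.
    by rewrite normrM ler_wpM2l // (bilC bP) b_phi_le.
  rewrite -mulrDl.
  (* The sign of the constant is only known once some [nrm b w] is positive; otherwise both sides
     vanish. *)
  have [w0|w0] := eqVneq (nrm b w) 0.
    have : b w w = 0 by apply/eqP; rewrite -(nrm_eq0 b0) w0.
    by move/null_a => ->; rewrite w0.
  have wp : 0 < nrm b w by rewrite lt_neqAle eq_sym w0 nrm_ge0.
  rewrite ler_wpM2l ?nrm_b_le // addr_ge0 ?sumr_ge0 //.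
  by rewrite -(pmulr_lge0 _ wp).
(* The normal equation; testing it on [phi i] shows that [x] is orthogonal to [phi]. *)
have [x xP] : exists x, forall w, t x w = c w v.
  apply: (riesz tP t0 (K := (1 + Lam) * nrm a v * C1) t_complete (bil_linl shift_form_bil v)) => w.
  apply: le_trans (shift_form_bound _ _) _; rewrite mulrAC -!mulrA ler_wpM2l ?addr_ge0 //.
  by rewrite ler_wpM2l ?nrm_ge0.
have xphi i : b x (phi i) = 0.
  have := xP (phi i); rewrite shift_form_phi (bilC tP) /t shift_form_phi add0r (bigD1 i) //= phi_orth eqxx mul1r.
  by rewrite big1 ?addr0 // => j ji; rewrite phi_orth eq_sym (negPf ji) mul0r.
exists x; split => // w.
(* [d] is in the kernel of [c] and orthogonal to [phi], hence null, so that [T x] and [v] represent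
   the same functional. *)
pose d := T x - v.
have cd z : c d z = 0.
  rewrite (bilC shift_form_bil) (bilBr shift_form_bil); apply/eqP; rewrite subr_eq0 -xP (bilC tP) /t.
  by rewrite [X in _ + X]big1 ?addr0 // => i _; rewrite xphi mulr0.
have dd : b d d = 0.
  apply: phi_span => [z|i]; first by apply/eqP; rewrite -subr_eq0; apply/eqP/cd.
  have : a d (phi i) = 0 by rewrite (bilBl graph_form_bil) TP vP l'phi (bilC shift_form_bil) shift_form_phi subr0.
  rewrite /a (bilC EP) phi_eig (bilC bP) -[X in _ + X]mul1r -mulrDl => /eqP.
  by rewrite mulf_eq0 (_ : Lam + 1 == 0 = false) /= => [/eqP //|]; apply/negbTE; rewrite gt_eqF // ltr_wpDl.
have : a d w = 0.
  by apply: (bil_null graph_form_bil graph_form_ge0); rewrite /a dd b_null // addr0.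
by rewrite (bilBl graph_form_bil) TP vP => /eqP; rewrite subr_eq0 => /eqP.
Qed.

(** * Power series of the invariant subspace and of its matrix *)

Variables (mk : nat -> V -> V -> R) (Bd : R) (mt : R -> V -> V -> R).
Hypothesis mkP : forall k, sym_bilinear (mk k).
Hypothesis mk0 : forall u w, mk 0%N u w = b u w.
Hypothesis Bd0 : 0 < Bd.
Hypothesis mkB : forall k u w, `|mk k u w| <= Bd ^+ k * (nrm b u * nrm b w).
Hypothesis mtP : forall t u w, series (fun k => mk k u w * t ^+ k) @ \oo --> mt t u w.

Lemma mt_bil t : sym_bilinear (mt t).
Proof.
split=> [s u v w|u v].
  have h : series (fun k => mk k (s *: u + v) w * t ^+ k) @ \oo --> s * mt t u w + mt t v w.
    have -> : series (fun k => mk k (s *: u + v) w * t ^+ k) =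
        (fun n => s * series (fun k => mk k u w * t ^+ k) n +
           series (fun k => mk k v w * t ^+ k) n).
      apply/funext => n; rewrite /series /= mulr_sumr -big_split /=; apply: eq_bigr => k _.
      by rewrite (bil_linl (mkP k)); ring.
    by apply: cvgD; [apply: cvgMr|]; exact: mtP.
  by rewrite -(cvg_lim (@Rhausdorff R) h); exact/esym/(cvg_lim (@Rhausdorff R))/mtP.
have h := @mtP t v u; rewrite -(cvg_lim (@Rhausdorff R) h).
rewrite -(cvg_lim (@Rhausdorff R) (@mtP t u v)); congr (limn _); apply/funext => n.
by apply: eq_bigr => k _; rewrite (bilC (mkP k)).
Qed.

Lemma mt_dist t u w : Bd * `|t| <= 2^-1 ->
  `|mt t u w - b u w| <= 2 * Bd * `|t| * (nrm b u * nrm b w).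
Proof.
move=> Bt; set nn := nrm b u * nrm b w.
have nn0 : 0 <= nn by rewrite mulr_ge0 ?nrm_ge0.
have h : (fun n => `|series (fun k => mk k u w * t ^+ k) n - b u w|) @ \oo --> `|mt t u w - b u w|.
  by apply: cvg_norm; apply: cvgB; [exact: mtP|exact: cvg_cst].
apply: (cvg_le_bound _ h); near=> n.
have : (0 < n)%N by near: n; exact: nbhs_infty_gt.
case: (n) => // N _; rewrite /series /= big_nat_recl // expr0 mulr1 mk0 addrAC subrr add0r.
apply: le_trans (ler_norm_sum _ _ _) _.
apply: (@le_trans _ _ ((\sum_(1 <= k < N.+1) (Bd * `|t|) ^+ k) * nn)).
  rewrite big_add1 /= mulr_suml; apply: ler_sum => k _.
  rewrite normrM normrX exprMn mulrAC ler_wpM2r ?exprn_ge0 //; exact: mkB.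
rewrite ler_wpM2r // -mulrA; apply: geometric_sum_le => //.
by rewrite mulr_ge0 // ltW.
Unshelve. all: by end_near.
Qed.

Implicit Type y : nat -> ('I_r -> V) * 'M[R]_r.

(* The part of the coefficient of order [m] of
   [\sum_i L_ij * mt t (z_i) w] that involves lower-order coefficients only. *)
Definition lower_terms y m j w := \sum_i (
  \sum_(1 <= l < m) (y l).2 i j * b ((y (m - l)%N).1 i) w +
  \sum_(1 <= k < m.+1) \sum_(0 <= l < (m - k).+1)
     (y l).2 i j * mk k ((y (m - k - l)%N).1 i) w).
Local Notation lf := lower_terms.

Lemma lower_terms_ext y y' m j : (forall i, (i < m)%N -> y i = y' i) ->
  lf y m j = lf y' m j.
Proof.
move=> yy'; apply/funext => w; apply: eq_bigr => i _; congr (_ + _).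
  by apply: eq_big_nat => l lm; rewrite !yy' //; move: lm; clear; lia.
apply: eq_big_nat => k km; apply: eq_big_nat => l lm.
by rewrite !yy' //; move: km lm; clear; lia.
Qed.

Lemma lower_terms_linear y m j : is_linear (lf y m j).
Proof.
move=> s u v; rewrite /lf mulr_sumr -big_split /=; apply: eq_bigr => i _.
rewrite mulrDr addrACA; congr (_ + _).
  rewrite mulr_sumr -big_split /=; apply: eq_bigr => l _.
  by rewrite (bil_linr bP); ring.
rewrite mulr_sumr -big_split /=; apply: eq_bigr => k _.
rewrite mulr_sumr -big_split /=; apply: eq_bigr => l _.
by rewrite (bil_linr (mkP k)); ring.
Qed.

Definition coef_size y m := \sum_i nrm a ((y m).1 i) + \sum_i \sum_j `|(y m).2 i j|.

Lemma coef_size_ge0 y m : 0 <= coef_size y m.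
Proof.
by rewrite addr_ge0 ?sumr_ge0 // => i _; rewrite ?nrm_ge0 // sumr_ge0.
Qed.

Lemma coef_size_z y m i : nrm a ((y m).1 i) <= coef_size y m.
Proof.
apply: le_trans (ler_sum_term i (fun i => nrm_ge0 a ((y m).1 i))) _.
by rewrite lerDl sumr_ge0 // => j _; rewrite sumr_ge0.
Qed.

Lemma coef_size_L y m i j : `|(y m).2 i j| <= coef_size y m.
Proof.
apply: (@le_trans _ _ (\sum_i \sum_j `|(y m).2 i j|)); last first.
  by rewrite lerDr sumr_ge0 // => k _; exact: nrm_ge0.
apply: le_trans (ler_sum_term i _); last by move=> k; rewrite sumr_ge0.
by apply: (ler_sum_term (F := fun j => `|(y m).2 i j|)).
Qed.

(** The nonlinear part of the recursive bound that [quadratic_majorant] takes as hypothesis. *)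
Definition quad_terms (Y : nat -> R) m :=
  \sum_(1 <= l < m) Y l * Y (m - l)%N +
  \sum_(1 <= k < m.+1) Bd ^+ k * \sum_(0 <= l < (m - k).+1) Y l * Y (m - k - l)%N.

Lemma quad_terms_ge0 y m : 0 <= quad_terms (coef_size y) m.
Proof.
rewrite addr_ge0 ?sumr_ge0 // => k _; first by rewrite mulr_ge0 ?coef_size_ge0.
rewrite mulr_ge0 ?exprn_ge0 ?(ltW Bd0) // sumr_ge0 // => l _.
by rewrite mulr_ge0 ?coef_size_ge0.
Qed.

Lemma lower_terms_bound y m j w :
  `|lf y m j w| <= r%:R * quad_terms (coef_size y) m * nrm b w.
Proof.
have nbY n i : nrm b ((y n).1 i) <= coef_size y n.
  exact: le_trans (nrm_b_le _) (coef_size_z _ _ _).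
rewrite -mulrA; apply: le_trans (ler_norm_sum _ _ _) _.
apply: (@le_trans _ _ (\sum_(i < r) quad_terms (coef_size y) m * nrm b w)); last first.
  by rewrite sumr_const card_ord mulr_natl.
apply: ler_sum => i _; apply: le_trans (ler_normD _ _) _; rewrite mulrDl lerD //.
  apply: le_trans (ler_norm_sum _ _ _) _; rewrite mulr_suml; apply: ler_sum => l _.
  rewrite normrM -mulrA ler_pM ?coef_size_L //.
  apply: le_trans (cauchy_schwarz bP b0 _ _) _.
  by rewrite ler_wpM2r ?nrm_ge0.
apply: le_trans (ler_norm_sum _ _ _) _; rewrite mulr_suml; apply: ler_sum => k _.
rewrite -mulrA mulr_suml mulr_sumr.
apply: le_trans (ler_norm_sum _ _ _) _; apply: ler_sum => l _.
rewrite normrM -[X in _ <= _ * X]mulrA mulrCA ler_pM ?coef_size_L //.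
apply: le_trans (mkB _ _ _) _; rewrite ler_wpM2l ?exprn_ge0 ?(ltW Bd0) //.
by rewrite ler_wpM2r ?nrm_ge0.
Qed.

Lemma expansion_exists : exists y, [/\ y 0%N = (phi, Lam%:M),
  forall m, (0 < m)%N -> forall j,
    (forall i, b ((y m).1 j) (phi i) = 0) /\
    (forall w, c ((y m).1 j) w = lf y m j w - \sum_i lf y m j (phi i) * b (phi i) w)
  & forall m, (0 < m)%N -> forall i j, (y m).2 i j = - lf y m j (phi i)].
Proof.
(* [strong_rec] takes a total step function, whence a solution operator on all functionals, with no
   requirement on those that are not linear and bounded. *)
have hS (l : V -> R) : exists x, (exists K, is_linear l /\ forall w, `|l w| <= K * nrm b w) ->
    (forall i, b x (phi i) = 0) /\
    forall w, c x w = l w - \sum_i l (phi i) * b (phi i) w.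
  have [[K [ll lK]]|nK] := pselect (exists K, is_linear l /\ forall w, `|l w| <= K * nrm b w).
    by have [x xP] := solve_shift_form ll lK; exists x.
  by exists 0.
have /choice[S SP] := hS.
pose Phi y m := if m is 0%N then (phi, Lam%:M) else
  (fun j => S (lf y m j), \matrix_(i, j) - lf y m j (phi i)).
have [y yE] : exists y, forall m, y m = Phi y m.
  apply: (strong_rec (phi, Lam%:M)) => y y' [//|m] yy' /=.
  have e j : lf y m.+1 j = lf y' m.+1 j by exact: lower_terms_ext.
  congr (_, _); first by apply/funext => j; rewrite e.
  by apply/matrixP => i j; rewrite !mxE e.
exists y; split; first by rewrite yE.
  move=> [//|m] _ j; rewrite yE /=; apply: SP.
  exists (r%:R * quad_terms (coef_size y) m.+1); split; first exact: lower_terms_linear.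
  exact: lower_terms_bound.
by move=> [//|m] _ i j; rewrite yE /= mxE.
Qed.

Lemma expansion_bound y : y 0%N = (phi, Lam%:M) ->
  (forall m, (0 < m)%N -> forall j,
    (forall i, b ((y m).1 j) (phi i) = 0) /\
    (forall w, c ((y m).1 j) w = lf y m j w - \sum_i lf y m j (phi i) * b (phi i) w)) ->
  (forall m, (0 < m)%N -> forall i j, (y m).2 i j = - lf y m j (phi i)) ->
  exists sg K : R, 0 < sg /\ forall N, \sum_(0 <= n < N) coef_size y n * sg ^+ n <= K.
Proof.
move=> y0 yz yL; have [C C0 Cc] := coercive.
have r0 : 0 <= r%:R :> R by [].
(* Each of the [r] vectors is bounded, through [coercive], by [C * (r%:R * (1 + r%:R))] times the
   quadratic terms, and each of the [r * r] matrix entries by [r%:R] times them. *)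
pose A := 1 + r%:R * (C * (r%:R * (1 + r%:R))) + r%:R * (r%:R * r%:R).
have A0 : 0 < A by rewrite /A -addrA ltr_pwDl // addr_ge0 // !mulr_ge0 // addr_ge0.
apply: (quadratic_majorant A0 Bd0 (coef_size_ge0 y)) => m m0.
rewrite -addrA -/(quad_terms (coef_size y) m); set Q := quad_terms _ m.
have Q0 : 0 <= Q by exact: quad_terms_ge0.
have lphi j i : `|lf y m j (phi i)| <= r%:R * Q.
  by apply: le_trans (lower_terms_bound _ _ _ _) _; rewrite nrm_b_phi mulr1.
apply: (@le_trans _ _ (A * Q)); last first.
  by rewrite ler_wpM2l ?(ltW A0) // lerDr exprn_ge0 // ltW.
rewrite /A -addrA mulrDl mul1r ler_wpDl // mulrDl lerD //.
  rewrite -mulrA mulr_natl -[X in _ *+ X]card_ord -sumr_const; apply: ler_sum => j _.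
  rewrite -!mulrA; have [zo zc] := yz m m0 j; apply: Cc => //.
    by rewrite !mulr_ge0 // addr_ge0.
  move=> w; rewrite zc; apply: (@le_trans _ _ (r%:R * ((1 + r%:R) * Q) * nrm b w)); last first.
    by rewrite ler_wpM2l ?nrm_b_le // !mulr_ge0 // addr_ge0.
  have -> : r%:R * ((1 + r%:R) * Q) * nrm b w =
     r%:R * Q * nrm b w + \sum_(i < r) r%:R * Q * nrm b w.
    by rewrite sumr_const card_ord -[X in _ = _ + X]mulr_natl; ring.
  apply: le_trans (ler_normB _ _) _; rewrite lerD ?lower_terms_bound //.
  apply: le_trans (ler_norm_sum _ _ _) _; apply: ler_sum => i _.
  by rewrite normrM ler_pM // (bilC bP) b_phi_le.
rewrite -mulrA mulr_natl -[X in _ *+ X]card_ord -sumr_const; apply: ler_sum => i _.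
rewrite -mulrA mulr_natl -[X in _ *+ X]card_ord -sumr_const; apply: ler_sum => j _.
by rewrite yL // normrN.
Qed.

Lemma conv_swap (F : nat -> nat -> R) m :
  \sum_(0 <= k < m.+1) \sum_(0 <= l < (m - k).+1) F k l =
  \sum_(0 <= l < m.+1) \sum_(0 <= k < (m - l).+1) F k l.
Proof.
have aux (G : nat -> nat -> R) : \sum_(0 <= k < m.+1) \sum_(0 <= l < (m - k).+1) G k l =
    \sum_(0 <= k < m.+1) \sum_(0 <= l < m.+1) if (k + l <= m)%N then G k l else 0.
  apply: eq_big_nat => k km.
  rewrite [RHS](big_cat_nat (n := (m - k).+1)) //=; last by rewrite ltnS leq_subr.
  rewrite [X in _ = _ + X]big1_seq ?addr0.
    by apply: eq_big_nat => l lm; rewrite ifT //; move: lm km; clear; lia.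
  move=> l; rewrite mem_index_iota => lm; rewrite ifF //; move: lm km; clear; lia.
rewrite (aux F) (aux (fun l k => F k l)) exchange_big /=; apply: eq_bigr => l _.
by apply: eq_bigr => k _; rewrite addnC.
Qed.

Lemma scalar_mx_sum j (f : 'I_r -> R) :
  \sum_i (Lam%:M : 'M[R]_r) i j * f i = Lam * f j.
Proof.
rewrite (bigD1 j) //= mxE eqxx mulr1n big1 ?addr0 // => i ij.
by rewrite mxE (negPf ij) mulr0n mul0r.
Qed.

(** This is the coefficient of order [m] of E(z_j, w) = sum_i L_ij m_t(z_i, w), a triple
    convolution. For [m > 0] the new unknowns occur in [Lam * b] at the new vector, which [c]
    absorbs, and in the new matrix entries times [b (phi i) w]; everything else is [lower_terms]. *)
Lemma expansion_identity y m j w : y 0%N = (phi, Lam%:M) ->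
  (forall m, (0 < m)%N -> forall j,
    (forall i, b ((y m).1 j) (phi i) = 0) /\
    (forall w, c ((y m).1 j) w = lf y m j w - \sum_i lf y m j (phi i) * b (phi i) w)) ->
  (forall m, (0 < m)%N -> forall i j, (y m).2 i j = - lf y m j (phi i)) ->
  E ((y m).1 j) w = \sum_i conv (fun l => (y l).2 i j)
    (fun p => \sum_(0 <= k < p.+1) mk k ((y (p - k)%N).1 i) w) m.
Proof.
move=> y0 yz yL; rewrite /conv.
have LamE := scalar_mx_sum j.
case: m => [|m].
  under eq_bigr => i _ do rewrite big_nat1 subnn big_nat1 subnn mk0 y0 /=.
  by rewrite y0 /= LamE phi_eig.
have [_ zc] := yz m.+1 isT j.
have -> : E ((y m.+1).1 j) w = c ((y m.+1).1 j) w + Lam * b ((y m.+1).1 j) w.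
  by rewrite /c subrK.
rewrite zc -(LamE (fun i => b ((y m.+1).1 i) w)).
have -> : - (\sum_i lf y m.+1 j (phi i) * b (phi i) w) =
    \sum_i (y m.+1).2 i j * b (phi i) w.
  by rewrite -sumrN; apply: eq_bigr => i _; rewrite yL // mulNr.
rewrite -!big_split /=; apply: eq_bigr => i _.
have -> : \sum_(0 <= k < m.+2) (y k).2 i j *
    \sum_(0 <= k0 < (m.+1 - k).+1) mk k0 ((y (m.+1 - k - k0)%N).1 i) w =
    \sum_(0 <= k < m.+2) \sum_(0 <= l < (m.+1 - k).+1)
      (y l).2 i j * mk k ((y (m.+1 - k - l)%N).1 i) w.
  rewrite conv_swap; apply: eq_big_nat => k km; rewrite mulr_sumr.
  by apply: eq_big_nat => l lm; rewrite subnAC.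
have split_ends (G : nat -> R) : \sum_(0 <= l < (m.+1 - 0).+1) G l =
    G 0%N + \sum_(1 <= l < m.+1) G l + G m.+1.
  by rewrite subn0 big_nat_recl // big_nat_recr //= big_add1 addrA.
rewrite [RHS]big_nat_recl // split_ends !subn0 subnn y0 /= !mk0.
rewrite [X in _ + X + _ + _]big_add1 /=.
have -> : \sum_(1 <= l < m.+1) (y l).2 i j * mk 0%N ((y (m.+1 - l)%N).1 i) w =
    \sum_(1 <= l < m.+1) (y l).2 i j * b ((y (m.+1 - l)%N).1 i) w.
  by apply: eq_bigr => l _; rewrite mk0.
ring.
Qed.

(* The expansions of [z] and [L] are found order by order: the component of the
   equation along [phi] gives the next coefficient of [L], and the rest is solved
   for the next coefficient of [z] under the normalization [b z_j phi_i = delta]. *)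
Theorem perturbation : exists (sg dl : R) (A : nat -> 'M[R]_r) (L : R -> 'M[R]_r)
    (z : R -> 'I_r -> V),
  [/\ 0 < sg /\ 0 < dl,
      forall i j, ps_on sg (fun m => A m i j) (fun t => L t i j),
      A 0%N = Lam%:M,
      forall i j, A 1%N i j = - Lam * mk 1%N (phi j) (phi i)
    & forall t : R, `|t| <= sg ->
      [/\ forall j w, E (z t j) w = \sum_i L t i j * mt t (z t i) w,
          forall i j, b (z t j) (phi i) = (i == j)%:R,
          forall u, b u u <= 2 * mt t u u
        & forall nu u, `|nu - Lam| < dl -> (forall w, E u w = nu * mt t u w) ->
          exists2 cc : 'cV[R]_r, (L t - nu%:M) *m cc = 0 &
            b (u - \sum_j cc j 0 *: z t j) (u - \sum_j cc j 0 *: z t j) = 0]].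
Proof.
have [y [y0 yz yL]] := expansion_exists.
have [sg0 [K [sg00 yK]]] := expansion_bound y0 yz yL.
have [C C0 Cc] := coercive.
have K0 : 0 <= K by apply: le_trans (yK 0%N); rewrite big_geq.
have sgm m : 0 <= sg0 ^+ m by rewrite exprn_ge0 // ltW.
have zK i N : \sum_(0 <= m < N) nrm a ((y m).1 i) * sg0 ^+ m <= K.
  by apply: le_trans (yK N); apply: ler_sum => m _; rewrite ler_wpM2r ?coef_size_z.
have LK i j N : \sum_(0 <= m < N) `|(y m).2 i j| * sg0 ^+ m <= K.
  by apply: le_trans (yK N); apply: ler_sum => m _; rewrite ler_wpM2r ?coef_size_L.
have hZ i := vector_series graph_form_bil graph_form_ge0 a_complete sg00 (zK i).
pose z t i := projT1 (cid (hZ i)) t.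
have zl (t : R) i l K' : `|t| <= sg0 -> is_linear l -> (forall u, `|l u| <= K' * nrm a u) ->
    series (fun m => l ((y m).1 i) * t ^+ m) @ \oo --> l (z t i).
  by move=> ts ll lK; rewrite /z; case: cid => Z /= /(_ t ts)[h _]; apply: h ll lK.
have zd (t : R) i : `|t| <= sg0 -> nrm a (z t i - phi i) <= `|t| / sg0 * K.
  by move=> ts; rewrite /z; case: cid => Z /= /(_ t ts)[_]; rewrite y0.
have hL i j := ps_on_bounded (ltW sg00) (ex_intro _ K (LK i j)).
pose L t : 'M[R]_r := \matrix_(i, j) projT1 (cid (hL i j)) t.
have LP i j : ps_on sg0 (fun m => (y m).2 i j) (fun t => L t i j).
  by under [X in ps_on _ _ X]eq_fun do rewrite mxE; case: cid.
(* [q], [s1], [s2] and [dl] are fitted to the final contraction. With [th = 2 * Bd * |t|] and [et]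
   bounding the distance from [z t i] to [phi i], they make [th * q], [C * dl] and [2 * r%:R * et]
   at most 1/8 each, whence the 3/8 in [small]. *)
pose q := C * (Lam + 1) + r%:R + 1.
have q1 : 1 <= q by rewrite /q lerDr !addr_ge0 // mulr_ge0 // addr_ge0.
pose s1 := (16 * q * Bd)^-1.
pose s2 := sg0 / (16 * (r%:R + 1) * (K + 1)).
have r10 : 0 < r%:R + 1 :> R by rewrite ltr_wpDl.
have K10 : 0 < K + 1 by rewrite ltr_wpDl.
have q0 : 0 < q by lra.
have s10 : 0 < s1 by rewrite invr_gt0 !mulr_gt0.
have s20 : 0 < s2 by rewrite divr_gt0 // !mulr_gt0.
pose sg := Num.min sg0 (Num.min s1 s2).
have sgsg0 : sg <= sg0 by rewrite ge_min lexx.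
have sgs1 : sg <= s1 by rewrite !ge_min lexx orbT.
have sgs2 : sg <= s2 by rewrite !ge_min lexx !orbT.
have sg_gt0 : 0 < sg by rewrite !lt_min sg00 s10.
pose dl := Num.min 1 (8 * (C + 1))^-1.
have C10 : 0 < C + 1 by rewrite ltr_wpDl.
have dl0 : 0 < dl by rewrite lt_min ltr01 invr_gt0 mulr_gt0.
exists sg, dl, (fun m => (y m).2), L, z; split => //.
- by move=> i j; apply: ps_on_shrink (LP i j) => //; exact: ltW.
- by rewrite y0.
- move=> i j; rewrite yL // /lf mulNr -(scalar_mx_sum j (fun k => mk 1%N (phi k) (phi i))).
  congr (- _); apply: eq_bigr => k _.
  by rewrite big_geq // add0r big_nat1 subnn big_nat1 subnn y0.
have zK' i N : \sum_(0 <= m < N) nrm b ((y m).1 i) * sg ^+ m <= K.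
  apply: le_trans (zK i N); apply: ler_sum => m _.
  rewrite ler_pM ?nrm_ge0 ?exprn_ge0 ?nrm_b_le ?(ltW sg_gt0) //.
  by rewrite lerXn2r ?nnegrE ?(ltW sg00) ?(ltW sg_gt0).
have Bsg : Bd * sg <= 2^-1.
  apply: (@le_trans _ _ (Bd * s1)); first by rewrite ler_wpM2l // ltW.
  have -> : Bd * s1 = (16 * q)^-1 by rewrite /s1; field; rewrite !gt_eqF.
  by rewrite lef_pV2 ?posrE ?mulr_gt0 //; lra.
have geo N : \sum_(0 <= k < N) (Bd * sg) ^+ k <= 2.
  have B0 : 0 <= Bd * sg by rewrite mulr_ge0 // ltW.
  case: N => [|N]; first by rewrite big_geq.
  rewrite big_nat_recl // expr0.
  by have := geometric_sum_le N B0 Bsg; rewrite big_add1 /=; lra.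
have Bk0 k : 0 <= (Bd * sg) ^+ k by rewrite exprn_ge0 // mulr_ge0 // ltW.
have Y0 i l : 0 <= nrm b ((y l).1 i) * sg ^+ l.
  by rewrite mulr_ge0 ?nrm_ge0 // exprn_ge0 // ltW.
(* Both the form and the vector depend on [t]. The forms [mk k] at the coefficients of [z] make a
   double family: its rows sum to [mt t (z t i) w], its diagonals give the power series. *)
have zps i w : ps_on sg (fun p => \sum_(0 <= k < p.+1) mk k ((y (p - k)%N).1 i) w)
    (fun t => mt t (z t i) w).
  have box N : (\sum_(0 <= k < N) (Bd * sg) ^+ k) *
      (\sum_(0 <= l < N) nrm b ((y l).1 i) * sg ^+ l) <= 2 * K.
    by rewrite ler_pM ?sumr_ge0.
  split.
    exists (2 * K * nrm b w) => N.
    apply: le_trans (ler_wpM2r (nrm_ge0 b w) (box N)).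
    apply: le_trans (ler_wpM2r (nrm_ge0 b w) (conv_le N Bk0 (Y0 i))).
    rewrite mulr_suml; apply: ler_sum => p _; rewrite mulr_suml.
    apply: le_trans (ler_wpM2r (exprn_ge0 p (ltW sg_gt0)) (ler_norm_sum _ _ _)) _.
    rewrite mulr_suml; apply: ler_sum_nat => k /andP[_ kp].
    rewrite -{2}(subnKC (_ : (k <= p)%N)) // exprD exprMn.
    have := ler_wpM2r (exprn_ge0 p (ltW sg_gt0)) (mkB k ((y (p - k)%N).1 i) w).
    rewrite -{2 4}(subnKC (_ : (k <= p)%N)) // exprD => /le_trans; apply.
    by rewrite le_eqVlt; apply/orP; left; apply/eqP; ring.
  move=> t tsg.
  have ts0 : `|t| <= sg0 by exact: le_trans sgsg0.
  pose F k l := mk k ((y l).1 i) w * t ^+ l * t ^+ k.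
  have [N|k|S0 [S1 S2 _]] := @diag_sum R F (2 * K * nrm b w) (fun k => mk k (z t i) w * t ^+ k).
  - apply: le_trans (ler_wpM2r (nrm_ge0 b w) (box N)).
    rewrite mulr_suml mulr_suml; apply: ler_sum => k _.
    rewrite mulr_sumr mulr_suml; apply: ler_sum => l _.
    rewrite /F !normrM !normrX.
    apply: (@le_trans _ _ (Bd ^+ k * (nrm b ((y l).1 i) * nrm b w) * sg ^+ l * sg ^+ k)).
      have tX n : `|t| ^+ n <= sg ^+ n by rewrite lerXn2r ?nnegrE // ltW.
      by rewrite !ler_pM ?mulr_ge0 ?exprn_ge0.
    by rewrite exprMn le_eqVlt; apply/orP; left; apply/eqP; ring.
  - have ll : is_linear ((mk k)^~ w) by exact: bil_linl.
    have lK u : `|mk k u w| <= (Bd ^+ k * nrm b w) * nrm a u.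
      apply: le_trans (mkB _ _ _) _; rewrite -mulrA [nrm b w * _]mulrC.
      by rewrite ler_wpM2l ?exprn_ge0 ?(ltW Bd0) // ler_wpM2r ?nrm_ge0 ?nrm_b_le.
    have := zl t i _ _ ts0 ll lK.
    suff -> : series (F k) = (fun n => series (fun m => mk k ((y m).1 i) w * t ^+ m) n * t ^+ k).
      by move=> h; apply: cvgMl.
    by apply/funext => n; rewrite /series /= mulr_suml.
  suff -> : series (fun p => (\sum_(0 <= k < p.+1) mk k ((y (p - k)%N).1 i) w) * t ^+ p) =
      series (fun n => \sum_(0 <= k < n.+1) F k (n - k)%N).
    suff <- : S0 = mt t (z t i) w by [].
    rewrite -(cvg_lim (@Rhausdorff R) S1).
    by apply: (cvg_lim (@Rhausdorff R)); exact: mtP.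
  apply/funext => N; apply: eq_bigr => p _; rewrite mulr_suml.
  by apply: eq_big_nat => k kp; rewrite /F -mulrA -exprD subnK.
(* Both sides are power series in [t] with the same coefficients, by [expansion_identity]. *)
have zeqP t j w : `|t| <= sg -> E (z t j) w = \sum_i L t i j * mt t (z t i) w.
  move=> tsg.
  have h1 : ps_on sg (fun m => E ((y m).1 j) w) (fun t => E (z t j) w).
    split.
      exists (K * nrm a w) => N.
      apply: le_trans (ler_wpM2r (nrm_ge0 a w) (zK j N)).
      rewrite mulr_suml; apply: ler_sum => m _; rewrite mulrAC.
      rewrite ler_pM ?exprn_ge0 ?(ltW sg_gt0) //; last first.
        by rewrite lerXn2r ?nnegrE ?(ltW sg00) ?(ltW sg_gt0).
      apply: le_trans (cauchy_schwarz EP E0 _ _) _.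
      by rewrite ler_pM ?nrm_ge0 ?nrm_E_le.
    move=> s ssg; have ll : is_linear (E^~ w) by exact: bil_linl.
    have lK u : `|E u w| <= nrm a w * nrm a u.
      rewrite mulrC; apply: le_trans (cauchy_schwarz EP E0 _ _) _.
      by rewrite ler_pM ?nrm_ge0 ?nrm_E_le.
    exact: (zl s j _ _ (le_trans ssg sgsg0) ll lK).
  have LP' i := ps_on_shrink (ltW sg_gt0) sgsg0 (LP i j).
  have h2 := ps_on_sum (index_enum 'I_r) (ltW sg_gt0)
     (fun i => ps_on_mul (ltW sg_gt0) (LP' i) (zps i w)).
  have h3 : (fun m => E ((y m).1 j) w) = (fun n => \sum_i conv (fun l => (y l).2 i j)
    (fun p => \sum_(0 <= k < p.+1) mk k ((y (p - k)%N).1 i) w) n).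
    by apply/funext => m; exact: expansion_identity.
  rewrite h3 in h1.
  exact: (ps_on_unique h1 h2 tsg).
move=> t tsg.
have ts0 : `|t| <= sg0 by exact: le_trans sgsg0.
have th1 : 2 * Bd * `|t| * q <= 8^-1.
  have : `|t| <= s1 by exact: le_trans sgs1.
  rewrite /s1 -div1r ler_pdivlMr ?mulr_gt0 //; lra.
pose th := 2 * Bd * `|t|.
have th0 : 0 <= th by rewrite !mulr_ge0 // ltW.
have thle : th <= 8^-1 by apply: le_trans th1; rewrite ler_peMr.
have et1 : `|t| / sg0 * K * (r%:R + 1) <= 16^-1.
  have t2 : `|t| <= s2 by exact: le_trans sgs2.
  rewrite /s2 in t2; rewrite ler_pdivlMr ?mulr_gt0 // in t2.
  have : `|t| / sg0 * (K + 1) * (r%:R + 1) <= 16^-1.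
    rewrite -(ler_pM2l (_ : 0 < 16 * sg0)) ?mulr_gt0 //.
    have -> : 16 * sg0 * (`|t| / sg0 * (K + 1) * (r%:R + 1)) = `|t| * (16 * (r%:R + 1) * (K + 1)).
      by field; rewrite gt_eqF.
    by apply: le_trans t2 _; rewrite le_eqVlt; apply/orP; left; apply/eqP; field.
  apply: le_trans; rewrite ler_wpM2r ?(ltW r10) // ler_wpM2l ?divr_ge0 ?(ltW sg00) //.
  by rewrite lerDl.
pose et := `|t| / sg0 * K.
have et0 : 0 <= et by rewrite mulr_ge0 // divr_ge0 // ltW.
have mb u w : `|mt t u w - b u w| <= th * (nrm b u * nrm b w).
  by apply: mt_dist; move: thle; rewrite /th; lra.
have mtb u : b u u <= 2 * mt t u u.
  have := mb u u; rewrite -expr2 sqr_nrm // ler_norml => /andP[h _].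
  have := ler_wpM2r (b0 u) thle; have := b0 u; move: h; move: (th * _) => X; lra.
(* The coefficients of positive order are orthogonal to [phi], so the normalization at order 0
   persists. *)
have zphi i j : b (z t j) (phi i) = (i == j)%:R.
  have ll : is_linear (b^~ (phi i)) by exact: bil_linl.
  have lK u : `|b u (phi i)| <= 1 * nrm a u.
    by rewrite mul1r; apply: le_trans (b_phi_le _ _) (nrm_b_le _).
  have h := zl t j _ _ ts0 ll lK.
  have h' : series (fun m => b ((y m).1 j) (phi i) * t ^+ m) @ \oo --> ((i == j)%:R : R).
    rewrite -(@cvg_shiftn 1) /= [X in X @ _ --> _](_ : _ = fun=> (i == j)%:R).
      exact: cvg_cst.
    apply/funext => N; rewrite addn1 /series /= big_nat_recl // expr0 mulr1 y0 phi_orth eq_sym.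
    rewrite big1 ?addr0 // => k _; have [-> _] := yz k.+1 isT j.
    by rewrite mul0r.
  by rewrite -(cvg_lim (@Rhausdorff R) h); exact: (cvg_lim (@Rhausdorff R) h').
have zeq j w : E (z t j) w = \sum_i L t i j * mt t (z t i) w.
  exact: zeqP.
split => // nu u nul uE.
pose m := mt t; have mP : sym_bilinear m by exact: mt_bil.
have m0 x : 0 <= m x x by have := mtb x; have := b0 x; rewrite /m; lra.
pose comb (cc : 'cV[R]_r) := \sum_j cc j 0 *: z t j.
pose G : 'M[R]_r := \matrix_(i, k) m (z t i) (z t k).
have bcomb cc i : b (comb cc) (phi i) = cc i 0.
  rewrite /comb (is_linear_sum _ _ _ (bil_linl bP _)) (bigD1 i) //= (bilZl bP) zphi eqxx mulr1.
  by rewrite big1 ?addr0 // => k ki; rewrite (bilZl bP) zphi eq_sym (negPf ki) mulr0.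
have mcomb cc w : m (comb cc) w = \sum_k cc k 0 * m (z t k) w.
  rewrite /comb (is_linear_sum _ _ _ (bil_linl mP _)); apply: eq_bigr => k _.
  by rewrite (bilZl mP).
have mcombG cc i : m (comb cc) (z t i) = (G *m cc) i 0.
  rewrite mcomb mxE; apply: eq_bigr => k _; rewrite mxE mulrC.
  by rewrite (bilC mP).
have Ginj (cc : 'cV[R]_r) : G *m cc = 0 -> cc = 0.
  move=> Gc; have : m (comb cc) (comb cc) = 0.
    rewrite {2}/comb (is_linear_sum _ _ _ (bil_linr mP _)) big1 // => i _.
    by rewrite (bilZr mP) mcombG Gc mxE mulr0.
  move=> mm; have bb : b (comb cc) (comb cc) = 0.
    by apply/eqP; rewrite eq_le b0 andbT; apply: le_trans (mtb _) _; rewrite -/m mm mulr0.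
  by apply/matrixP => i j; rewrite (ord1 j) mxE -bcomb (bil_null bP b0).
have Gu : G \in unitmx.
  rewrite -unitmx_tr -row_free_unit -kermx_eq0; apply/eqP/row_matrixP => i.
  rewrite row0; apply: trmx_inj; rewrite trmx0; apply: Ginj.
  by apply: trmx_inj; rewrite trmx_mul trmxK trmx0 -row_mul mulmx_ker row0.
pose rhs : 'cV[R]_r := \col_i m u (z t i).
(* These are the coordinates of the [mt t]-orthogonal projection [v] of [u] on the span of [z t]. *)
pose cc := invmx G *m rhs.
have Gcc : G *m cc = rhs by rewrite mulKVmx.
pose v := comb cc.
have mv i : m v (z t i) = m u (z t i) by rewrite mcombG Gcc mxE.
have Ecomb c' w : E (comb c') w = m (comb (L t *m c')) w.
  rewrite mcomb /comb (is_linear_sum _ _ _ (bil_linl EP _)).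
  under eq_bigr => j _ do rewrite (bilZl EP) zeq mulr_sumr.
  rewrite exchange_big /=; apply: eq_bigr => k _; rewrite mxE mulr_suml.
  by apply: eq_bigr => j _; rewrite mulrA [c' j 0 * _]mulrC.
(* The span of [z t] is invariant, so by symmetry of the two forms the projection of a solution
   solves the equation against each [z t i]. *)
have Ev i : E v (z t i) = nu * m v (z t i).
  rewrite (bilC EP) zeq mv -uE (bilC EP) zeq; apply: eq_bigr => k _.
  by rewrite (bilC (mt_bil t) _ v) (bilC (mt_bil t) _ u); congr (_ * _); exact: mv.
have Lcc : (L t - nu%:M) *m cc = 0.
  apply: Ginj; apply/matrixP => i j; rewrite (ord1 j) [RHS]mxE mulmxBl mulmxBr.
  rewrite mxE [X in _ + X]mxE -mcombG -Ecomb mul_scalar_mx -scalemxAr [X in _ - X]mxE -mcombG.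
  by rewrite Ev subrr.
exists cc => //.
have vE w : E v w = nu * m v w.
  rewrite Ecomb; move/eqP: Lcc; rewrite mulmxBl subr_eq0 => /eqP ->.
  rewrite mul_scalar_mx !mcomb mulr_sumr; apply: eq_bigr => k _.
  by rewrite mxE mulrA.
pose d := u - v.
have dE w : E d w = nu * m d w.
  by rewrite (bilBl EP) uE vE (bilBl mP) mulrBr.
have dz i : m d (z t i) = 0 by rewrite (bilBl mP) mv subrr.
rewrite -/(comb cc) -/v -/d.
(* [d] is [mt t]-orthogonal to [z t i]; replacing this form by [b] and this vector by [phi i] costs
   only [th] and [et]. *)
have dphi i : `|b d (phi i)| <= (th + 2 * et) * nrm b d.
  have -> : b d (phi i) = - (m d (phi i) - b d (phi i)) - m d (z t i - phi i).
    by rewrite (bilBr mP) dz; ring.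
  apply: le_trans (ler_normB _ _) _; rewrite normrN mulrDl lerD //.
    by apply: le_trans (mb _ _) _; rewrite nrm_b_phi mulr1.
  have h1 : nrm b (z t i - phi i) <= et.
    by apply: le_trans (nrm_b_le _) _; exact: zd.
  have h2 : `|m d (z t i - phi i)| <= (1 + th) * (nrm b d * nrm b (z t i - phi i)).
    rewrite -[m d _](subrK (b d (z t i - phi i))).
    apply: le_trans (ler_normD _ _) _; rewrite addrC mulrDl mul1r lerD //.
    exact: cauchy_schwarz.
  apply: le_trans h2 _.
  have th2 : 1 + th <= 2 by move: thle; lra.
  rewrite -mulrA ler_pM ?mulr_ge0 ?nrm_ge0 ?addr_ge0 // mulrC ler_wpM2r ?nrm_ge0 //.
pose d0 := d - phi_part d.
have Lth0 : 0 <= (Lam + 1) * th + dl.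
  exact: addr_ge0 (mulr_ge0 (addr_ge0 Lam0 ler01) th0) (ltW dl0).
(* The functional [c d0] consists of [nu] times the small difference of [mt t] and [b], and of
   [(nu - Lam) * b]; [coercive] turns its smallness into that of [d0]. *)
have d0a : nrm a d0 <= C * (((Lam + 1) * th + dl) * nrm b d).
  apply: Cc.
  - exact: mulr_ge0 Lth0 (nrm_ge0 _ _).
  - by move=> i; rewrite (bilBl bP) b_phi_part subrr.
  move=> w; rewrite (bilBl shift_form_bil) shift_form_phi_part subr0 /c dE.
  have -> : nu * m d w - Lam * b d w = nu * (m d w - b d w) + (nu - Lam) * b d w by ring.
  apply: (@le_trans _ _ (((Lam + 1) * th + dl) * (nrm b d * nrm b w))); last first.
    by rewrite -mulrA ler_wpM2l // ler_wpM2l ?nrm_ge0 ?nrm_b_le.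
  apply: le_trans (ler_normD _ _) _; rewrite [leRHS]mulrDl !normrM lerD //.
    rewrite -mulrA ler_pM //.
    have -> : nu = Lam + (nu - Lam) by ring.
    apply: le_trans (ler_normD _ _) _; rewrite (ger0_norm Lam0) lerD2l.
    by apply: le_trans (ltW nul) _; rewrite ge_min lexx.
  by rewrite ler_pM // ?(ltW nul) //; exact: cauchy_schwarz.
have dle : nrm b d <= (C * ((Lam + 1) * th + dl) + r%:R * (th + 2 * et)) * nrm b d.
  rewrite -{1}[d](subrK (phi_part d)); apply: le_trans (nrmD bP b0 _ _) _.
  rewrite mulrDl lerD //.
    by rewrite -mulrA; apply: le_trans (nrm_b_le _) d0a.
  apply: le_trans (nrm_sum bP b0 _ _ _) _; rewrite -mulrA mulr_natl.
  rewrite -[X in _ *+ X]card_ord -sumr_const; apply: ler_sum => i _.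
  by rewrite (nrmZ bP) nrm_b_phi mulr1.
have small : C * ((Lam + 1) * th + dl) + r%:R * (th + 2 * et) <= 3 / 8.
  have c1 : C * dl <= 8^-1.
    have : dl <= (8 * (C + 1))^-1 by rewrite ge_min lexx orbT.
    rewrite -div1r ler_pdivlMr ?mulr_gt0 // => h.
    have := ltW dl0; lra.
  have c2 : r%:R * et <= 16^-1.
    apply: le_trans et1; rewrite -/et mulrC ler_wpM2l // lerDl //.
  have := th1; rewrite -/th /q; lra.
have : nrm b d <= 3 / 8 * nrm b d.
  by apply: le_trans dle _; rewrite ler_wpM2r ?nrm_ge0.
have := nrm_ge0 b d; move=> h1 h2.
have h3 : nrm b d = 0 by lra.
by apply/eqP; rewrite -(nrm_eq0 b0) h3.
Qed.

(** The Gram matrix of [z t] is positive definite: [mt t] dominates half of [b], and pairing with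
    [phi] recovers the coordinates of a combination. The last clauses at each [t] match the kernel
    of [L t - nu%:M] with the solutions for [nu], up to null vectors. *)
Theorem rellich : exists (eps dl : R) (lam : 'I_r -> R -> R) (A1 : 'M[R]_r)
    (L : R -> 'M[R]_r) (z : R -> 'I_r -> V),
  [/\ 0 < eps /\ 0 < dl,
      forall j, real_analytic_on [set t | `|t| < eps] (lam j),
      forall j, lam j 0 = Lam,
      forall t : R, `|t| < eps ->
      [/\ forall j, `|lam j t - Lam| < dl,
          forall nu, \rank (L t - nu%:M) = (r - #|[pred j | lam j t == nu]|)%N,
          forall i j, b (z t j) (phi i) = (i == j)%:R,
          forall nu (cc : 'cV[R]_r), (L t - nu%:M) *m cc = 0 -> forall w,
            E (\sum_j cc j 0 *: z t j) w = nu * mt t (\sum_j cc j 0 *: z t j) w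
        & forall nu u, `|nu - Lam| < dl -> (forall w, E u w = nu * mt t u w) ->
          exists2 cc : 'cV[R]_r, (L t - nu%:M) *m cc = 0 &
            b (u - \sum_j cc j 0 *: z t j) (u - \sum_j cc j 0 *: z t j) = 0]
    & (forall i j, A1 i j = - Lam * mk 1%N (phi j) (phi i)) /\
      forall nu, \rank (A1 - nu%:M) = (r - #|[pred j | derive1 (lam j) 0 == nu]|)%N].
Proof.
have [sg [dl [A [L [z [[sg0 dl0] LP A0 A1 zP]]]]]] := perturbation.
have mP t : sym_bilinear (mt t) := mt_bil t.
pose g t : 'M[R]_r := \matrix_(i, j) mt t (z t i) (z t j).
have gs t : (g t)^T = g t by apply/matrixP => i j; rewrite !mxE (bilC (mP t)).
have gLE t i j : `|t| <= sg -> (g t *m L t) i j = E (z t j) (z t i).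
  move=> ts; have [-> _ _ _] := zP t ts.
  by rewrite mxE; apply: eq_bigr => k _; rewrite mxE mulrC (bilC (mP t)).
have [|t ts|eps [lam [[eps0 epssg] lam_an lam0 lamP lam1]]] := branches sg0 dl0 LP A0 (g := g).
- by apply/matrixP => i j; rewrite mxE !A1 (bilC (mkP 1%N)).
- split=> //.
    by apply/matrixP => i j; rewrite mxE !gLE // (bilC EP).
  move=> v v0; have [_ zb mb _] := zP t ts.
  pose x := \sum_j v 0 j *: z t j.
  have -> : (v *m g t *m v^T) 0 0 = mt t x x.
    rewrite mxE (is_linear_sum _ _ _ (bil_linl (mP t) x)); apply: eq_bigr => j _.
    rewrite (bilZl (mP t)) (is_linear_sum _ _ _ (bil_linr (mP t) _)) !mxE mulrC.
    congr (_ * _); apply: eq_bigr => k _.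
    by rewrite (bilZr (mP t)) mxE (bilC (mP t)).
  have : 0 < b x x.
    rewrite lt0r b0 andbT; apply: contra v0 => /eqP bx; apply/eqP/rowP => i.
    have := bil_null bP b0 (phi i) bx.
    rewrite (is_linear_sum _ _ _ (bil_linl bP _)) (bigD1 i) //= big1 ?addr0.
      by rewrite (bilZl bP) zb eqxx mulr1 mxE.
    by move=> j ji; rewrite (bilZl bP) zb eq_sym (negPf ji) mulr0.
  by have := mb x; lra.
exists eps, dl, lam, (A 1%N), L, z; split => // t te.
have ts : `|t| <= sg by apply/ltW/(lt_le_trans te).
have [Ez zb _ zspan] := zP t ts; have [lamd lamr] := lamP t te.
split => // nu cc Lc w.
have {}Lc : L t *m cc = nu *: cc.
  by apply/eqP; rewrite -subr_eq0 -mul_scalar_mx -mulmxBl Lc.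
rewrite !(is_linear_sum _ _ _ (bil_linl EP w)) (is_linear_sum _ _ _ (bil_linl (mP t) w)) mulr_sumr.
transitivity (\sum_i (L t *m cc) i 0 * mt t (z t i) w).
  under eq_bigr do rewrite (bilZl EP) Ez mulr_sumr.
  rewrite exchange_big /=; apply: eq_bigr => i _.
  by rewrite mxE mulr_suml; apply: eq_bigr => j _; ring.
by apply: eq_bigr => i _; rewrite Lc mxE (bilZl (mP t)) mulrA.
Qed.

End Eigenspace.

(** * Square-integrable functions and tilted measures *)

Section SquareIntegrable.
Context d (T : measurableType d) (R : realType).
Variable mu : {measure set T -> \bar R}.
Implicit Types (u v w h : T -> R).

Lemma L2P u : L2 mu u <-> measurable_fun setT u /\
  mu.-integrable setT (EFin \o (fun x => u x ^+ 2)).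
Proof.
split=> [Lu|[mu_ iu]].
  split; last exact: Lfun2_integrable_sqr.
  by move: Lu; rewrite /L2 /= inE => /andP[]; rewrite inE.
rewrite /L2 /= inE; apply/andP; split; rewrite inE //=.
rewrite /finite_norm unlock /Lnorm poweR_lty //=.
have /integrableP[_] := iu; apply: le_lt_trans; rewrite le_eqVlt; apply/orP; left; apply/eqP.
by apply: eq_integral => x _ /=; rewrite powR_mulrn // normrX.
Qed.

Lemma L2_measurable u : L2 mu u -> measurable_fun setT u.
Proof. by case/L2P. Qed.

Lemma L2_integrableM u v : L2 mu u -> L2 mu v ->
  mu.-integrable setT (EFin \o (fun x => u x * v x)).
Proof. by move=> Lu Lv; apply/Lfun1_integrable; exact: Lfun2_mul_Lfun1. Qed.

Lemma L2_lin a u v : L2 mu u -> L2 mu v -> L2 mu (fun x => a * u x + v x).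
Proof.
move=> Lu Lv; apply/L2P; split.
  apply: measurable_funD; last exact: L2_measurable.
  by apply: measurable_funM => //; exact: L2_measurable.
have -> : EFin \o (fun x => (a * u x + v x) ^+ 2) =
    (fun x => ((a ^+ 2)%:E * (u x * u x)%:E + ((a *+ 2)%:E * (u x * v x)%:E + (v x * v x)%:E))%E).
  by apply/funext => x /=; rewrite -!EFinM -!EFinD; congr EFin; ring.
apply: integrableD => //; first exact/integrableZl/L2_integrableM.
apply: integrableD => //; last exact: L2_integrableM.
exact/integrableZl/L2_integrableM.
Qed.

Lemma L2_0 : L2 mu (cst 0).
Proof.
apply/L2P; split => //.
have -> : EFin \o (fun x : T => (cst 0 x : R) ^+ 2) = cst 0%E.
  by apply/funext => x /=; rewrite expr0n.
exact: integrable0.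
Qed.

Lemma L2_bounded_mul M h u : measurable_fun setT h -> (forall x, `|h x| <= M) ->
  L2 mu u -> L2 mu (fun x => h x * u x).
Proof.
move=> mh hM Lu; have M0 : 0 <= M := le_trans (normr_ge0 _) (hM point).
have mhu : measurable_fun setT (fun x => h x * u x).
  by apply: measurable_funM => //; exact: L2_measurable.
apply/L2P; split => //.
have [_ iu] := (L2P u).1 Lu.
have := @integrableZl _ _ _ mu _ measurableT (M ^+ 2) _ iu.
apply: le_integrable => //.
  by apply/measurable_EFinP; exact: measurable_funX.
move=> x _; rewrite -EFinM lee_fin exprMn !normrM ler_wpM2r //.
by rewrite -!expr2 lerXn2r // ?nnegrE ?normr_ge0 // (ger0_norm M0).
Qed.

Lemma L2_integrableZM a u v : L2 mu u -> L2 mu v ->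
  mu.-integrable setT (EFin \o (fun x => a * (u x * v x))).
Proof. by move=> Lu Lv; apply: (@integrableZl _ _ _ mu _ measurableT a _ (L2_integrableM Lu Lv)). Qed.

Lemma L2dotC u v : L2dot mu u v = L2dot mu v u.
Proof. by rewrite /L2dot; apply: eq_Rintegral => x _; rewrite mulrC. Qed.

Lemma L2dot_lin a u v w : L2 mu u -> L2 mu v -> L2 mu w ->
  L2dot mu (fun x => a * u x + v x) w = a * L2dot mu u w + L2dot mu v w.
Proof.
move=> Lu Lv Lw; rewrite /L2dot -RintegralZl //; last exact: L2_integrableM.
rewrite -RintegralD //; first by apply: eq_Rintegral => x _; ring.
  exact: L2_integrableZM.
exact: L2_integrableM.
Qed.

Lemma L2dot0l w : L2dot mu (cst 0) w = 0.
Proof.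
transitivity (\int[mu]_(x in setT) (cst 0 x : R)); last by rewrite Rintegral_cst // mul0r.
by apply: eq_Rintegral => x _; rewrite mul0r.
Qed.

Lemma L2Z a u : L2 mu u -> L2 mu (fun x => a * u x).
Proof.
by move=> Lu; have := L2_lin a Lu L2_0; under eq_fun do rewrite addr0.
Qed.

Lemma L2dotZ a u v : L2 mu u -> L2 mu v -> L2dot mu (fun x => a * u x) v = a * L2dot mu u v.
Proof.
move=> Lu Lv; have := L2dot_lin a Lu L2_0 Lv; rewrite L2dot0l addr0.
by under eq_fun do rewrite addr0.
Qed.

Lemma L2dot_ge0 u : 0 <= L2dot mu u u.
Proof. by apply: Rintegral_ge0 => x _; rewrite -expr2 sqr_ge0. Qed.

Lemma L2dot_ae u u' v v' : L2 mu u -> L2 mu u' -> L2 mu v -> L2 mu v' ->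
  u = u' %[ae mu] -> v = v' %[ae mu] -> L2dot mu u v = L2dot mu u' v'.
Proof.
move=> Lu Lu' Lv Lv' uu vv; rewrite /L2dot /Rintegral; congr fine.
apply: ae_eq_integral => //; try apply/measurable_EFinP.
- by apply: measurable_funM; exact: L2_measurable.
- by apply: measurable_funM; exact: L2_measurable.
by apply: filterS2 uu vv => x /(_ I) -> /(_ I) ->.
Qed.

Lemma L2dot_eq0 u : L2 mu u -> L2dot mu u u = 0 <-> u = cst 0 %[ae mu].
Proof.
move=> Lu; split=> [uu|uu]; last first.
  rewrite (L2dot_ae _ _ _ _ uu uu) //; try exact: L2_0.
  exact: L2dot0l.
have [_ iu] := (L2P u).1 Lu.
have h : (\int[mu]_x `|(u x ^+ 2)%:E| = 0)%E.
  have fi := integrable_fin_num measurableT iu.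
  have := uu; rewrite /L2dot /Rintegral.
  under eq_integral do rewrite -expr2.
  move=> h; rewrite -[LHS](_ : \int[mu]_x (u x ^+ 2)%:E = _)%E; last first.
    by apply: eq_integral => x _; rewrite gee0_abs // lee_fin sqr_ge0.
  by rewrite -(fineK fi) h.
have mf : measurable_fun setT (EFin \o (fun x => u x ^+ 2)) by exact: measurable_int iu.
have := (ae_eq_integral_abs mu measurableT mf).1 h.
by apply: filterS => x /(_ I) /= [] /eqP; rewrite sqrf_eq0 => /eqP.
Qed.

Lemma L2dot_bounded_mul M h u : measurable_fun setT h -> (forall x, `|h x| <= M) ->
  L2 mu u -> L2dot mu (fun x => h x * u x) (fun x => h x * u x) <= M ^+ 2 * L2dot mu u u.
Proof.
move=> mh hM Lu; have M0 : 0 <= M := le_trans (normr_ge0 _) (hM point).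
have Lhu := L2_bounded_mul mh hM Lu.
rewrite /L2dot -RintegralZl //; last exact: L2_integrableM.
apply: le_Rintegral => //.
- exact: L2_integrableM.
- exact: L2_integrableZM.
move=> x _; rewrite -!expr2 exprMn ler_wpM2r ?sqr_ge0 //.
by rewrite -[h x ^+ 2]real_normK ?num_real // lerXn2r // ?nnegrE.
Qed.

End SquareIntegrable.

(** * Measures with a bounded exponential density *)

Section Tilt.
Context d (T : measurableType d) (R : realType).
Variables (mu : {measure set T -> \bar R}) (g : {mfun T >-> R}).
Local Notation e x := (expR (g x))%:E.

Import HBNNSimple.

Lemma measurable_exp_tilt : measurable_fun setT (fun x => expR (g x)).
Proof. exact: measurableT_comp. Qed.

(** On indicators this is the definition of [tilt]; simple functions and monotone convergence on
    both sides do the rest. *)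
Lemma ge0_integral_tilt (f : T -> \bar R) : (forall x, 0 <= f x)%E -> measurable_fun setT f ->
  (\int[tilt mu g]_x f x = \int[mu]_x (f x * e x))%E.
Proof.
move=> f0 mf; pose h := nnsfun_approx measurableT mf.
have me : measurable_fun setT (fun x => e x).
  by apply/measurable_EFinP; exact: measurable_exp_tilt.
have e0 x : (0 <= e x)%E by rewrite lee_fin expR_ge0.
have hf x : (EFin \o h n) x @[n --> \oo] --> f x by exact: cvg_nnsfun_approx.
have -> : (\int[tilt mu g]_x f x =
    lim (\int[tilt mu g]_x (EFin \o h n) x @[n --> \oo]))%E.
  under eq_integral => x _ do rewrite -(cvg_lim (@ereal_hausdorff R) (hf x)).
  apply: monotone_convergence => //.
  - by move=> n; apply/measurable_EFinP.
  - by move=> n x _ //=; rewrite lee_fin.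
  - by move=> x _ a b ab; rewrite lee_fin; exact/lefP/nd_nnsfun_approx.
have hfe x : ((EFin \o h n) x * e x)%E @[n --> \oo] --> (f x * e x)%E.
  by apply: cvgeZr => //; exact: hf.
have -> : (\int[mu]_x (f x * e x) =
    lim (\int[mu]_x ((EFin \o h n) x * e x) @[n --> \oo]))%E.
  under eq_integral => x _ do rewrite -(cvg_lim (@ereal_hausdorff R) (hfe x)).
  apply: monotone_convergence => //.
  - by move=> n; apply: emeasurable_funM => //; exact/measurable_EFinP.
  - by move=> n x _ /=; rewrite mule_ge0 ?lee_fin.
  - by move=> x _ a b ab/=; rewrite lee_wpmul2r ?lee_fin //; exact/lefP/nd_nnsfun_approx.
congr (limn _); apply/funext => n.
transitivity (\int[tilt mu g]_x
   (\sum_(y \in range (h n)) (y * \1_(h n @^-1` [set y]) x)%:E))%E.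
  by apply: eq_integral => t tE; rewrite /= fimfunE -fsumEFin.
have indich r : measurable_fun setT (fun x => (r * \1_(h n @^-1` [set r]) x)%:E).
  by apply: (measurable_comp measurableT) => //; exact: measurable_funM.
rewrite ge0_integral_fsum//; last by move=> m y Ey; exact: nnfun_muleindic_ge0.
transitivity (\int[mu]_x (\sum_(y \in range (h n))
    (y * \1_(h n @^-1` [set y]) x)%:E * e x))%E; last first.
  under [RHS]eq_integral => x xE.
    rewrite /= (fimfunE (h n) x) -fsumEFin // ge0_mule_fsuml => [|y];
      last exact: nnfun_muleindic_ge0.
    over.
  by [].
rewrite ge0_integral_fsum//; last 2 first.
  - by move=> y; apply: emeasurable_funM.
  - by move=> m y Ey; rewrite mule_ge0 ?nnfun_muleindic_ge0.
apply: eq_fsbigr => r rhn.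
under eq_integral do rewrite EFinM.
rewrite integralZl_indic_nnsfun => //.
under [RHS]eq_integral do rewrite EFinM -muleA.
rewrite ge0_integralZl//.
- rewrite integral_indic // setIT /= /tilt; congr (_ * _)%E.
  rewrite integral_mkcond; apply: eq_integral => x _.
  by rewrite epatch_indic muleC.
- by apply: emeasurable_funM => //; exact/measurable_EFinP.
- by move: rhn; rewrite inE => -[t _ <-]; rewrite lee_fin.
Qed.

Variable M : R.
Hypothesis gM : forall x, `|g x| <= M.

Lemma exp_tilt_le x : expR (g x) <= expR M.
Proof. by rewrite ler_expR; apply: le_trans (gM x); exact: ler_norm. Qed.

Lemma exp_tilt_ge x : expR (- M) <= expR (g x).
Proof. by rewrite ler_expR lerNl; apply: le_trans (gM x); rewrite -normrN ler_norm. Qed.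

(** The density lies between [expR (- M)] and [expR M]. This is why null sets, and later
    square-integrability, are the same for both measures. *)
Lemma tilt_null (A : set T) : measurable A -> tilt mu g A = 0%E <-> mu A = 0%E.
Proof.
move=> mA; have me : measurable_fun A (fun x => (expR (g x))%:E).
  by apply/measurable_EFinP/measurable_funTS; exact: measurable_exp_tilt.
have h1 : (((expR (- M))%:E * mu A) <= tilt mu g A)%E.
  rewrite -integral_cst // /tilt; apply: ge0_le_integral => //.
  - by move=> x _; rewrite lee_fin expR_ge0.
  - by move=> x _; rewrite lee_fin exp_tilt_ge.
have h2 : (tilt mu g A <= (expR M)%:E * mu A)%E.
  rewrite -integral_cst // /tilt; apply: ge0_le_integral => //.
  by move=> x _; rewrite lee_fin exp_tilt_le.
split=> h0.
  apply/eqP; rewrite eq_le measure_ge0 andbT.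
  by move: h1; rewrite h0 pmule_rle0 // lte_fin expR_gt0.
by apply/eqP; rewrite eq_le (measure_ge0 (tilt mu g)) andbT; move: h2; rewrite h0 mule0.
Qed.

Lemma tilt_ae (P : set T) : (\forall x \ae tilt mu g, P x) <-> (\forall x \ae mu, P x).
Proof. by split=> -[A [mA A0 AP]]; exists A; split => //; exact/tilt_null. Qed.

Lemma tilt_ae_eq (u v : T -> R) : u = v %[ae tilt mu g] <-> u = v %[ae mu].
Proof. exact: tilt_ae. Qed.

Lemma integrable_tiltE (f : T -> \bar R) : measurable_fun setT f ->
  (tilt mu g).-integrable setT f <-> mu.-integrable setT (fun x => f x * e x)%E.
Proof.
move=> mf; have me : measurable_fun setT (fun x => e x).
  by apply/measurable_EFinP; exact: measurable_exp_tilt.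
have fe : (\int[tilt mu g]_x `|f x| = \int[mu]_x `|f x * e x|)%E.
  rewrite ge0_integral_tilt //; last exact: measurableT_comp.
  by apply: eq_integral => x _; rewrite abseM [`|e x|%E]gee0_abs ?lee_fin ?expR_ge0.
split=> /integrableP[_ fi]; apply/integrableP; split => //.
- exact: emeasurable_funM.
- by rewrite -fe.
- by rewrite fe.
Qed.

Lemma integrable_tilt (f : T -> \bar R) : (tilt mu g).-integrable setT f <-> mu.-integrable setT f.
Proof.
have me : measurable_fun setT (fun x => e x).
  by apply/measurable_EFinP; exact: measurable_exp_tilt.
split=> fi; have mf := measurable_int _ fi.
  have /(integrable_tiltE mf) fei := fi.
  have := @integrableZl _ _ _ mu _ measurableT (expR M) _ fei.
  apply: le_integrable => // x _.
  rewrite !abseM muleCA -[leLHS]mule1 lee_pmul //.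
  rewrite -abseM -EFinM lee_fin -expRD ger0_norm ?expR_ge0 // -expR0 ler_expR.
  by have := gM x; rewrite ler_norml => /andP[]; lra.
apply/(integrable_tiltE mf).
have := @integrableZl _ _ _ mu _ measurableT (expR M) _ fi.
apply: le_integrable => //; first exact: emeasurable_funM.
move=> x _; rewrite !abseM muleC lee_pmul // lee_fin !ger0_norm ?expR_ge0 //.
exact: exp_tilt_le.
Qed.

Lemma L2_tilt (u : T -> R) : L2 (tilt mu g) u <-> L2 mu u.
Proof. by split=> /L2P[mu_ iu]; apply/L2P; split => //; exact/integrable_tilt. Qed.

Lemma Rintegral_tilt (f : T -> R) : measurable_fun setT f ->
  \int[tilt mu g]_x f x = \int[mu]_x (f x * expR (g x)).
Proof.
move=> mf; rewrite /Rintegral; congr fine.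
have mEf : measurable_fun setT (EFin \o f) by exact/measurable_EFinP.
rewrite integralE [RHS]integralE; congr (_ - _)%E.
  rewrite ge0_integral_tilt //; last exact: measurable_funepos.
  apply: eq_integral => x _; rewrite !funeposE /= -EFin_max -EFinM -EFin_max.
  by rewrite maxr_pMl ?expR_ge0 // mul0r.
rewrite ge0_integral_tilt //; last exact: measurable_funeneg.
by apply: eq_integral => x _; rewrite !funenegE /= -!EFin_max -EFinM maxr_pMl ?expR_ge0 // mul0r mulNr.
Qed.

Lemma L2dot_tilt (u v : T -> R) : L2 mu u -> L2 mu v ->
  L2dot (tilt mu g) u v = L2dot mu (fun x => expR (g x) * u x) v.
Proof.
move=> Lu Lv; rewrite /L2dot Rintegral_tilt.
  by apply: eq_Rintegral => x _; ring.
by apply: measurable_funM; [exact: L2_measurable Lu|exact: L2_measurable Lv].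
Qed.

End Tilt.

Section ExponentialSeries.
Context d (T : measurableType d) (R : realType).
Variables (mu : {measure set T -> \bar R}) (h : T -> R) (M : R).
Hypotheses (mh : measurable_fun setT h) (hM : forall x, `|h x| <= M).

Lemma partial_exp_le (n : nat) (y : R) : `|series (exp_coeff y) n| <= expR `|y|.
Proof.
apply: (@le_trans _ _ (series (exp_coeff `|y|) n)).
  rewrite !seriesEnat; apply: le_trans (ler_norm_sum _ _ _) _.
  by apply: ler_sum => k _; rewrite normrM normrX normfV (ger0_norm (ler0n _ _)).
apply: (nondecreasing_cvgn_le _ (is_cvg_series_exp_coeff _)) => //.
by apply/nondecreasing_seqP => k; rewrite !seriesEnat /= big_nat_recr //= lerDl exp_coeff_ge0.
Qed.

(** Dominated convergence: the partial sums of the exponential series are bounded by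
    [expR (|t| * M)] uniformly on the space, for every [t]. *)
Lemma L2dot_exp_series (t : R) (u w : T -> R) : L2 mu u -> L2 mu w ->
  series (fun k => L2dot mu (fun x => h x ^+ k / k`!%:R * u x) w * t ^+ k) @ \oo -->
  L2dot mu (fun x => expR (t * h x) * u x) w.
Proof.
move=> Lu Lw; pose p n x := series (exp_coeff (t * h x)) n.
have tM x : `|t * h x| <= `|t| * M by rewrite normrM ler_wpM2l.
have mth : measurable_fun setT (fun x => t * h x) by exact: measurable_funM.
have mp n : measurable_fun setT (p n).
  rewrite /p; elim: n => [|n IH].
    by rewrite (_ : (fun x => _) = cst 0) //; apply/funext => x; rewrite seriesEnat /= big_geq.
  under eq_fun do rewrite seriesSr.
  apply: measurable_funD => //; apply: measurable_funM => //.
  exact: measurable_funX.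
have pM n x : `|p n x| <= expR (`|t| * M).
  by apply: le_trans (partial_exp_le _ _) _; rewrite ler_expR.
have Lpu n : L2 mu (fun x => p n x * u x) := L2_bounded_mul (mp n) (pM n) Lu.
have kM k x : `|h x ^+ k / k`!%:R| <= M ^+ k / k`!%:R.
  rewrite normrM normrX normfV (ger0_norm (ler0n _ _)) ler_wpM2r ?invr_ge0 //.
  by rewrite lerXn2r // nnegrE ?(le_trans _ (hM x)).
have mk k : measurable_fun setT (fun x => h x ^+ k / k`!%:R).
  by apply: measurable_funM => //; exact: measurable_funX.
have -> : series (fun k => L2dot mu (fun x => h x ^+ k / k`!%:R * u x) w * t ^+ k) =
    (fun n => L2dot mu (fun x => p n x * u x) w).
  apply/funext; elim=> [|n IH].
    rewrite seriesEnat /= big_geq // -(L2dot0l mu w); congr (L2dot mu _ w).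
    by apply/funext => x; rewrite /p seriesEnat /= big_geq // mul0r.
  rewrite seriesSr IH addrC mulrC -L2dot_lin //; last exact: L2_bounded_mul (mk n) (kM n) Lu.
  congr (L2dot mu _ w); apply/funext => x.
  have -> : p n.+1 x = p n x + (t * h x) ^+ n / n`!%:R by exact: seriesSr.
  by rewrite exprMn; ring.
have ppt x : p n x * u x * w x @[n --> \oo] --> expR (t * h x) * u x * w x.
  apply: cvgMl; apply: cvgMl; exact: is_cvg_series_exp_coeff.
have Luw := L2_integrableM Lu Lw.
pose G x := (expR (`|t| * M) * `|u x * w x|)%:E.
have [] := @dominated_convergence _ T R mu setT measurableT
  (fun n x => (p n x * u x * w x)%:E) (fun x => (expR (t * h x) * u x * w x)%:E) G.
- move=> n; apply/measurable_EFinP; apply: measurable_funM; [exact: L2_measurable (Lpu n)|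
  exact: L2_measurable Lw].
- apply/measurable_EFinP; apply: measurable_funM; last exact: L2_measurable Lw.
  by apply: measurable_funM; [exact: measurableT_comp|exact: L2_measurable Lu].
- by apply: aeW => x _; apply/cvg_EFin; [exact: nearW|exact: ppt].
- apply: (@integrableZl _ _ _ mu _ measurableT (expR (`|t| * M)) (fun x => `|u x * w x|%:E)).
  exact: integrable_abse Luw.
- by apply: aeW => x n _; rewrite abse_EFin lee_fin -mulrA normrM ler_wpM2r.
move=> If _; rewrite -(fineK (integrable_fin_num measurableT If)).
exact: fine_cvg.
Qed.
End ExponentialSeries.

(** * Forms on subspaces of square-integrable functions *)

Section Subspace.
Variables (R : realType) (V : lmodType R) (W : set V) (WP : linear_subspace W).

(** The proof of linearity is an argument so that the submodule structure can be attached to the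
    predicate; forms that are bilinear on [W] only then become forms on a module. *)
Definition mem_subspace of linear_subspace W : {pred V} := fun u => u \in W.

Lemma mem_subspace_closed : submod_closed (mem_subspace WP).
Proof.
split; first by apply/mem_set; case: WP.
by move=> a u v /set_mem Wu /set_mem Wv; apply/mem_set; case: WP => _; apply.
Qed.

HB.instance Definition _ := GRing.isSubmodClosed.Build R V (mem_subspace WP) mem_subspace_closed.

Definition subspace := {u : V | mem_subspace WP u}.

HB.instance Definition _ := SubChoice.on subspace.
HB.instance Definition _ := [SubChoice_isSubLmodule of subspace by <:].

Lemma subspaceP (u : subspace) : W (val u).
Proof. exact: set_mem (valP u). Qed.

Definition to_subspace u (Wu : W u) : subspace := exist _ u (mem_set Wu).

End Subspace.

Lemma sym_bilinear_restr (R : realType) (V : lmodType R) (W : set V)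
    (WP : linear_subspace W) (B : V -> V -> R) :
  (forall (a : R) u v w, W u -> W v -> W w -> B (a *: u + v) w = a * B u w + B v w) ->
  (forall u v, W u -> W v -> B u v = B v u) ->
  sym_bilinear (fun u v : subspace WP => B (val u) (val v)).
Proof.
move=> Bl Bs; split=> [a u v w|u v]; last by apply: Bs; exact: subspaceP.
by apply: Bl; exact: subspaceP.
Qed.

Lemma sym_bilinear_subspace (R : realType) (V : lmodType R) (W : set V)
    (WP : linear_subspace W) (B : V -> V -> R) : nonneg_sym_bilinear W B ->
  sym_bilinear (fun u v : subspace WP => B (val u) (val v)) /\
  forall u : subspace WP, 0 <= B (val u) (val u).
Proof.
case=> Bl Bs B0; split; last by move=> u; apply: B0; exact: subspaceP.
exact: sym_bilinear_restr.
Qed.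

Lemma nonneg_sym_bilinear_null (R : realType) (V : lmodType R) (W : set V)
    (WP : linear_subspace W) (B : V -> V -> R) : nonneg_sym_bilinear W B ->
  forall u v, W u -> W v -> B u u = 0 -> B u v = 0.
Proof.
move=> /(sym_bilinear_subspace WP)[Bb B0] u v Wu Wv.
exact: (@bil_null _ _ _ Bb B0 (to_subspace WP Wu) (to_subspace WP Wv)).
Qed.

Section L2Space.
Context d (T : measurableType d) (R : realType).
Variable mu : {measure set T -> \bar R}.

Lemma ae_lin (a : R) (u u' v v' : T -> R) : u = u' %[ae mu] -> v = v' %[ae mu] ->
  (fun x => a * u x + v x) = (fun x => a * u' x + v' x) %[ae mu].
Proof. by apply: filterS2 => x hu hv xT; rewrite hu // hv. Qed.

Lemma L2_linear : linear_subspace (L2 mu : set (T -> R^o)).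
Proof. by split=> [|a u v]; [exact: L2_0|exact: L2_lin]. Qed.

Lemma L2dot_bilinear : nonneg_sym_bilinear (L2 mu : set (T -> R^o)) (L2dot mu).
Proof.
split=> [a u v w Lu Lv Lw|u v _ _|u _].
- exact: L2dot_lin.
- exact: L2dotC.
- exact: L2dot_ge0.
Qed.

Local Notation X := (subspace L2_linear).
Let BP := (sym_bilinear_subspace L2_linear L2dot_bilinear).1.
Let B0 := (sym_bilinear_subspace L2_linear L2dot_bilinear).2.

Lemma L2_cauchy_schwarz u v : L2 mu u -> L2 mu v ->
  `|L2dot mu u v| <= L2norm mu u * L2norm mu v.
Proof.
by move=> Lu Lv; exact: (cauchy_schwarz BP B0 (to_subspace L2_linear Lu) (to_subspace L2_linear Lv)).
Qed.

Lemma L2norm_triangle (u v w : T -> R) : L2 mu u -> L2 mu v -> L2 mu w ->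
  L2norm mu (u \- v) <= L2norm mu (u \- w) + L2norm mu (v \- w).
Proof.
move=> Lu Lv Lw; pose s x (Lx : L2 mu x) := to_subspace L2_linear Lx.
have := nrmD BP B0 (s u Lu - s w Lw) (s w Lw - s v Lv).
by rewrite (nrmBC BP (s w Lw)) addrA subrK.
Qed.

End L2Space.

Section FormOnL2.
Context (R : realType) (S : ptopologicalType).
Variables (Ve : set (S -> R)) (E : (S -> R) -> (S -> R) -> R).
Variable mu : {measure set (borel S) -> \bar R}.
Hypothesis VeP : linear_subspace (Ve : set (S -> R^o)).
Hypothesis EP : nonneg_sym_bilinear (Ve : set (S -> R^o)) E.
Hypothesis closedE : densely_defined_closed_form Ve E mu.
Hypothesis compactE : compact_embedding Ve E mu.

Lemma Vmu_L2 u : Vmu Ve mu u -> L2 mu u. Proof. by case. Qed.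

Lemma Vmu_linear : linear_subspace (Vmu Ve mu : set (S -> R^o)).
Proof.
have [V0 Vl] := VeP; split.
  by split; [exact: L2_0|exists 0 => //; exact: ae_eq_refl].
move=> a u v [Lu [u' Vu uu]] [Lv [v' Vv vv]]; split; first exact: L2_lin.
exists (a *: (u' : S -> R^o) + v'); first exact: Vl.
exact: ae_lin.
Qed.

Lemma Ve_reprP u : Vmu Ve mu u -> Ve (Ve_repr Ve mu u) /\ u = Ve_repr Ve mu u %[ae mu].
Proof.
move=> [_ [v Vv uv]].
by have := @xgetPex _ (cst 0) [set u' | Ve u' /\ u = u' %[ae mu]]; apply; exists v.
Qed.

(** The first clause of [closedE] gives [E u u = 0]; Cauchy-Schwarz on [Ve] extends this to all
    [v]. *)
Lemma E_null u v : Ve u -> Ve v -> u = cst 0 %[ae mu] -> E u v = 0.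
Proof.
move=> Vu Vv u0; apply: (nonneg_sym_bilinear_null VeP EP) => //.
by case: closedE => /(_ u Vu u0).
Qed.

Lemma E_ae u u' v v' : Ve u -> Ve u' -> Ve v -> Ve v' ->
  u = u' %[ae mu] -> v = v' %[ae mu] -> E u v = E u' v'.
Proof.
have [El Es _] := EP; have [V0 Vl] := VeP.
have half x x' y : Ve x -> Ve x' -> Ve y -> x = x' %[ae mu] -> E x y = E x' y.
  move=> Vx Vx' Vy xx.
  have Vd := Vl (-1) _ _ Vx' Vx.
  have := E_null Vd Vy _; rewrite El // mulN1r => /(_ _)/eqP.
  move=> h; apply/eqP; rewrite -subr_eq0 addrC; apply: h.
  apply: ae_eq_trans (ae_lin (-1) (@ae_eq_refl _ _ _ mu setT _ x') xx) _.
  by apply: aeW => t _; rewrite mulN1r addNr.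
move=> Vu Vu' Vv Vv' uu vv; rewrite (half u u') // Es // (half v v') // Es //.
Qed.

(** This frees [Emu] from the representatives chosen by [Ve_repr]. *)
Lemma EmuE u u' v v' : Vmu Ve mu u -> Vmu Ve mu v -> Ve u' -> Ve v' ->
  u = u' %[ae mu] -> v = v' %[ae mu] -> Emu Ve E mu u v = E u' v'.
Proof.
move=> Vu Vv Vu' Vv' uu vv.
have [Wu ru] := Ve_reprP Vu; have [Wv rv] := Ve_reprP Vv.
by apply: E_ae => //; [exact: ae_eq_trans (ae_eq_sym ru) uu|exact: ae_eq_trans (ae_eq_sym rv) vv].
Qed.

Lemma Emu_bilinear : nonneg_sym_bilinear (Vmu Ve mu : set (S -> R^o)) (Emu Ve E mu).
Proof.
have [El Es E0] := EP; have [V0 Vl] := VeP.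
split=> [a u v w Vu Vv Vw|u v Vu Vv|u Vu].
- have [Wu ru] := Ve_reprP Vu; have [Wv rv] := Ve_reprP Vv; have [Ww rw] := Ve_reprP Vw.
  rewrite -[RHS]El //; apply: EmuE => //; [|exact: Vl|].
    by case: Vmu_linear => _; apply.
  exact: ae_lin ru rv.
- by have [Wu _] := Ve_reprP Vu; have [Wv _] := Ve_reprP Vv; exact: Es.
- by have [Wu _] := Ve_reprP Vu; exact: E0.
Qed.

Lemma Emu_null u : Vmu Ve mu u -> L2dot mu u u = 0 -> Emu Ve E mu u u = 0.
Proof.
move=> Vu /(L2dot_eq0 (Vmu_L2 Vu)) u0; have [Wu ru] := Ve_reprP Vu.
by apply: E_null => //; exact: ae_eq_trans (ae_eq_sym ru) u0.
Qed.

Lemma Vmu_dot_bilinear : nonneg_sym_bilinear (Vmu Ve mu : set (S -> R^o)) (L2dot mu).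
Proof.
have [dl ds d0] := L2dot_bilinear mu.
split=> [a u v w /Vmu_L2 Lu /Vmu_L2 Lv /Vmu_L2 Lw|u v /Vmu_L2 Lu /Vmu_L2 Lv|u /Vmu_L2 Lu].
- exact: dl.
- exact: ds.
- exact: d0.
Qed.

Local Notation Vspace := (subspace Vmu_linear).

Definition formV (u v : Vspace) : R := Emu Ve E mu (val u) (val v).
Definition dotV (u v : Vspace) : R := L2dot mu (val u) (val v).

Lemma formV_bil : sym_bilinear formV. Proof. exact: (sym_bilinear_subspace Vmu_linear Emu_bilinear).1. Qed.
Lemma formV_ge0 u : 0 <= formV u u. Proof. exact: (sym_bilinear_subspace Vmu_linear Emu_bilinear).2. Qed.

Lemma VspaceP (u : Vspace) : Vmu Ve mu (val u). Proof. exact: subspaceP. Qed.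
Lemma Vspace_L2 (u : Vspace) : L2 mu (val u). Proof. exact/Vmu_L2/VspaceP. Qed.

Lemma dotV_bil : sym_bilinear dotV.
Proof. exact: (sym_bilinear_subspace Vmu_linear Vmu_dot_bilinear).1. Qed.

Lemma dotV_ge0 u : 0 <= dotV u u. Proof. exact: L2dot_ge0. Qed.

Lemma dotV_null u : dotV u u = 0 -> formV u u = 0.
Proof. exact: Emu_null (VspaceP u). Qed.

Lemma Enorm_nrm (u : Vspace) : Enorm Ve E mu (val u) = nrm (graph_form formV dotV) u.
Proof. by rewrite /Enorm /L2norm sqr_sqrtr //; exact: L2dot_ge0. Qed.

Lemma graph_complete : complete_nrm (graph_form formV dotV).
Proof.
move=> w wC; have [_ _ cE] := closedE.
have [n|e e0|w0 Vw0 w0P] := cE (fun n => val (w n)).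
- exact: VspaceP.
- have [N NP] := wC e e0; exists N => m n Nm Nn.
  by have := NP m n Nm Nn; rewrite -Enorm_nrm.
exists (to_subspace Vmu_linear Vw0).
rewrite (_ : (fun _ => _) = (fun n => Enorm Ve E mu ((val (w n) : S -> R^o) - w0))) //.
by apply/funext => n; rewrite -Enorm_nrm.
Qed.

Lemma graph_compact (w : nat -> Vspace) :
  (exists M : R, forall n, nrm (graph_form formV dotV) (w n) <= M) ->
  exists2 k : nat -> nat, (forall n, (k n < k n.+1)%N) & cauchy_nrm dotV (w \o k).
Proof.
move=> [M wM]; have [n||k [w0 Lw0 [kk kP]]] := @compactE (fun n => val (w n)).
- exact: VspaceP.
- by exists M => n; rewrite Enorm_nrm.
exists k => // e e0.
have e2 : 0 < e / 2 by rewrite divr_gt0.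
have /cvgrPdist_lt/(_ _ e2)[N _ NP] := kP.
exists N => m n Nm Nn.
apply: (@le_lt_trans _ _ (L2norm mu (val (w (k m)) \- val (w (k n))))); first by [].
apply: le_lt_trans (L2norm_triangle _ _ Lw0) _; try exact: Vspace_L2.
rewrite [e]splitr ltrD //.
  by have := NP m Nm; rewrite /= sub0r normrN ger0_norm ?sqrtr_ge0.
by have := NP n Nn; rewrite /= sub0r normrN ger0_norm ?sqrtr_ge0.
Qed.

End FormOnL2.

Definition comb (T : Type) (R : realType) r (z : 'I_r -> T -> R) (c : 'I_r -> R) : T -> R :=
  fun x => \sum_j c j * z j x.

Lemma comb_mul (T : Type) (R : realType) r (z : 'I_r -> T -> R) (h : T -> R) c x :
  h x * comb z c x = \sum_j c j * (h x * z j x).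
Proof. by rewrite mulr_sumr; apply: eq_bigr => j _; rewrite mulrCA. Qed.

Section Combinations.
Context d (T : measurableType d) (R : realType).
Variable mu : {measure set T -> \bar R}.
Variables (r : nat) (z : 'I_r -> T -> R).

Local Notation comb := (comb z).

Hypothesis Lz : forall j, L2 mu (z j).

Lemma L2_comb c : L2 mu (comb c).
Proof.
rewrite /comb; elim: (index_enum _) => [|j s IH].
  by under eq_fun do rewrite big_nil; exact: L2_0.
by under eq_fun do rewrite big_cons; exact: L2_lin.
Qed.

Lemma L2dot_comb c w : L2 mu w -> L2dot mu (comb c) w = \sum_j c j * L2dot mu (z j) w.
Proof.
move=> Lw; suff h s : L2 mu (fun x => \sum_(j <- s) c j * z j x) /\
    L2dot mu (fun x => \sum_(j <- s) c j * z j x) w = \sum_(j <- s) c j * L2dot mu (z j) w.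
  by case: (h (index_enum 'I_r)).
elim: s => [|j s [IH1 IH2]].
  under eq_fun do rewrite big_nil; split; first exact: L2_0.
  by rewrite big_nil L2dot0l.
under eq_fun do rewrite big_cons; split; first exact: L2_lin.
by rewrite L2dot_lin // IH2 big_cons.
Qed.

(** A row base of [kermx M^T], that is, of the column kernel of [M], gives a basis of [W], and
    independence of the [z j] modulo null sets makes coordinates unique. This converts ranks into
    multiplicities for both the tilted operators and the response operator. *)
Lemma dim_kernel (W : set (T -> R)) (M : 'M[R]_r) :
  (forall c : 'cV_r, M *m c = 0 -> W (comb (c^~ 0))) ->
  (forall u, W u -> exists2 c : 'cV_r, M *m c = 0 & u = comb (c^~ 0) %[ae mu]) ->
  (forall c, comb c = cst 0 %[ae mu] -> forall j, c j = 0) ->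
  L2dim mu W (r - \rank M).
Proof.
move=> W1 W2 free; rewrite -mxrank_tr -mxrank_ker.
pose K := row_base (kermx M^T).
have MK : M *m K^T = 0.
  apply: trmx_inj; rewrite trmx_mul trmxK trmx0; apply: sub_kermxP.
  by rewrite eq_row_base.
have combK (a : 'rV_(\rank (kermx M^T))) x :
    \sum_i a 0 i * comb (K i) x = comb ((a *m K) 0) x.
  rewrite /comb; under eq_bigr do rewrite mulr_sumr.
  rewrite exchange_big; apply: eq_bigr => j _; rewrite mxE mulr_suml.
  by apply: eq_bigr => i _; rewrite mulrA.
exists (fun i => comb (K i)); split.
  move=> i; have -> : comb (K i) = comb ((col i K^T)^~ 0).
    by congr comb; apply/funext => j; rewrite !mxE.
  by apply: W1; rewrite colE mulmxA MK mul0mx.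
move=> u /W2[c Mc uc].
have /submxP[a ca] : (c^T <= K)%MS.
  by rewrite eq_row_base; apply/sub_kermxP; rewrite -trmx_mul Mc trmx0.
have uE : u = (fun x => \sum_i a 0 i * comb (K i) x) %[ae mu].
  apply: ae_eq_trans uc _; apply: aeW => x _; rewrite combK -ca.
  by congr (comb _ x); apply/funext => j; rewrite mxE.
exists [ffun i => a 0 i]; split.
  by apply: ae_eq_trans uE _; apply: aeW => x _; apply: eq_bigr => i _; rewrite ffunE.
move=> b ub; pose b' := \row_i b i.
have h : comb (((a - b') *m K) 0) = cst 0 %[ae mu].
  apply: filterS2 uE ub => x /(_ I) h1 /(_ I) h2 _.
  rewrite -combK; under eq_bigr do rewrite !mxE mulrBl.
  by rewrite sumrB -h1 h2 subrr.
have : (a - b') *m K = 0 by apply/rowP => j; rewrite (free _ h) mxE.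
move/eqP; rewrite mulmx_free_eq0 ?row_base_free // subr_eq0 => /eqP ->.
by apply/ffunP => i; rewrite ffunE mxE.
Qed.

End Combinations.

Section WeightedForms.
Context (R : realType) (S : ptopologicalType).
Variables (Ve : set (S -> R)).
Variable mu : {measure set (borel S) -> \bar R}.
Hypothesis VeP : linear_subspace (Ve : set (S -> R^o)).
Local Notation Vspace := (subspace (Vmu_linear mu VeP)).

(** The weight will be a Taylor coefficient of [expR (t * h)] or this exponential itself. *)
Definition wdot (c : S -> R) (u v : Vspace) : R :=
  L2dot mu (fun x => c x * val u x) (val v).

Variable M : R.

Lemma wdot_bil (c : borel S -> R) : measurable_fun setT c -> (forall x, `|c x| <= M) ->
  sym_bilinear (wdot c).
Proof.
move=> mc cM; have Lc u : Vmu Ve mu u -> L2 mu (fun x => c x * u x).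
  by move=> /Vmu_L2; exact: L2_bounded_mul mc cM.
apply: (sym_bilinear_restr (Vmu_linear mu VeP) (B := fun u v => L2dot mu (fun x => c x * u x) v)).
  move=> a u v w Vu Vv /Vmu_L2 Lw; rewrite -(L2dot_lin a (Lc u Vu) (Lc v Vv) Lw).
  congr (L2dot mu _ _); apply/funext => x.
  by rewrite mulrCA -mulrDr.
by move=> u v _ _; rewrite /L2dot; apply: eq_Rintegral => x _; rewrite mulrAC mulrC mulrA.
Qed.

Lemma wdot_le (c : borel S -> R) u v : measurable_fun setT c -> (forall x, `|c x| <= M) ->
  `|wdot c u v| <= M * (nrm (@dotV _ _ Ve mu VeP) u * nrm (@dotV _ _ Ve mu VeP) v).
Proof.
move=> mc cM; have M0 : 0 <= M := le_trans (normr_ge0 _) (cM point).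
have Lc := L2_bounded_mul mc cM (Vspace_L2 u).
apply: le_trans (L2_cauchy_schwarz Lc (Vspace_L2 v)) _.
rewrite mulrA ler_wpM2r ?sqrtr_ge0 //.
rewrite -(ger0_norm M0) -sqrtr_sqr -sqrtrM ?sqr_ge0 // ler_wsqrtr //.
exact: L2dot_bounded_mul (Vspace_L2 u).
Qed.

End WeightedForms.

(** * The tilted operators and the response operator *)

Section Application.
Context (R : realType) (S : ptopologicalType) (D : tilt_stable_form_data R S).
Variable mu : {measure set (borel S) -> \bar R}.
Hypothesis hmu : Madm D mu.
Variable f : {mfun (borel S) >-> R}.
Variable M : R.
Hypothesis fM : forall x, `|f x| <= M.
Implicit Types (u v w : S -> R) (t Lam nu : R).

Let VeP := Ve_linear D.
Local Notation Vm := (Vmu (Ve D) mu).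
Local Notation Em := (Emu (Ve D) (Eform D) mu).
Let h x := kappa D * f x.
(** The added 1 makes the bound strictly positive even when [M = 0]. *)
Let Bd := `|kappa D * M| + 1.

Lemma tilt_potential_measurable : measurable_fun (setT : set (borel S)) h.
Proof. exact: measurable_funM. Qed.

Lemma tilt_potential_bounded x : `|h x| <= Bd.
Proof.
rewrite /h /Bd !normrM; apply: le_trans (_ : _ <= `|kappa D| * `|M|) _; last by rewrite lerDl.
by rewrite ler_wpM2l // (le_trans (fM x)) // ler_norm.
Qed.

Lemma exp_weight_measurable t : measurable_fun (setT : set (borel S)) (fun x => expR (t * h x)).
Proof. by apply: measurableT_comp => //; apply: measurable_funM => //; exact: tilt_potential_measurable. Qed.

Lemma exp_weight_bounded t x : `|expR (t * h x)| <= expR (`|t| * Bd).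
Proof.
rewrite ger0_norm ?expR_ge0 // ler_expR; apply: le_trans (ler_norm _) _.
by rewrite normrM ler_wpM2l // tilt_potential_bounded.
Qed.

Lemma tilted_bounded t x : `|((kappa D * t) *: f) x| <= `|t| * Bd.
Proof.
have -> : ((kappa D * t) *: f) x = t * h x by rewrite -[LHS]/(kappa D * t * f x) /h; ring.
by rewrite normrM ler_wpM2l // tilt_potential_bounded.
Qed.

Lemma Vmu_tilted t : Vmu (Ve D) (tilted D mu f t) = Vm.
Proof.
apply/seteqP; split=> u [Lu [v Vv uv]]; split.
- exact: (L2_tilt mu (tilted_bounded t) u).1 Lu.
- by exists v => //; exact: (tilt_ae_eq mu (tilted_bounded t) _ _).1 uv.
- exact: (L2_tilt mu (tilted_bounded t) u).2 Lu.
- by exists v => //; exact: (tilt_ae_eq mu (tilted_bounded t) _ _).2 uv.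
Qed.

(** The null sets agree, so [xget] is applied to the same set of representatives for both measures
    and makes the same choice. *)
Lemma Emu_tilted t u v : Emu (Ve D) (Eform D) (tilted D mu f t) u v = Em u v.
Proof.
have rE w : Ve_repr (Ve D) (tilted D mu f t) w = Ve_repr (Ve D) mu w.
  congr xget; apply/seteqP; split=> x [Vx wx]; split => //.
    exact: (tilt_ae_eq mu (tilted_bounded t) _ _).1 wx.
  exact: (tilt_ae_eq mu (tilted_bounded t) _ _).2 wx.
by rewrite /Emu !rE.
Qed.

Lemma eigspE nu u : eigsp D mu nu u <->
  Vm u /\ forall w, Vm w -> Em u w = nu * L2dot mu u w.
Proof.
split=> [[Vu _ uE]|[Vu uE]].
  by split=> // w Vw; rewrite uE // (L2dotZ nu (Vmu_L2 Vu) (Vmu_L2 Vw)).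
split=> //; first exact: L2Z (Vmu_L2 Vu).
by move=> w Vw; rewrite uE // (L2dotZ nu (Vmu_L2 Vu) (Vmu_L2 Vw)).
Qed.

Lemma eigsp_tilted t nu u : eigsp D (tilted D mu f t) nu u <->
  Vm u /\ forall w, Vm w -> Em u w = nu * L2dot mu (fun x => expR (t * h x) * u x) w.
Proof.
have gE x : ((kappa D * t) *: f) x = t * h x by rewrite -[LHS]/(kappa D * t * f x) /h; ring.
have Le u' : Vm u' -> L2 mu (fun x => expR (t * h x) * u' x).
  by move=> /Vmu_L2; apply: L2_bounded_mul (exp_weight_measurable t) (exp_weight_bounded t).
have dE w : Vm u -> Vm w -> L2dot (tilted D mu f t) (fun x => nu * u x) w =
    nu * L2dot mu (fun x => expR (t * h x) * u x) w.
  move=> Vu Vw; have Lu := Vmu_L2 Vu; have Lw := Vmu_L2 Vw.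
  rewrite /tilted (L2dot_tilt _ (L2Z nu Lu) Lw) -(L2dotZ nu (Le u Vu) Lw).
  by congr (L2dot mu _ w); apply/funext => x; rewrite gE mulrCA.
split=> [[]|[Vu uE]].
  rewrite Vmu_tilted => Vu _ uE; split => // w Vw.
  by rewrite -dE // -uE ?Vmu_tilted // Emu_tilted.
split; first by rewrite Vmu_tilted.
  by apply/(L2_tilt mu (tilted_bounded t) _); exact: L2Z (Vmu_L2 Vu).
by rewrite Vmu_tilted => w Vw; rewrite Emu_tilted dE // uE.
Qed.

Lemma hatA_eigspace t nu v : op_eigenspace (hatA D mu f t) nu v <->
  exists2 u, eigsp D (tilted D mu f t) nu u & v = Utilt D f t u.
Proof.
split=> [[u1 [u2 [Au vE nuvE]]]|[u Au ->]]; last first.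
  exists u, (fun x => nu * u x); split => //.
  by apply/funext => x; rewrite /Utilt mulrCA.
(* [Utilt] multiplies by a positive function, so the equality holds at every point and not only
   almost everywhere. *)
exists u1 => //; suff e : (fun x => nu * u1 x) = u2 by rewrite /eigsp /op_eigenspace /= e.
apply/funext => x; have := congr1 (fun g => g x) nuvE.
rewrite vE /Utilt mulrCA; by apply: mulfI; rewrite gt_eqF ?expR_gt0.
Qed.

Lemma orthonormal_coord Lam r (phi : 'I_r -> S -> R) (u : S -> R) :
  orthonormal_basis mu (eigsp D mu Lam) phi -> eigsp D mu Lam u ->
  u = comb phi (fun i => L2dot mu u (phi i)) %[ae mu].
Proof.
move=> [phiE phi_orth phi_span] Eu; have [c uc] := phi_span u Eu.
have Lphi i : L2 mu (phi i) by have /eigspE[/Vmu_L2] := phiE i.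
have Lu : L2 mu u by have /eigspE[/Vmu_L2] := Eu.
suff -> : (fun i => L2dot mu u (phi i)) = c by [].
apply/funext => i; rewrite (L2dot_ae Lu (L2_comb Lphi c) (Lphi i) (Lphi i) uc (ae_eq_refl _ _ _)).
rewrite (L2dot_comb Lphi c (Lphi i)) (bigD1 i) //= phi_orth eqxx mulr1 big1 ?addr0 //.
by move=> j ji; rewrite phi_orth (negPf ji) mulr0.
Qed.

Lemma eigsp_comb Lam r (phi : 'I_r -> S -> R) (c : 'I_r -> R) :
  (forall i, eigsp D mu Lam (phi i)) -> eigsp D mu Lam (comb phi c).
Proof.
move=> phiE; rewrite /comb; have [El _ _] := Emu_bilinear VeP (E_form D) (form_closed hmu).
have [V0 Vl] := Vmu_linear mu VeP.
elim: (index_enum _) => [|j s IH].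
  under eq_fun do rewrite big_nil; apply/eigspE; split => // w Vw.
  have := El (-1) 0 0 w V0 V0 Vw; rewrite scaler0 add0r mulN1r addNr => ->.
  by rewrite (_ : L2dot mu _ w = 0) ?mulr0 //; exact: L2dot0l.
under eq_fun do rewrite big_cons; move/eigspE: IH => [Vs sE].
have /eigspE[Vj jE] := phiE j.
apply/eigspE; split; first exact: Vl.
move=> w Vw; have Lw := Vmu_L2 Vw.
rewrite (L2dot_lin (c j) (Vmu_L2 Vj) (Vmu_L2 Vs) Lw) mulrDr mulrCA -jE // -sE //.
exact: El.
Qed.

Section Response.
Variables (Lam : R) (r : nat) (phi : 'I_r -> S -> R).
Hypothesis phiB : orthonormal_basis mu (eigsp D mu Lam) phi.

Let phiE i : eigsp D mu Lam (phi i). Proof. by case: phiB. Qed.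
Let phi_orth i j : L2dot mu (phi i) (phi j) = (i == j)%:R. Proof. by case: phiB. Qed.
Let Lphi i : L2 mu (phi i). Proof. by have /eigspE[/Vmu_L2] := phiE i. Qed.

Lemma L2_potential u : L2 mu u -> L2 mu (f \* u).
Proof. exact: L2_bounded_mul fM. Qed.

Lemma orth_projP u : L2 mu u -> eigsp D mu Lam (orth_proj mu (eigsp D mu Lam) u) /\
  forall i, L2dot mu (orth_proj mu (eigsp D mu Lam) u) (phi i) = L2dot mu u (phi i).
Proof.
move=> Lu; pose c i := L2dot mu u (phi i).
have cE i : L2dot mu (comb phi c) (phi i) = c i.
  rewrite (L2dot_comb Lphi c (Lphi i)) (bigD1 i) //= phi_orth eqxx mulr1 big1 ?addr0 //.
  by move=> j ji; rewrite phi_orth (negPf ji) mulr0.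
have dB w v : L2 mu w -> L2 mu v -> L2dot mu (u \- w) v = L2dot mu u v - L2dot mu w v.
  move=> Lw Lv; rewrite -mulN1r addrC -(L2dot_lin (-1) Lw Lu Lv).
  by congr (L2dot mu _ v); apply/funext => x /=; rewrite mulN1r addrC.
have [PE Porth] : [set w | eigsp D mu Lam w /\
    forall v, eigsp D mu Lam v -> L2dot mu (u \- w) v = 0] (orth_proj mu (eigsp D mu Lam) u).
  (* The witness is the combination of [phi] with the Fourier coefficients of [u]. *)
  apply: (xgetPex (cst 0)); exists (comb phi c); split; first exact: eigsp_comb.
  move=> v Ev; have Lv : L2 mu v by have /eigspE[/Vmu_L2] := Ev.
  have Lc := L2_comb Lphi c.
  have Lv' := L2_comb Lphi (fun i => L2dot mu v (phi i)).
  have Lur : L2 mu (u \- comb phi c).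
    have := L2_lin (-1) Lc Lu; congr L2.
    by apply/funext => x /=; rewrite mulN1r addrC.
  rewrite (L2dot_ae Lur Lur Lv Lv' (ae_eq_refl _ _ _) (orthonormal_coord phiB Ev)).
  rewrite L2dotC (L2dot_comb Lphi _ Lur) big1 // => i _.
  by rewrite [X in _ * X]L2dotC dB // cE subrr mulr0.
have LP : L2 mu (orth_proj mu (eigsp D mu Lam) u) by have /eigspE[/Vmu_L2] := PE.
split=> // i; have := Porth _ (phiE i); rewrite dB // => /eqP.
by rewrite subr_eq0 => /eqP ->.
Qed.

Lemma L2dot_response u i : L2 mu u ->
  L2dot mu (response D mu f Lam u) (phi i) = - kappa D * Lam * L2dot mu (f \* u) (phi i).
Proof.
move=> Lu; have [PE Pphi] := orth_projP (L2_potential Lu).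
by rewrite -Pphi -L2dotZ //; have /eigspE[/Vmu_L2] := PE.
Qed.

Lemma response_matrix : response_matrix_formula D mu f Lam phi.
Proof.
apply/matrixP => i j; rewrite !mxE L2dot_response //; congr (_ * _).
by rewrite /L2dot; apply: eq_Rintegral => x _ /=; rewrite mulrAC.
Qed.

(** [A] is the matrix of the response operator in the basis [phi], so kernel vectors of [A - nu%:M]
    are the coordinates of its eigenvectors. *)
Lemma response_spectrum_rank (A : 'M[R]_r) (s : 'I_r -> R) :
  (forall i j, A i j = - kappa D * Lam * L2dot mu (f \* phi j) (phi i)) ->
  (forall nu, \rank (A - nu%:M) = (r - #|[pred j | s j == nu]|)%N) ->
  response_spectrum D mu f Lam s.
Proof.
move=> AE Ar nu.
have -> : #|[pred j | s j == nu]| = (r - \rank (A - nu%:M)%R)%N.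
  by rewrite Ar subKn // -[X in (_ <= X)%N]card_ord max_card.
have Ac (c : 'I_r -> R) i : (A *m \col_j c j) i 0 =
    L2dot mu (response D mu f Lam (comb phi c)) (phi i).
  rewrite L2dot_response; last exact: L2_comb.
  have -> : f \* comb phi c = comb (fun j => f \* phi j) c.
    by apply/funext => x; exact: comb_mul.
  rewrite (L2dot_comb _ c (Lphi i)); last by move=> j; exact: L2_potential.
  by rewrite mxE mulr_sumr; apply: eq_bigr => j _; rewrite AE mxE; ring.
have kerE (c : 'I_r -> R) : (A - nu%:M) *m (\col_j c j) = 0 <->
    forall i, L2dot mu (response D mu f Lam (comb phi c)) (phi i) = nu * c i.
  rewrite mulmxBl mul_scalar_mx; split=> [/eqP|ce].
    by rewrite subr_eq0 => /eqP/matrixP ce i; rewrite -Ac ce !mxE.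
  by apply/eqP; rewrite subr_eq0; apply/eqP/matrixP => i j; rewrite !ord1 Ac ce !mxE.
have colE (c : 'cV[R]_r) : \col_j c j 0 = c by apply/colP => j; rewrite mxE.
have resp_eig u : L2 mu u -> eigsp D mu Lam (response D mu f Lam u).
  move=> /L2_potential/orth_projP[PE _].
  have := @eigsp_comb Lam 1 (fun _ => orth_proj mu (eigsp D mu Lam) (f \* u))
    (fun _ => - kappa D * Lam) (fun _ => PE).
  by congr eigsp; apply/funext => x; rewrite /comb big_ord1.
apply: (@dim_kernel _ (borel S) R mu r phi _ (A - nu%:M)).
- move=> c /esym Mc; have {}Mc := esym Mc; rewrite -(colE c) in Mc.
  have /kerE ce := Mc.
  have Ec := eigsp_comb (c^~ 0) phiE.
  split=> //.
  apply: ae_eq_sym; apply: ae_eq_trans (orthonormal_coord phiB (resp_eig _ (L2_comb Lphi _))) _.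
  apply: aeW => x _; rewrite /comb mulr_sumr; apply: eq_bigr => j _.
  by rewrite ce mulrA.
- move=> u [Eu uE]; have Lu : L2 mu u by have /eigspE[/Vmu_L2] := Eu.
  pose c i := L2dot mu u (phi i).
  have uc : u = comb phi c %[ae mu] := orthonormal_coord phiB Eu.
  exists (\col_j c j); last first.
    apply: ae_eq_trans uc _; apply: aeW => x _; congr (comb _ _ x).
    by apply/funext => j; rewrite mxE.
  apply/kerE => i; rewrite L2dot_response; last exact: L2_comb.
  have Lf := L2_potential.
  have -> : L2dot mu (f \* comb phi c) (phi i) = L2dot mu (f \* u) (phi i).
    apply: L2dot_ae => //; try exact: Lf.
      exact: Lf (L2_comb _ _).
      exact: ae_eq_mul2l (ae_eq_sym uc).
    exact: ae_eq_refl.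
  rewrite -L2dot_response // /c -L2dotZ //.
  apply: L2dot_ae => //; [|exact: L2Z|exact: ae_eq_sym|exact: ae_eq_refl].
  by have /eigspE[/Vmu_L2] := resp_eig u Lu.
- move=> c c0 i.
  have := L2dot_ae (L2_comb Lphi c) (L2_0 mu) (Lphi i) (Lphi i) c0 (ae_eq_refl _ _ _).
  rewrite L2dot0l (L2dot_comb Lphi c (Lphi i)) (bigD1 i) //= phi_orth eqxx mulr1 big1 ?addr0 //.
  by move=> j ji; rewrite phi_orth (negPf ji) mulr0.
Qed.

End Response.

End Application.

Lemma val_sum (R : realType) (V : lmodType R) (W : set V) (WP : linear_subspace W)
    (r : nat) (c : 'I_r -> R) (z : 'I_r -> subspace WP) :
  val (\sum_j c j *: z j) = \sum_j c j *: val (z j).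
Proof. by rewrite raddf_sum; apply: eq_bigr => j _; exact: linearZ. Qed.

Lemma sum_fun (T : Type) (R : realType) (r : nat) (c : 'I_r -> R) (z : 'I_r -> (T -> R^o)) :
  \sum_j c j *: z j = comb z c.
Proof.
rewrite /comb; apply/funext => x; elim: (index_enum _) => [|j s IH]; first by rewrite !big_nil.
by rewrite !big_cons -IH.
Qed.

Theorem proposition3p2 (R : realType) (S : ptopologicalType)
    (D : tilt_stable_form_data R S)
    (mu : {measure set (borel S) -> \bar R}) (hmu : Madm D mu)
    (Lam : R) (hLam : 0 < Lam)
    (r : nat) (hr : eigenvalue_of_mult D mu Lam r)
    (phi : 'I_r -> S -> R)
    (hphi : orthonormal_basis mu (eigsp D mu Lam) phi)
    (f : {mfun (borel S) >-> R}) (hf : Hreg D f) :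
  exists (eps : R) (lam : 'I_r -> R -> R),
    [/\ 0 < eps,
        (forall j, real_analytic_on [set tau | `|tau| < eps] (lam j)),
        lists_eigenvalues_from D mu f Lam eps lam,
        response_matrix_formula D mu f Lam phi
      & response_spectrum D mu f Lam (fun j => derive1 (lam j) 0)] /\
    (* independence of the choice of basis *)
    (forall psi : 'I_r -> S -> R,
       orthonormal_basis mu (eigsp D mu Lam) psi ->
       response_matrix_formula D mu f Lam psi).
Proof.
have [M fM] := Hreg_bounded hf.
pose VeP := Ve_linear D; pose X := subspace (Vmu_linear mu VeP).
have [phiE phi_orth phi_span] := hphi.
have phiV i : Vmu (Ve D) mu (phi i) by have /eigspE[] := phiE i.
pose phi' i : X := to_subspace (Vmu_linear mu VeP) (phiV i).
pose h x := kappa D * f x; pose Bd := `|kappa D * M| + 1.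
have mh : measurable_fun (setT : set (borel S)) h := tilt_potential_measurable D f.
have hB x : `|h x| <= Bd := tilt_potential_bounded D fM x.
have Bd0 : 0 < Bd by apply: ltr_wpDl => //.
(* These are the Taylor coefficients in [t] of [expR (t * h x)]. *)
pose c k (x : borel S) := h x ^+ k / k`!%:R.
have mc k : measurable_fun setT (c k).
  by apply: measurable_funM => //; exact: measurable_funX.
have cB k x : `|c k x| <= Bd ^+ k.
  rewrite /c normrM normrX -[leRHS]mulr1 ler_pM //.
    by rewrite lerXn2r // nnegrE ltW.
  by rewrite normfV ger0_norm ?ler0n // invf_le1 ?ltr0n ?fact_gt0 // ler1n fact_gt0.
have EP := E_form D; have cE := form_closed hmu.
have phi_eig i (w : X) : formV (Eform D) (phi' i) w = Lam * dotV (phi' i) w.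
  by have /eigspE[_ ] := phiE i; apply; exact: VspaceP.
have phi_null (u : X) : (forall w : X, formV (Eform D) u w = Lam * dotV u w) ->
    (forall i, dotV u (phi' i) = 0) -> dotV u u = 0.
  move=> uE u0; apply/(L2dot_eq0 (Vspace_L2 u)).
  have Eu : eigsp D mu Lam (val u).
    by apply/eigspE; split=> [|w Vw]; [exact: VspaceP|exact: uE (to_subspace (Vmu_linear mu VeP) Vw)].
  apply: ae_eq_trans (orthonormal_coord hphi Eu) _; apply: aeW => x _.
  by rewrite /comb big1 // => i _; rewrite [L2dot _ _ _]u0 mul0r.
have mkS k : sym_bilinear (wdot (mu := mu) (VeP := VeP) (c k)) := wdot_bil mu VeP (mc k) (cB k).
have mk0 (u w : X) : wdot (c 0%N) u w = dotV u w.
  congr (L2dot mu _ _); apply/funext => x.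
  by rewrite /c expr0 fact0 divr1 mul1r.
have mkB k (u w : X) :
    `|wdot (c k) u w| <= Bd ^+ k * (nrm (dotV (VeP := VeP)) u * nrm (dotV (VeP := VeP)) w).
  exact: wdot_le (mc k) (cB k).
have mtP t (u w : X) :
    series (fun k => wdot (c k) u w * t ^+ k) @ \oo --> wdot (fun x => expR (t * h x)) u w.
  have := @L2dot_exp_series _ _ _ mu h Bd mh hB t _ _ (Vspace_L2 u) (Vspace_L2 w); exact.
have [eps [dl [lam [A1 [L [z [[eps0 dl0] lam_an lam0 lamP [A1E A1r]]]]]]]] :=
  rellich (formV_bil VeP EP cE) (formV_ge0 EP cE) (dotV_bil mu VeP) (dotV_ge0 (VeP := VeP))
    (graph_complete cE) (graph_compact (form_compact hmu)) (dotV_null EP cE) (ltW hLam)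
    phi_eig phi_orth phi_null mkS mk0 Bd0 mkB mtP.
have Lphi i : L2 mu (phi i) := Vmu_L2 (phiV i).
exists eps, lam; split; last by move=> psi; exact: (response_matrix hmu fM).
split => //; last 2 first.
- exact: (response_matrix hmu fM).
(* The weight of order 1 is [kappa D * f], so that [A1] is the matrix of the response operator. *)
- apply: (response_spectrum_rank hmu fM hphi) A1r => i j; rewrite A1E.
  have -> : wdot (c 1%N) (phi' j) (phi' i) = kappa D * L2dot mu (f \* phi j) (phi i).
    rewrite -(L2dotZ (kappa D) (L2_potential fM (Lphi j)) (Lphi i)).
    congr (L2dot mu _ _); apply/funext => x.
    by rewrite /c expr1 divr1 /h mulrA.
  by ring.
split => //; exists dl => // t te; have [lamd Lr zb zeig zspan] := lamP t te.
split=> // nu nudl.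
have -> : #|[pred j | lam j t == nu]| = (r - \rank (L t - nu%:M)%R)%N.
  by rewrite Lr subKn // -[X in (_ <= X)%N]card_ord max_card.
have combE (cc : 'I_r -> R) : val (\sum_j cc j *: z t j) = comb (fun j => val (z t j)) cc.
  by rewrite val_sum sum_fun.
have UE cc : comb (fun j => Utilt D f t (val (z t j))) cc =
    Utilt D f t (comb (fun j => val (z t j)) cc).
  by apply/funext => x; rewrite /Utilt (comb_mul _ (fun x => expR (kappa D * t * f x / 2))).
have tE u := @eigsp_tilted R S D mu f M fM t nu u.
have Lz j : L2 mu (val (z t j)) by exact: Vspace_L2.
(* Eigenvectors of the conjugated operator are the images under [Utilt] of combinations of [z t]
   with coordinates in the kernel of [L t - nu%:M]. *)
apply: (@dim_kernel _ (borel S) R mu r (fun j => Utilt D f t (val (z t j))) _ (L t - nu%:M)).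
- move=> cc Lc; apply/hatA_eigspace; rewrite UE; exists (comb (fun j => val (z t j)) (cc^~ 0)) => //.
  apply/tE; rewrite -combE; split; first exact: VspaceP.
  move=> w Vw; exact: (zeig nu cc Lc (to_subspace (Vmu_linear mu VeP) Vw)).
- move=> v /hatA_eigspace[u /tE[Vu uE] ->].
  pose u' : X := to_subspace (Vmu_linear mu VeP) Vu.
  have [w|cc Lc ucc] := zspan nu u' nudl; first exact: uE (VspaceP w).
  exists cc => //; rewrite UE.
  have /(L2dot_eq0 (Vspace_L2 _)) := ucc.
  apply: filterS => x /(_ I) hx _; rewrite /Utilt -combE.
  by congr (_ * _); apply/eqP; rewrite -subr_eq0; apply/eqP.
(* Independence: the positive factor of [Utilt] cancels, and pairing with [phi i] isolates the
   coordinate [i] by the normalization of [z t]. *)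
- move=> cc cc0 i.
  have c0 : comb (fun j => val (z t j)) cc = cst 0 %[ae mu].
    apply: filterS cc0 => x /[apply]; rewrite UE /Utilt => /eqP.
    by rewrite mulf_eq0 gt_eqF ?expR_gt0 //= => /eqP.
  have := L2dot_ae (L2_comb Lz cc) (L2_0 mu) (Lphi i) (Lphi i) c0 (ae_eq_refl _ _ _).
  rewrite L2dot0l (L2dot_comb Lz cc (Lphi i)) (bigD1 i) //= [L2dot _ _ _](zb i i) eqxx mulr1 big1 ?addr0 //.
  by move=> j ji; rewrite [L2dot _ _ _](zb i j) eq_sym (negPf ji) mulr0.
Qed.
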